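(* Let $M$ be a connected $2n$-dimensional manifold with an almost complex structure $J$. Then the following conditions are equivalent: (i) there exist vector fields $X_1,\dots,X_n,JX_1,\dots,JX_n$ on $M$, linearly independent at every point of $M$, such that $$[X_k,X_l]=[JX_k,JX_l],\qquad [JX_k,X_l]=-[X_k,JX_l],\qquad k<l;$$ (ii) there exist $n$ commuting (complex) vector fields $Z_1,\dots,Z_n$ which are linearly independent sections of $T^{1,0}M$ at every point of $M$; (iii) there exist $n$ $(1,0)$-forms $\alpha_1,\dots,\alpha_n$ on $M$, linearly independent at every point of $M$, such that $d\alpha_i$ is a section of $\Lambda^{1,1}M$ for every $i$; (iv) there exists a complex connection $\nabla$ on $M$ with trivial holonomy whose torsion tensor field $T$ is of type $(1,1)$. Moreover, any one of the conditions (i), (ii), (iii), (iv) implies that $J$ is integrable.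
   Context: $J$ is integrable if its Nijenhuis tensor $N(X,Y)=[JX,JY]-J[X,JY]-J[JX,Y]-[X,Y]$ vanishes identically. $T^{1,0}M\subset TM\otimes\mathbb{C}$ is the $i$-eigenbundle of $J$, and $\Lambda^{p,q}M$ is the bundle of complex forms of type $(p,q)$ with respect to $J$; linear independence of $(1,0)$ vector fields and forms is over $\mathbb{C}$. A complex connection is an affine connection $\nabla$ with $\nabla J=0$. It has trivial holonomy if parallel transport along every loop is the identity. The torsion is $T(X,Y)=\nabla_XY-\nabla_YX-[X,Y]$, and it is of type $(1,1)$ with respect to $J$ if $T(JX,JY)=T(X,Y)$ for all vector fields $X,Y$. *)

(* Defs.v *)
From HB Require Import structures.
From mathcomp Require Export all_boot all_order all_algebra.
From mathcomp Require Export all_classical all_reals all_analysis.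
From mathcomp Require Export complex.
Export numFieldNormedType.Exports.

Set Implicit Arguments.
Unset Strict Implicit.
Unset Printing Implicit Defensive.

Import Order.TTheory GRing.Theory Num.Theory.

Local Open Scope classical_set_scope.
Local Open Scope ring_scope.

Fixpoint Ck_on (R : realType) (V W : normedModType R) (U : set V) (k : nat)
    (f : V -> W) : Prop :=
  if k is k'.+1 then
    (forall x, U x -> differentiable f x) /\ (forall v, Ck_on U k' ('D_v f))
  else forall x, U x -> {for x, continuous f}.

Definition smooth_on (R : realType) (V W : normedModType R) (U : set V)
    (f : V -> W) : Prop :=
  forall k, Ck_on U k f.

(* Smooth (C^oo) manifold of dimension m without boundary.  The maps [coord c]
   and [param c] are total, but only meaningful on [dom c] and on its image.
   The chart [chart_at p] around p is fixed once and for all: it serves to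
   represent the tangent space at p, see below. *)
Record manifold (R : realType) (m : nat) := Manifold {
  carrier :> topologicalType ;
  carrier_hausdorff : hausdorff_space carrier ;
  carrier_countable : @second_countable carrier ;
  chart : Type ;
  dom : chart -> set carrier ;
  coord : chart -> carrier -> 'rV[R]_m ;
  param : chart -> 'rV[R]_m -> carrier ;
  chart_at : carrier -> chart ;
  chart_atP : forall p, dom (chart_at p) p ;
  dom_open : forall c, open (dom c) ;
  coord_open : forall c, open (coord c @` dom c) ;
  coordK : forall c p, dom c p -> param c (coord c p) = p ;
  coord_continuous : forall c p, dom c p -> {for p, continuous (coord c)} ;
  param_continuous : forall c x, (coord c @` dom c) x ->
    {for x, continuous (param c)} ;
  transition_smooth : forall c d,
    smooth_on (coord c @` (dom c `&` dom d)) (coord d \o param c)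
}.

Section Manifold.
Context {R : realType} {m : nat} {M : manifold R m}.
Local Notation C := (complex R).
Local Notation toC := (real_complex R).
Local Notation vec := 'rV[R]_m.

Definition chart_image (c : chart M) : set vec := coord c @` dom c.

Definition transition_jac (c d : chart M) (p : M) : 'M[R]_m :=
  'J (coord d \o param c) (coord c p).

(* A tangent vector at p is the row v of its components in the coordinates
   given by [chart_at p], that is, v stands for \sum_i v_i d/dx^i at p.  Its
   components in another chart c are v *m transition_jac (chart_at p) c p.
   Likewise, an endomorphism of the tangent space at p is a matrix acting on
   rows from the right, a complex covector at p is a column a, with value
   v *m a on v, and a complex bilinear form at p is a matrix w, with value
   u *m w *m v^T on (u, v). *)

Definition smooth_fun (f : M -> R) : Prop :=
  forall c, smooth_on (chart_image c) (f \o param c : vec -> R^o).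

Definition dirder (f : M -> R) (p : M) (v : vec) : R :=
  'D_v (f \o param (chart_at p) : vec -> R^o) (coord (chart_at p) p).

Definition field_rep (c : chart M) (X : M -> vec) (x : vec) : vec :=
  let p := param c x in X p *m transition_jac (chart_at p) c p.

Definition smooth_field (X : M -> vec) : Prop :=
  forall c, smooth_on (chart_image c) (field_rep c X).

(* In coordinates, [X,Y]^j = \sum_i X^i d_i Y^j - Y^i d_i X^j. *)
Definition bracket (X Y : M -> vec) (p : M) : vec :=
  let c := chart_at p in
  'D_(X p) (field_rep c Y) (coord c p) - 'D_(Y p) (field_rep c X) (coord c p).

Definition endo_rep (c : chart M) (A : M -> 'M[R]_m) (x : vec) : 'M[R]_m :=
  let p := param c x in
  transition_jac c (chart_at p) p *m A p *m transition_jac (chart_at p) c p.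

Definition smooth_endo (A : M -> 'M[R]_m) : Prop :=
  forall c, smooth_on (chart_image c) (endo_rep c A).

Definition almost_complex (J : M -> 'M[R]_m) : Prop :=
  smooth_endo J /\ forall p, J p *m J p = - 1%:M.

Definition endo_app (J : M -> 'M[R]_m) (X : M -> vec) : M -> vec :=
  fun p => X p *m J p.

Definition nijenhuis (J : M -> 'M[R]_m) (X Y : M -> vec) (p : M) : vec :=
  bracket (endo_app J X) (endo_app J Y) p
  - endo_app J (bracket X (endo_app J Y)) p
  - endo_app J (bracket (endo_app J X) Y) p
  - bracket X Y p.

Definition integrable_acs (J : M -> 'M[R]_m) : Prop :=
  forall X Y, smooth_field X -> smooth_field Y ->
  forall p, nijenhuis J X Y p = 0.

Definition re_field (Z : M -> 'rV[C]_m) : M -> vec :=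
  fun p => map_mx (@complex.Re R) (Z p).

Definition im_field (Z : M -> 'rV[C]_m) : M -> vec :=
  fun p => map_mx (@complex.Im R) (Z p).

Definition smooth_cfield (Z : M -> 'rV[C]_m) : Prop :=
  smooth_field (re_field Z) /\ smooth_field (im_field Z).

(* C-bilinear extension of the bracket: the real and imaginary parts of
   [A + iB, A' + iB']. *)
Definition cbracket (Z W : M -> 'rV[C]_m) (p : M) : 'rV[C]_m :=
  map2_mx (@Complex R)
    (bracket (re_field Z) (re_field W) p - bracket (im_field Z) (im_field W) p)
    (bracket (re_field Z) (im_field W) p + bracket (im_field Z) (re_field W) p).

Definition T10 (J : M -> 'M[R]_m) (p : M) (z : 'rV[C]_m) : Prop :=
  z *m map_mx toC (J p) = ('i)%C *: z.

Definition T01 (J : M -> 'M[R]_m) (p : M) (z : 'rV[C]_m) : Prop :=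
  z *m map_mx toC (J p) = - ('i)%C *: z.

Definition form_rep (c : chart M) (alpha : M -> 'cV[C]_m) (x : vec) :
    'cV[C]_m :=
  let p := param c x in
  map_mx toC (transition_jac c (chart_at p) p) *m alpha p.

Definition smooth_form (alpha : M -> 'cV[C]_m) : Prop :=
  forall c,
    smooth_on (chart_image c)
      (fun x => map_mx (@complex.Re R) (form_rep c alpha x)) /\
    smooth_on (chart_image c)
      (fun x => map_mx (@complex.Im R) (form_rep c alpha x)).

Definition cpartial (g : vec -> C) (i : 'I_m) (x : vec) : C :=
  Complex ('D_(delta_mx 0 i) (fun y => complex.Re (g y) : R^o) x)
          ('D_(delta_mx 0 i) (fun y => complex.Im (g y) : R^o) x).

(* (d alpha)_ij = d_i alpha_j - d_j alpha_i. *)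
Definition ext_der (alpha : M -> 'cV[C]_m) (p : M) : 'M[C]_m :=
  let c := chart_at p in
  \matrix_(i, j)
    (cpartial (fun y => form_rep c alpha y j 0) i (coord c p)
     - cpartial (fun y => form_rep c alpha y i 0) j (coord c p)).

Definition Lambda10 (J : M -> 'M[R]_m) (p : M) (a : 'cV[C]_m) : Prop :=
  forall z, T01 J p z -> z *m a = 0.

Definition Lambda01 (J : M -> 'M[R]_m) (p : M) (a : 'cV[C]_m) : Prop :=
  forall z, T10 J p z -> z *m a = 0.

Definition wedge (a b : 'cV[C]_m) : 'M[C]_m := a *m b^T - b *m a^T.

Definition Lambda11 (J : M -> 'M[R]_m) (p : M) (w : 'M[C]_m) : Prop :=
  exists N (a b : 'I_N -> 'cV[C]_m),
    [/\ forall k, Lambda10 J p (a k), forall k, Lambda01 J p (b k)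
      & w = \sum_k wedge (a k) (b k)].

(* [nabla p v X] is the derivative of the field X at p along v; it is only
   meaningful for smooth X. *)
Definition connection (nabla : M -> vec -> (M -> vec) -> vec) : Prop :=
  [/\ forall p X, smooth_field X -> linear (fun v => nabla p v X),
      forall p v X Y, smooth_field X -> smooth_field Y ->
        nabla p v (fun q => X q + Y q) = nabla p v X + nabla p v Y,
      forall p v f X, smooth_fun f -> smooth_field X ->
        nabla p v (fun q => f q *: X q) =
          dirder f p v *: X p + f p *: nabla p v X
    & forall X Y, smooth_field X -> smooth_field Y ->
        smooth_field (fun p => nabla p (X p) Y)].

(* nabla J = 0, where (nabla_v J) X = nabla_v (J X) - J (nabla_v X). *)
Definition complex_connection (J : M -> 'M[R]_m)
    (nabla : M -> vec -> (M -> vec) -> vec) : Prop :=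
  connection nabla /\
  forall p v X, smooth_field X ->
    nabla p v (endo_app J X) - nabla p v X *m J p = 0.

Definition torsion (nabla : M -> vec -> (M -> vec) -> vec)
    (X Y : M -> vec) (p : M) : vec :=
  nabla p (X p) Y - nabla p (Y p) X - bracket X Y p.

Definition torsion11 (J : M -> 'M[R]_m)
    (nabla : M -> vec -> (M -> vec) -> vec) : Prop :=
  forall X Y, smooth_field X -> smooth_field Y ->
  forall p,
    torsion nabla (endo_app J X) (endo_app J Y) p = torsion nabla X Y p.

Definition smooth_curve (sigma : R -> M) : Prop :=
  continuous sigma /\
  forall c, smooth_on (sigma @^-1` dom c) (coord c \o sigma : R^o -> vec).

Definition velocity (sigma : R -> M) (t : R) : vec :=
  derive1 (coord (chart_at (sigma t)) \o sigma) t.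

(* w is the covariant derivative at time t of the field V along sigma: the
   operator determined by the Leibniz rule and by its value
   nabla_(sigma'(t)) X on fields of the form X \o sigma. *)
Definition cov_der (nabla : M -> vec -> (M -> vec) -> vec)
    (sigma : R -> M) (V : R -> vec) (t : R) (w : vec) : Prop :=
  exists N (g : 'I_N -> R -> R) (X : 'I_N -> M -> vec),
    [/\ forall k, smooth_on [set: R^o] (g k : R^o -> R^o),
        forall k, smooth_field (X k),
        \forall s \near t, V s = \sum_k g k s *: X k (sigma s)
      & w = \sum_k (derive1 (g k : R -> R^o) t *: X k (sigma t)
                    + g k t *: nabla (sigma t) (velocity sigma t) (X k))].

(* Parallel transport along sigma from time 0 to time 1, as the graph of a
   map. *)
Definition curve_transport (nabla : M -> vec -> (M -> vec) -> vec)
    (sigma : R -> M) (u v : vec) : Prop :=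
  exists V : R -> vec,
    [/\ forall t, cov_der nabla sigma V t 0, V 0 = u & V 1 = v].

(* A piecewise smooth path is a list of smooth curves, each run from time 0 to
   time 1 (a smooth curve on [0, 1] always extends smoothly to the line up to
   reparametrisation outside [0, 1]). *)
Fixpoint piecewise_path (p : M) (s : seq (R -> M)) (q : M) : Prop :=
  if s is sigma :: s' then
    [/\ smooth_curve sigma, sigma 0 = p & piecewise_path (sigma 1) s' q]
  else p = q.

Fixpoint transport (nabla : M -> vec -> (M -> vec) -> vec)
    (s : seq (R -> M)) (u v : vec) : Prop :=
  if s is sigma :: s' then
    exists2 w, curve_transport nabla sigma u w & transport nabla s' w v
  else u = v.

Definition trivial_holonomy (nabla : M -> vec -> (M -> vec) -> vec) : Prop :=
  forall p s, piecewise_path p s p ->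
  forall u v, transport nabla s u v <-> u = v.

End Manifold.

(* Main.v *)
From HB Require Import structures.
Require Import Defs.
From mathcomp Require Import ring lra.

Set Implicit Arguments.
Unset Strict Implicit.
Unset Printing Implicit Defensive.

Import Order.TTheory GRing.Theory Num.Theory.

Local Open Scope classical_set_scope.
Local Open Scope ring_scope.

(** The four conditions all describe a flat structure adapted to [J].

   A frame [X_1, ..., X_n, J X_1, ..., J X_n] is the same thing as the frame
   [Z_k = X_k - i J X_k] of the bundle of (1,0) vectors, and
     [Z_k, Z_l] = [X_k, X_l] - [J X_k, J X_l]
                  - i ([J X_k, X_l] + [X_k, J X_l]),
   so the relations in (i) say that the [Z_k] commute ([cbracket_T10]). The
   formula d a (X, Y) = X (a Y) - Y (a X) - a [X, Y], applied to the coframe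
   dual to the [Z_k] and their conjugates, on which the first two terms vanish,
   turns this into the vanishing of the (2,0) and (0,2) parts of the exterior
   derivatives ([dual_coframe_invariant], [invariant_Lambda11]). A coframe of
   forms a_k as in (iii) defines a flat connection, the one that
   differentiates the components of vector fields in the real coframe
   (Re a_k, Im a_k). Its parallel transport preserves these components, hence
   depends only on the end points ([flat_transport]), and its torsion has the
   components d a_k ([flat_torsion11]).

   The deep step is from (iv) to (i). Parallel transport from a base point [p0]
   along arbitrary paths gives a frame [par_frame], and fields with constant
   components in it are parallel. For parallel fields the torsion is
   T (X, Y) = - [X, Y], and J maps parallel fields to parallel fields; hence a
   torsion of type (1,1) gives the relations of (i) for the parallel extension
   of a complex basis at [p0] ([adapted_basis]). Two points need care.

   - The frame [par_frame] is a priori just a family of vectors. Existence of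
     transport is part of the hypothesis on holonomy, since a loop can be made
     of any path followed by its reverse; so no existence theorem for
     differential equations is involved. Along each curve the components of
     [par_frame] in a smooth local frame solve a linear equation. A Gronwall
     estimate shows that they are continuous ([continuous_along]), the mean
     value inequality that they are differentiable ([differentiable_along]),
     and the equation itself then gives all derivatives ([smooth_on_along]).

   - The connection is an operator on global fields. That it acts through the
     components in a local frame, with the Leibniz rule, follows by
     multiplication with bump functions ([nabla_frame]), which are built from
     the flat function exp (-1/x) ([bump_function]).

   Integrability follows from (iv), because the Nijenhuis tensor of J is
     T (X, Y) - T (J X, J Y) + J (T (J X, Y) + T (X, J Y))
   for the torsion T of any complex connection ([torsion11_integrable]). *)

(** * Smooth functions *)

Section SmoothFunctions.
Context {R : realType}.
Implicit Types V W Y : normedModType R.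

(** The epsilon form of differentiability, in which the candidate for the
   differential can be any continuous linear map. *)
Lemma differentiable_eps V W (f : V -> W) (df : {linear V -> W}) x :
  continuous df ->
  (forall e, 0 < e -> \forall h \near 0, `|f (h + x) - f x - df h| <= e * `|h|) ->
  differentiable f x /\ 'd f x = df :> (V -> W).
Proof.
move=> cdf H.
have E : f \o shift x = cst (f x) + df +o_ 0 id.
  apply/eqaddoP => e e0; near=> h.
  rewrite -[X in `|X|]/(f (h + x) - (f x + df h)) opprD addrA.
  by near: h; exact: H.
have dE := diff_unique cdf E.
by split=> //; apply/diff_locallyP; rewrite dE.
Unshelve. all: by end_near. Qed.

Lemma differentiable_near V W (f g : V -> W) x :
  (\near x, f x = g x) -> differentiable f x -> differentiable g x.
Proof.
move=> fg df; have [c E] := (diff_locallyP _ _).1 df.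
apply: (proj1 (@differentiable_eps _ _ g ('d f x) x c _)) => e e0.
have fgx := nbhs_singleton fg.
have fg' : \forall h \near (0 : V), f (h + x) = g (h + x).
  by rewrite (near_shift x); near=> z; rewrite /= sub0r addrNK; near: z.
have /eqaddoP/(_ _ e0) H := E; near=> h.
rewrite -fgx -(near fg' h) // -addrA -opprD.
by near: h; exact: H.
Unshelve. all: by end_near. Qed.

(** The condition is pointwise in the set, so smoothness can be checked near each
   point, with a different formula for the function at each place. *)
Lemma Ck_onP V W (U : set V) k (f : V -> W) :
  Ck_on U k f <-> forall x, U x -> Ck_on [set x] k f.
Proof.
elim: k f => [|k IH] f /=.
  by split=> [h x Ux y ->|h x Ux]; [exact: h|exact: (h x Ux)].
split=> [[df h] x Ux|h].
  split=> [y ->|v]; first exact: df.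
  by have /IH := h v; exact.
split=> [x Ux|v]; first by have [df _] := h x Ux; exact: df.
by apply/IH => x Ux; have [_] := h x Ux; exact.
Qed.

(** At each order, agreement near [x] passes to the derivatives, because functions
   that agree near [x] agree near all the points close to [x]. *)
Lemma Ck_on_near V W k x (f g : V -> W) :
  (\near x, f x = g x) -> Ck_on [set x] k f -> Ck_on [set x] k g.
Proof.
elim: k f g => [|k IH] f g fg /=.
  move=> h y ->; have fgx := nbhs_singleton fg.
  have /= cf := h x erefl.
  have : f y @[y --> x] --> g x by rewrite -fgx; exact: cf.
  by apply: cvg_trans; exact: near_eq_cvg.
move=> [df h]; split=> [y -> {y}|v].
  by apply: differentiable_near fg _; exact: df.
apply: IH (h v).
have : \forall y \near x, \near y, f y = g y by exact: near_join.
by apply: filterS => y; exact: near_eq_derive.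
Qed.

Lemma Ck_on_subset V W (U U' : set V) k (f : V -> W) :
  U' `<=` U -> Ck_on U k f -> Ck_on U' k f.
Proof. by move=> sU /Ck_onP h; apply/Ck_onP => x /sU; exact: h. Qed.

Lemma smooth_on_subset V W (U U' : set V) (f : V -> W) :
  U' `<=` U -> smooth_on U f -> smooth_on U' f.
Proof. by move=> sU h k; exact: Ck_on_subset (h k). Qed.

Lemma open_nearP V (U : set V) x (P : V -> Prop) :
  open U -> U x -> (forall y, U y -> P y) -> \near x, P x.
Proof.
by move=> oU Ux h; apply: filterS h _; exact: open_nbhs_nbhs.
Qed.

Lemma Ck_on_eq V W (U : set V) k (f g : V -> W) :
  open U -> (forall x, U x -> f x = g x) -> Ck_on U k f -> Ck_on U k g.
Proof.
move=> oU fg /Ck_onP h; apply/Ck_onP => x Ux; apply: Ck_on_near (h _ Ux).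
exact: open_nearP fg.
Qed.

Lemma smooth_on_eq V W (U : set V) (f g : V -> W) :
  open U -> (forall x, U x -> f x = g x) -> smooth_on U f -> smooth_on U g.
Proof. by move=> oU fg h k; exact: Ck_on_eq (h k). Qed.

Lemma smooth_on_near V W (U : set V) (f : V -> W) :
  (forall x, U x -> exists g U', [/\ nbhs x (U' : set V), smooth_on U' g &
     forall y, U' y -> g y = f y]) -> smooth_on U f.
Proof.
move=> h k; apply/Ck_onP => x /h [g [U' [nU sg gf]]].
apply: Ck_on_near (Ck_on_subset _ (sg k)); first exact: filterS nU.
by move=> y ->; exact: nbhs_singleton.
Qed.

Lemma Ck_on_diff V W (U : set V) k (f : V -> W) x :
  Ck_on U k.+1 f -> U x -> differentiable f x.
Proof. by move=> [h _]; exact: h. Qed.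

Lemma Ck_onS V W (U : set V) k (f : V -> W) : Ck_on U k.+1 f -> Ck_on U k f.
Proof.
elim: k f => [|k IH] f [df h]; last by split=> // v; apply: IH.
by move=> x /df; exact: differentiable_continuous.
Qed.

Lemma smooth_on_diff V W (U : set V) (f : V -> W) x :
  smooth_on U f -> U x -> differentiable f x.
Proof. by move=> h; exact: Ck_on_diff (h 1%N). Qed.

Lemma smooth_on_cont V W (U : set V) (f : V -> W) x :
  smooth_on U f -> U x -> {for x, continuous f}.
Proof. by move=> h Ux; exact: (h 0%N). Qed.

Lemma smooth_on_D V W (U : set V) (f : V -> W) v :
  smooth_on U f -> smooth_on U ('D_v f).
Proof. by move=> h k; have [_] := h k.+1; exact. Qed.

Lemma Ck_on_cst V W (U : set V) k (a : W) : Ck_on U k (fun=> a : W).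
Proof.
elim: k a => [|k IH] a /=; first by move=> x _; exact: cvg_cst.
split=> [x _|v]; first exact: differentiable_cst.
rewrite (_ : 'D_v _ = fun=> 0 : W); first exact: IH.
by apply/funext => x; exact: derive_cst.
Qed.

Lemma smooth_on_cst V W (U : set V) (a : W) : smooth_on U (fun=> a : W).
Proof. by move=> k; exact: Ck_on_cst. Qed.

Lemma smooth_on_linear V W (U : set V) (f : {linear V -> W}) :
  continuous f -> smooth_on U f.
Proof.
move=> cf [|k] /=; first by move=> x _; exact: cf.
split=> [x _|v]; first exact: linear_differentiable.
rewrite (_ : 'D_v _ = fun=> f v); first exact: Ck_on_cst.
apply/funext => x; rewrite deriveE; last exact: linear_differentiable.
by rewrite diff_lin.
Qed.

Lemma smooth_on_coord m n (U : set 'M[R]_(m, n)) i j :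
  smooth_on U (fun A => A i j : R^o).
Proof.
have lin : linear (fun A : 'M[R]_(m, n) => A i j : R^o).
  by move=> k A B; rewrite !mxE.
pose f := HB.pack_for {linear 'M[R]_(m, n) -> R^o}
  (fun A : 'M[R]_(m, n) => A i j : R^o) (GRing.isLinear.Build _ _ _ _ _ lin).
by apply: (@smooth_on_linear _ _ U f) => x; exact: matrix_normedtype.coord_continuous.
Qed.

Lemma Ck_onD V W (U : set V) k (f g : V -> W) : open U ->
  Ck_on U k f -> Ck_on U k g -> Ck_on U k (fun x => f x + g x).
Proof.
move=> oU; elim: k f g => [|k IH] f g /=.
  by move=> cf cg x Ux; apply: cvgD; [exact: cf|exact: cg].
move=> [df Hf] [dg Hg]; split=> [x Ux|v].
  by apply: differentiableD; [exact: df|exact: dg].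
apply: Ck_on_eq (IH _ _ (Hf v) (Hg v)) => // x Ux /=.
by rewrite deriveD //; apply: diff_derivable; [exact: df|exact: dg].
Qed.

Lemma Ck_onM V (U : set V) k (f g : V -> R^o) : open U ->
  Ck_on U k f -> Ck_on U k g -> Ck_on U k (fun x => f x * g x : R^o).
Proof.
move=> oU; elim: k f g => [|k IH] f g.
  by move=> cf cg x Ux; apply: cvgM; [exact: cf|exact: cg].
move=> Hf Hg; have [df Df] := Hf; have [dg Dg] := Hg.
split=> [x Ux|v].
  by apply: differentiableM; [exact: df|exact: dg].
have H := Ck_onD oU (IH _ _ (Ck_onS Hf) (Dg v)) (IH _ _ (Ck_onS Hg) (Df v)).
apply: Ck_on_eq H => // x Ux /=.
by rewrite deriveM //; apply: diff_derivable; [exact: df|exact: dg].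
Qed.

Lemma Ck_onV V (U : set V) k (f : V -> R^o) : open U ->
  (forall x, U x -> f x != 0) -> Ck_on U k f ->
  Ck_on U k (fun x => (f x)^-1 : R^o).
Proof.
move=> oU f0; elim: k => [|k IH].
  by move=> cf x Ux; exact: (cvgV (f0 _ Ux) (cf _ Ux)).
move=> Hf; have [df Df] := Hf; have Hi := IH (Ck_onS Hf).
split=> [x Ux|v].
  exact: (differentiableV (df _ Ux) (f0 _ Ux)).
have H := Ck_onM oU (@Ck_on_cst V R^o U k (-1)) (Ck_onM oU (Ck_onM oU Hi Hi) (Df v)).
apply: Ck_on_eq H => // x Ux /=.
rewrite deriveV; [|exact: f0|by apply: diff_derivable; exact: df].
by rewrite -exprVn /GRing.scale /= mulN1r -mulNr expr2.
Qed.

Lemma smooth_onD V W (U : set V) (f g : V -> W) : open U ->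
  smooth_on U f -> smooth_on U g -> smooth_on U (fun x => f x + g x).
Proof. by move=> oU hf hg k; exact: Ck_onD. Qed.

Lemma smooth_onM V (U : set V) (f g : V -> R^o) : open U ->
  smooth_on U f -> smooth_on U g -> smooth_on U (fun x => f x * g x : R^o).
Proof. by move=> oU hf hg k; exact: Ck_onM. Qed.

Lemma smooth_onV V (U : set V) (f : V -> R^o) : open U ->
  (forall x, U x -> f x != 0) -> smooth_on U f ->
  smooth_on U (fun x => (f x)^-1 : R^o).
Proof. by move=> oU f0 hf k; exact: Ck_onV. Qed.

Lemma smooth_onN V (U : set V) (f : V -> R^o) : open U ->
  smooth_on U f -> smooth_on U (fun x => - f x : R^o).
Proof.
move=> oU hf; apply: (@smooth_on_eq _ _ _ (fun x => -1 * f x : R^o)) => //.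
  by move=> x _; rewrite mulN1r.
by apply: smooth_onM => //; exact: smooth_on_cst.
Qed.

Lemma Ck_on_sum V W (U : set V) k I (s : seq I) (P : pred I)
    (f : I -> V -> W) :
  open U -> (forall i, P i -> Ck_on U k (f i)) ->
  Ck_on U k (fun x => \sum_(i <- s | P i) f i x).
Proof.
move=> oU h; elim: s => [|i s IH].
  apply: (Ck_on_eq oU _ (@Ck_on_cst V W U k 0)) => x _.
  by rewrite big_nil.
case: (boolP (P i)) => Pi.
  apply: (Ck_on_eq oU _ (Ck_onD oU (h i Pi) IH)) => x _.
  by rewrite big_cons Pi.
by apply: (Ck_on_eq oU _ IH) => x _; rewrite big_cons (negbTE Pi).
Qed.

Lemma smooth_on_sum V W (U : set V) I (s : seq I) (P : pred I)
    (f : I -> V -> W) :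
  open U -> (forall i, P i -> smooth_on U (f i)) ->
  smooth_on U (fun x => \sum_(i <- s | P i) f i x).
Proof. by move=> oU h k; apply: Ck_on_sum => // i Pi; exact: h. Qed.

Lemma smooth_on_prod V (U : set V) I (s : seq I) (f : I -> V -> R^o) :
  open U -> (forall i, smooth_on U (f i)) ->
  smooth_on U (fun x => \prod_(i <- s) f i x : R^o).
Proof.
move=> oU h; elim: s => [|i s IH].
  apply: (smooth_on_eq oU _ (@smooth_on_cst V R^o U 1)) => x _.
  by rewrite big_nil.
apply: (smooth_on_eq oU _ (smooth_onM oU (h i) IH)) => x _.
by rewrite big_cons.
Qed.

Lemma differentiable_mx V m n (f : V -> 'M[R]_(m, n)) x :
  (forall i j, differentiable (fun x => f x i j : R^o) x) ->
  differentiable f x.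
Proof.
move=> h.
rewrite (_ : f = \sum_i \sum_j (fun x => f x i j *: delta_mx i j)).
  apply: differentiable_sum => i; apply: differentiable_sum => j.
  exact: differentiableZl.
apply/funext => y; rewrite fct_sumE {1}(matrix_sum_delta (f y)).
by apply: eq_bigr => i _; rewrite fct_sumE.
Qed.

Lemma Ck_on_mxP V m n (U : set V) k (f : V -> 'M[R]_(m, n)) : open U ->
  Ck_on U k f <-> forall i j, Ck_on U k (fun x => f x i j : R^o).
Proof.
move=> oU; elim: k f => [|k IH] f.
  split=> [cf i j x Ux|cf x Ux]; last first.
    apply/cvgrPdist_le => e e0; near=> y.
    rewrite /Num.Def.normr/= mx_normrE (bigmax_le _ (ltW e0))//= => i _.
    rewrite !mxE; move: i; near: y; apply: filter_forall => -[i j].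
    by move: e e0; apply/cvgrPdist_le; exact: cf.
  apply: (@continuous_comp _ _ _ f (fun A => A i j)); first exact: cf.
  exact: matrix_normedtype.coord_continuous.
have E v : (forall x, U x -> derivable f x v) -> forall i j x, U x ->
    ('D_v f) x i j = 'D_v (fun x => f x i j : R^o) x.
  by move=> dv i j x Ux; rewrite derive_mx ?mxE //; exact: dv.
split=> [[df Df] i j|h].
  split=> [x Ux|v].
    apply: (@differentiable_comp _ _ _ _ f (fun A => A i j : R^o)).
      exact: df.
    exact: differentiable_coord.
  apply: Ck_on_eq ((IH _).1 (Df v) i j) => // x Ux.
  by apply: E => // y Uy; apply: diff_derivable; exact: df.
have df x : U x -> differentiable f x.
  by move=> Ux; apply: differentiable_mx => i j; have [d _] := h i j; exact: d.
split=> // v; apply/IH => i j.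
have [_ /(_ v) H] := h i j.
apply: Ck_on_eq H => // x Ux.
by rewrite E // => y Uy; apply: diff_derivable; exact: df.
Unshelve. all: by end_near. Qed.

End SmoothFunctions.

(** * Composition, products and inverses *)

Section SmoothComposition.
Context {R : realType}.
Implicit Types V W Y : normedModType R.

Lemma derive_comp V Y W (f : Y -> W) (g : V -> Y) x v :
  differentiable g x -> differentiable f (g x) ->
  'D_v (f \o g) x = 'D_('D_v g x) f (g x).
Proof.
move=> dg df.
rewrite (deriveE v (differentiable_comp dg df)) (deriveE _ df) (deriveE v dg).
by rewrite diff_comp.
Qed.

Lemma derive_span V W (f : V -> W) x N (l : 'I_N -> R) (e : 'I_N -> V) :
  differentiable f x ->
  'D_(\sum_i l i *: e i) f x = \sum_i l i *: 'D_(e i) f x.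
Proof.
move=> df; rewrite deriveE // linear_sum.
by apply: eq_bigr => i _; rewrite linearZ deriveE.
Qed.

(** The chain rule expresses a derivative of [f \o g] by partial derivatives of
   [f] composed with [g], so the induction on the order needs [f] with real
   values and a source of finite dimension: here it has the basis [e], with
   coordinates [l]. The cases of interest are row vectors and real numbers. *)
Lemma smooth_on_comp_basis V Y (U : set V) (U' : set Y) (f : Y -> R^o)
    (g : V -> Y) N (e : 'I_N -> Y) (l : 'I_N -> Y -> R^o) :
  (forall y, y = \sum_i l i y *: e i) ->
  (forall i k (h : V -> Y), Ck_on U k h -> Ck_on U k (fun x => l i (h x))) ->
  open U -> (forall x, U x -> U' (g x)) ->
  smooth_on U' f -> smooth_on U g -> smooth_on U (fun x => f (g x) : R^o).
Proof.
move=> ly hl oU gU hf hg k; elim: k f hf => [|k IH] f hf.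
  move=> x Ux; apply: (@continuous_comp _ _ _ g f).
    exact: smooth_on_cont hg Ux.
  exact: smooth_on_cont hf (gU _ Ux).
have df x : U x -> differentiable f (g x) by move=> /gU; exact: smooth_on_diff.
have dg x : U x -> differentiable g x by exact: smooth_on_diff.
split=> [x Ux|v].
  by apply: (@differentiable_comp _ _ _ _ g f); [exact: dg|exact: df].
have H : Ck_on U k (fun x => \sum_(i < N) l i ('D_v g x) * 'D_(e i) f (g x) : R^o).
  elim: (index_enum _) => [|i s IHs].
    by apply: (Ck_on_eq oU _ (@Ck_on_cst R V R^o U k 0)) => x _; rewrite big_nil.
  have h1 := hl i k _ (smooth_on_D v hg k).
  have h2 := IH _ (smooth_on_D (e i) hf).
  apply: (Ck_on_eq oU _ (Ck_onD oU (Ck_onM oU h1 h2) IHs)) => x _.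
  by rewrite big_cons.
apply: Ck_on_eq H => // x Ux.
rewrite (derive_comp v (dg _ Ux) (df _ Ux)) [in RHS](ly ('D_v g x)).
by rewrite derive_span //; exact: df.
Qed.

Lemma smooth_on_mxP V m n (U : set V) (f : V -> 'M[R]_(m, n)) : open U ->
  smooth_on U f <-> forall i j, smooth_on U (fun x => f x i j : R^o).
Proof.
move=> oU; split=> [h i j k|h k].
  by apply: (Ck_on_mxP k f oU).1; exact: h.
by apply/(Ck_on_mxP k f oU) => i j; exact: h.
Qed.

Lemma smooth_on_comp_rV V m (U : set V) (U' : set 'rV[R]_m)
    (f : 'rV[R]_m -> R^o) (g : V -> 'rV[R]_m) :
  open U -> (forall x, U x -> U' (g x)) ->
  smooth_on U' f -> smooth_on U g -> smooth_on U (fun x => f (g x) : R^o).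
Proof.
move=> oU; apply: (@smooth_on_comp_basis V 'rV[R]_m U U' f g m
  (fun i => delta_mx 0 i) (fun i y => y 0 i)) => // [y|i k h hh].
  exact: row_sum_delta.
exact: (Ck_on_mxP k h oU).1 hh 0 i.
Qed.

Lemma smooth_on_comp_R V (U : set V) (U' : set R^o) (f : R^o -> R^o)
    (g : V -> R^o) :
  open U -> (forall x, U x -> U' (g x)) ->
  smooth_on U' f -> smooth_on U g -> smooth_on U (fun x => f (g x) : R^o).
Proof.
move=> oU; apply: (@smooth_on_comp_basis V R^o U U' f g 1
  (fun=> 1 : R^o) (fun i y => y)) => // y.
by rewrite big_ord1 /GRing.scale /= mulr1.
Qed.

Lemma smooth_on_comp_rV_mx V m a b (U : set V) (U' : set 'rV[R]_m)
    (f : 'rV[R]_m -> 'M[R]_(a, b)) (g : V -> 'rV[R]_m) :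
  open U -> open U' -> (forall x, U x -> U' (g x)) ->
  smooth_on U' f -> smooth_on U g -> smooth_on U (fun x => f (g x)).
Proof.
move=> oU oU' gU hf hg; apply/smooth_on_mxP => // i j.
apply: (smooth_on_comp_rV (U' := U') (f := fun y => f y i j : R^o)) => //.
exact: (smooth_on_mxP f oU').1 hf i j.
Qed.

Lemma Ck_on_mulmx V a b c (U : set V) k (f : V -> 'M[R]_(a, b))
    (g : V -> 'M[R]_(b, c)) : open U ->
  Ck_on U k f -> Ck_on U k g -> Ck_on U k (fun x => f x *m g x).
Proof.
move=> oU hf hg; apply/Ck_on_mxP => // i j.
have H : Ck_on U k (fun x => \sum_l f x i l * g x l j : R^o).
  apply: Ck_on_sum => // l _; apply: Ck_onM => //.
    exact: (Ck_on_mxP k f oU).1 hf i l.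
  exact: (Ck_on_mxP k g oU).1 hg l j.
by apply: Ck_on_eq H => // x _; rewrite mxE.
Qed.

Lemma smooth_on_mulmx V a b c (U : set V) (f : V -> 'M[R]_(a, b))
    (g : V -> 'M[R]_(b, c)) : open U ->
  smooth_on U f -> smooth_on U g -> smooth_on U (fun x => f x *m g x).
Proof. by move=> oU hf hg k; exact: Ck_on_mulmx. Qed.

Lemma Ck_onZ V a b (U : set V) k (f : V -> R^o) (g : V -> 'M[R]_(a, b)) :
  open U -> Ck_on U k f -> Ck_on U k g -> Ck_on U k (fun x => f x *: g x).
Proof.
move=> oU hf hg; apply/Ck_on_mxP => // i j.
have := Ck_onM oU hf ((Ck_on_mxP k g oU).1 hg i j).
by apply: Ck_on_eq => // x _; rewrite mxE.
Qed.

Lemma smooth_onZ V a b (U : set V) (f : V -> R^o) (g : V -> 'M[R]_(a, b)) :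
  open U -> smooth_on U f -> smooth_on U g -> smooth_on U (fun x => f x *: g x).
Proof. by move=> oU hf hg k; exact: Ck_onZ. Qed.

Lemma smooth_on_det V n (U : set V) (f : V -> 'M[R]_n) : open U ->
  smooth_on U f -> smooth_on U (fun x => \det (f x) : R^o).
Proof.
move=> oU hf; apply: smooth_on_sum => // s _; apply: smooth_onM => //.
  exact: smooth_on_cst.
apply: smooth_on_prod => // i.
exact: (smooth_on_mxP f oU).1 hf i _.
Qed.

(** Cramer's rule. *)
Lemma smooth_on_invmx V n (U : set V) (f : V -> 'M[R]_n) : open U ->
  (forall x, U x -> f x \in unitmx) ->
  smooth_on U f -> smooth_on U (fun x => invmx (f x)).
Proof.
move=> oU fu hf; have hd := smooth_on_det oU hf.
have d0 x : U x -> \det (f x) != 0.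
  by move=> /fu; rewrite unitmxE unitfE.
have hi := smooth_onV oU d0 hd.
have ha : smooth_on U (fun x => \adj (f x)).
  apply/smooth_on_mxP => // i j.
  have H : smooth_on U (fun x => (-1) ^+ (j + i) *
      \det (row' j (col' i (f x))) : R^o).
    apply: smooth_onM => //; first exact: smooth_on_cst.
    apply: smooth_on_det => //; apply/smooth_on_mxP => // a b.
    have := (smooth_on_mxP f oU).1 hf (lift j a) (lift i b).
    by apply: smooth_on_eq => // x _; rewrite !mxE.
  by apply: smooth_on_eq H => // x _; rewrite mxE.
apply: smooth_on_eq (smooth_onZ oU hi ha) => // x Ux.
by rewrite /invmx fu.
Qed.

Lemma derive_mulmx V a b c (f : V -> 'M[R]_(a, b)) (g : V -> 'M[R]_(b, c)) x v :
  derivable f x v -> derivable g x v ->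
  derivable (fun y => f y *m g y) x v /\
  'D_v (fun y => f y *m g y) x = 'D_v f x *m g x + f x *m 'D_v g x.
Proof.
move=> df dg.
have dfE i j := (derivable_mxP f x v).1 df i j.
have dgE i j := (derivable_mxP g x v).1 dg i j.
pose F i j k := (fun y => f y i k : R) * (fun y => g y k j : R).
have E i j : (fun y => (f y *m g y) i j) = \sum_k F i j k.
  by apply/funext => y; rewrite mxE fct_sumE.
have dF i j k : derivable (F i j k) x v by apply: derivableM; [exact: dfE|exact: dgE].
have d : derivable (fun y => f y *m g y) x v.
  apply/derivable_mxP => i j; rewrite E.
  exact: derivable_sum.
split=> //; rewrite derive_mx //; apply/matrixP => i j; rewrite !mxE E.
rewrite derive_sum // -big_split; apply: eq_bigr => k _ /=.
rewrite deriveM // (derive_mx df) (derive_mx dg) !mxE /GRing.scale /=.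
by rewrite addrC; congr (_ + _); rewrite mulrC.
Qed.

Lemma is_derive_scalemx V a b (f : V -> R^o) (g : V -> 'M[R]_(a, b)) x v
    (df : R) (dg : 'M[R]_(a, b)) :
  is_derive x v f df -> is_derive x v g dg ->
  is_derive x v (fun y => f y *: g y) (df *: g x + f x *: dg).
Proof.
move=> [f1 f2] [g1 g2].
have gE i j := (derivable_mxP g x v).1 g1 i j.
pose G i j := (fun y => f y : R) * (fun y => g y i j : R).
have E i j : (fun y => (f y *: g y) i j) = G i j.
  by apply/funext => y; rewrite mxE.
have d : derivable (fun y => f y *: g y) x v.
  by apply/derivable_mxP => i j; rewrite E; exact: derivableM.
apply: DeriveDef => //; rewrite derive_mx //; apply/matrixP => i j; rewrite !mxE E.
rewrite deriveM // f2 -g2 (derive_mx g1) !mxE /GRing.scale /=.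
by rewrite addrC; congr (_ + _); rewrite mulrC.
Qed.

Lemma is_derive_rows V a b (f : V -> 'M[R]_(a, b)) x v (df : 'M[R]_(a, b)) :
  (forall i, is_derive x v (fun y => row i (f y)) (row i df)) -> is_derive x v f df.
Proof.
move=> H.
have E i j : (fun y => row i (f y) 0 j) = (fun y => f y i j).
  by apply/funext => y; rewrite mxE.
have d : derivable f x v.
  apply/derivable_mxP => i j; rewrite -E.
  by have [di _] := H i; exact: (derivable_mxP _ x v).1 di 0 j.
apply: DeriveDef => //; rewrite derive_mx //; apply/matrixP => i j.
have [di Ei] := H i; rewrite mxE -E.
have := congr1 (fun A : 'rV_b => A 0 j) Ei.
by rewrite derive_mx // !mxE.
Qed.

End SmoothComposition.

(** * A flat function *)

Section FlatFunction.
Context {R : realType}.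
Implicit Types x v : R.

(** The functions [exp (-1/x) / x ^ n] are considered together because their
   derivatives are combinations of functions of the same family. *)
Definition flat n x : R^o :=
  if 0 < x then x^-1 ^+ n * expR (- x^-1) else 0.

(** Comes from [(y / m) ^ m <= exp y] for [y = 1/x] and [m = n + 2]. The square on
   the right makes the function differentiable at 0, with derivative 0. *)
Lemma flat_bound n : exists2 C, 0 < C & forall x, `|flat n x| <= C * x ^+ 2.
Proof.
pose m := n.+2; exists (m%:R ^+ m).
  by apply: exprn_gt0; rewrite ltr0n.
move=> x; rewrite /flat; case: ifPn => x0; last first.
  by rewrite normr0 mulr_ge0 ?sqr_ge0 // exprn_ge0 // ler0n.
set y := x^-1; have y0 : 0 < y by rewrite invr_gt0.
rewrite ger0_norm; last by rewrite mulr_ge0 ?expR_ge0 // exprn_ge0 // ltW.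
have key : (y / m%:R) ^+ m <= expR y.
  rewrite [X in expR X](_ : y = m%:R * (y / m%:R)); last first.
    by rewrite mulrCA mulfV ?mulr1 // pnatr_eq0.
  rewrite expRM_natl lerXn2r // ?nnegrE ?expR_ge0 //.
    by rewrite divr_ge0 ?ler0n // ltW.
  by apply: le_trans (expR_ge1Dx _); rewrite lerDr ler01.
rewrite expRN ler_pdivrMr ?expR_gt0 //.
have mm : 0 < (m%:R : R) ^+ m by rewrite exprn_gt0 // ltr0n.
move: key; rewrite expr_div_n ler_pdivrMr // => key.
have -> : y ^+ n = x ^+ 2 * y ^+ m.
  by rewrite /m !exprS expr0 /y; field; rewrite gt_eqF.
rewrite [leRHS](_ : _ = x ^+ 2 * (expR y * m%:R ^+ m)); last first.
  by rewrite -mulrA mulrCA [m%:R ^+ m * _]mulrC.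
by rewrite ler_pM2l ?exprn_gt0.
Qed.

Lemma flat_differentiable n x : differentiable (flat n : R^o -> R^o) x /\
  forall v, 'D_v (flat n : R^o -> R^o) x = v * (flat n.+2 x - n%:R * flat n.+1 x).
Proof.
have [x0|x0|->] := ltgtP x 0.
- have E : \forall y \near (x : R^o), cst 0 y = flat n y.
    have : \forall y \near x, y < 0 by exact: lt_nbhsl.
    by apply: filterS => y y0; rewrite /flat ltNge (ltW y0).
  split=> [|v]; first exact: differentiable_near E (differentiable_cst _ _).
  rewrite -(near_eq_derive _ E) derive_cst /flat !ltNge (ltW x0) /=.
  by rewrite mulr0 subr0 mulr0.
- pose g := fun y : R => y^-1 ^+ n * expR (- y^-1).
  have E : \forall y \near (x : R^o), g y = flat n y.
    have : \forall y \near x, 0 < y by exact: lt_nbhsr.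
    by apply: filterS => y y0; rewrite /flat y0.
  have x1 : x != 0 by rewrite gt_eqF.
  have di : is_derive x 1 (fun y : R => y^-1) (- x ^- 2).
    by have := @realfun.is_deriveV _ id x 1 1 x1 (is_derive_id x 1); rewrite [_%:A]mulr1.
  have dg : is_derive (x : R^o) (1 : R^o) (g : R^o -> R^o) (flat n.+2 x - n%:R * flat n.+1 x).
    have dX : is_derive x^-1 1 (fun y : R => y ^+ n) (n%:R * x^-1 ^+ n.-1).
      apply: DeriveDef; first exact: exprn_derivable.
      by rewrite exp_derive /GRing.scale /= mulr1.
    have dE : is_derive x 1 (fun y : R => expR (- y^-1)) (expR (- x^-1) * - (- x ^- 2)).
      apply: (@is_derive1_comp _ expR (fun y : R => - y^-1)).
    have [d1 d2] := is_deriveM (is_derive1_comp dX di) dE.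
    apply: DeriveDef; first exact: d1.
    apply: (etrans d2); rewrite /flat x0 /GRing.scale /= -exprVn.
    by case: n {g E dX d1 d2} => [|n]; rewrite ?exprS /=; ring.
  have df : differentiable (flat n : R^o -> R^o) x.
    apply: differentiable_near E _; apply/derivable1_diffP.
    by case: dg.
  split=> // v.
  rewrite -[X in 'D_X _ _]mulr1 -[X in 'D_X _ _]/(v *: (1 : R^o)).
  rewrite deriveE // linearZ -deriveE //= -(near_eq_derive _ E).
  by case: dg => _ ->.
- have [C C0 hC] := flat_bound n.
  pose z := @GRing.null_fun R^o R^o : {linear _ -> _}.
  have [||d0 E] := @differentiable_eps R R^o R^o (flat n) z 0.
  + by move=> y; exact: cvg_cst.
  + move=> e e0; near=> h.
    rewrite addr0 {2}/flat ltxx !subr0 (le_trans (hC h)) //.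
    rewrite -real_normK ?num_real // expr2 mulrA ler_wpM2r //.
    rewrite mulrC -ler_pdivlMr //.
    near: h; exact: (@nbhs0_le R R^o (e / C) (divr_gt0 e0 C0)).
  split=> // v.
  by rewrite deriveE // E /flat ltxx /= mulr0 subr0 mulr0.
Unshelve. all: by end_near. Qed.

Lemma flat_smooth n : smooth_on setT (flat n : R^o -> R^o).
Proof.
move=> k; elim: k n => [|k IH] n.
  by move=> x _; apply: differentiable_continuous; exact: (flat_differentiable n x).1.
split=> [x _|v]; first exact: (flat_differentiable n x).1.
have E x : [set: R^o] x -> v * (flat n.+2 x + - n%:R * flat n.+1 x) = 'D_v (flat n : R^o -> R^o) x.
  by move=> _; rewrite (flat_differentiable n x).2 mulNr.
apply: (Ck_on_eq openT E); apply: Ck_onM => //; first exact: openT.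
  exact: Ck_on_cst.
apply: Ck_onD => //; first exact: openT.
apply: Ck_onM => //; first exact: openT.
exact: Ck_on_cst.
Qed.

Lemma flat0_gt0 x : 0 < x -> flat 0 x != 0.
Proof. by move=> x0; rewrite /flat x0 expr0 mul1r gt_eqF // expR_gt0. Qed.

Lemma flat0_eq0 x : x <= 0 -> flat 0 x = 0.
Proof. by move=> x0; rewrite /flat ltNge x0. Qed.

End FlatFunction.

(** * Mean value estimates for matrix-valued maps *)

Section MeanValue.
Context {R : realType}.

Lemma mxnorm_leP a b (A : 'M[R]_(a, b)) e : 0 <= e ->
  `|A| <= e <-> forall i j, `|A i j| <= e.
Proof.
move=> e0; rewrite /Num.Def.normr /= mx_normrE; split.
  move=> /bigmax_leP [_ h] i j; exact: (h (i, j)).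
by move=> h; apply: bigmax_le => // -[i j] _; exact: h.
Qed.

Lemma le_mxnorm a b (A : 'M[R]_(a, b)) i j : `|A i j| <= `|A|.
Proof. by apply: (mxnorm_leP A (normr_ge0 A)).1. Qed.

Lemma mxnorm_mul a b c (A : 'M[R]_(a, b)) (B : 'M[R]_(b, c)) :
  `|A *m B| <= b%:R * (`|A| * `|B|).
Proof.
apply/mxnorm_leP => [|i j]; first by rewrite !mulr_ge0.
rewrite mxE (le_trans (ler_norm_sum _ _ _)) //.
rewrite -[b in b%:R]card_ord mulr_natl -sumr_const.
by apply: ler_sum => k _; rewrite normrM ler_pM // le_mxnorm.
Qed.

Lemma mean_value_le a b (f df : R -> 'M[R]_(a, b)) (C : R) : 0 <= C ->
  (forall t : R, 0 <= t <= 1 -> is_derive t 1 f (df t)) ->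
  (forall t : R, 0 <= t <= 1 -> `|df t| <= C) ->
  forall s : R, 0 <= s <= 1 -> `|f s - f 0| <= C.
Proof.
move=> C0 df_f dfC s /andP[s0 s1]; apply/mxnorm_leP => // i j.
have df_ij (t : R) : 0 <= t <= 1 -> is_derive t 1 (fun t => f t i j) (df t i j).
  move=> /df_f [d E]; apply: DeriveDef.
    exact: (derivable_mxP f t 1).1 d i j.
  by rewrite -E derive_mx // mxE.
have [||x /itvP xs] := @MVT_segment R (fun t => f t i j) (fun t => df t i j) 0 s s0.
- by move=> x /itvP xs; apply: df_ij; rewrite xs /= (le_trans _ s1) // xs.
- apply: derivable_within_continuous => x /itvP xs.
  by have [] := df_ij x; last by []; rewrite xs /= (le_trans _ s1) // xs.
rewrite subr0 !mxE => ->.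
rewrite normrM (ger0_norm s0) -[leRHS]mulr1 ler_pM //.
by rewrite (le_trans (le_mxnorm _ _ _)) // dfC // xs /= (le_trans _ s1) // xs.
Qed.

(** A smooth map from the line into [-1, 1] that joins 0 to 1: the curve
   [x + tau t *: h] goes from [x] to [x + h] and, although it is defined for all
   times, stays on the segment from [x - h] to [x + h]. *)
Definition tau (t : R) : R := 2 * t / (1 + t ^+ 2).
Definition dtau (t : R) : R := 2 * (1 - t ^+ 2) / (1 + t ^+ 2) ^+ 2.

Lemma tau_den t : 1 + t ^+ 2 != 0 :> R.
Proof. by rewrite gt_eqF // ltr_wpDr // sqr_ge0. Qed.

Lemma tau0 : tau 0 = 0. Proof. by rewrite /tau mulr0 mul0r. Qed.

Lemma tau1 : tau 1 = 1.
Proof. by rewrite /tau expr1n mulr1 divff // pnatr_eq0. Qed.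

Lemma dtau0 : dtau 0 = 2.
Proof. by rewrite /dtau expr0n /= subr0 addr0 expr1n divr1 mulr1. Qed.

Lemma tau_le1 t : `|tau t| <= 1.
Proof.
have d0 : 0 < 1 + t ^+ 2 by rewrite ltr_wpDr // sqr_ge0.
rewrite /tau normrM normfV (gtr0_norm d0) ler_pdivrMr // mul1r.
rewrite ler_norml; have := sqr_ge0 (t + 1); have := sqr_ge0 (t - 1).
by rewrite !expr2 => h1 h2; apply/andP; split; lra.
Qed.

Lemma dtau_le2 t : `|dtau t| <= 2.
Proof.
have d0 : 0 < (1 + t ^+ 2) ^+ 2 by rewrite exprn_gt0 // ltr_wpDr // sqr_ge0.
rewrite /dtau normrM normfV (gtr0_norm d0) ler_pdivrMr //.
rewrite ler_norml; have := sqr_ge0 t; set u := t ^+ 2 => u0.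
by apply/andP; split; nra.
Qed.

Lemma smooth_tau : smooth_on setT (tau : R^o -> R^o).
Proof.
have sid : smooth_on setT (fun t : R^o => t).
  apply: (@smooth_on_linear _ _ _ _ (@idfun R^o)).
  by move=> x; exact: cvg_id.
apply: smooth_onM; first exact: openT.
  by apply: smooth_onM => //; [exact: openT|exact: smooth_on_cst].
apply: smooth_onV; [exact: openT|by move=> t _; exact: tau_den|].
apply: smooth_onD; [exact: openT|exact: smooth_on_cst|].
apply: (@smooth_on_eq _ _ _ _ (fun t : R^o => t * t : R^o)) => //.
  exact: openT.
by apply: smooth_onM => //; exact: openT.
Qed.

Lemma is_derive_tau (t : R) : is_derive t 1 tau (dtau t).
Proof.
have d1 : is_derive t 1 (fun t : R => 2 * t) 2.
  have [d E] := is_deriveZ 2 (@is_derive_id R R t 1).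
  by apply: DeriveDef; [exact: d|apply: (etrans E); rewrite [_ *: _]mulr1].
have d2 : is_derive t 1 (fun t : R => 1 + t ^+ 2) (2 * t).
  have [d E] := is_deriveD (@is_derive_cst R R R 1 t 1)
                     (is_deriveX 2 (@is_derive_id R R t 1)).
  apply: DeriveDef; first exact: d.
  by apply: (etrans E); rewrite add0r expr1 [_ *: _]mulr1.
have [d E] := is_deriveM d1 
  (@realfun.is_deriveV _ (fun t => 1 + t ^+ 2) t _ _ (tau_den t) d2).
apply: DeriveDef; first exact: d.
apply: (etrans E); rewrite /dtau /GRing.scale /=.
by field; exact: tau_den.
Qed.

(** The error [f (x + h) - f x - df h] is the increment between 0 and 1 of
   [f (x + tau t *: h) - tau t *: df h], whose derivative is small compared to
   [h] by continuity of the [B i]; the mean value inequality concludes. *)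
Lemma differentiable_along m a b (f : 'rV[R]_m -> 'M[R]_(a, b))
    (B : 'I_m -> 'rV[R]_m -> 'M[R]_(a, b)) x :
  (forall i, {for x, continuous (B i)}) ->
  (\forall h \near (0 : 'rV[R]_m), forall t : R, 0 <= t <= 1 ->
    is_derive t 1 (fun t => f (x + tau t *: h))
      (dtau t *: \sum_i h 0 i *: B i (x + tau t *: h))) ->
  differentiable f x /\ forall h, 'd f x h = \sum_i h 0 i *: B i x.
Proof.
move=> cB Hf.
pose l (h : 'rV[R]_m) : 'M[R]_(a, b) := \sum_i h 0 i *: B i x.
have lin : linear l.
  move=> k u v; rewrite /l scaler_sumr -big_split; apply: eq_bigr => i _.
  by rewrite !mxE scalerDl scalerA.
pose L := HB.pack_for {linear 'rV[R]_m -> 'M[R]_(a, b)} l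
   (GRing.isLinear.Build _ _ _ _ _ lin).
have cL : continuous L.
  have sL : smooth_on setT l.
    apply: smooth_on_sum => [|i _]; first exact: openT.
    by apply: smooth_onZ; [exact: openT|exact: smooth_on_coord|exact: smooth_on_cst].
  by move=> h; exact: (smooth_on_cont sL).
suff [df E] : differentiable f x /\ 'd f x = L :> (_ -> _).
  by split=> // h; rewrite E.
apply: differentiable_eps => // e e0.
have m0 : 0 < 2 * m.+1%:R :> R by rewrite mulr_gt0 // ltr0n.
(* [2] bounds [dtau]; [m.+1] rather than [m] avoids a division by 0. *)
pose e' := e / (2 * m.+1%:R); have e'0 : 0 < e' by rewrite divr_gt0.
have : \forall y \near x, forall i, `|B i y - B i x| <= e'.
  apply: (@filter_forall _ _ (fun i y => `|B i y - B i x| <= e') (nbhs x)) => i.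
  have /cvgrPdist_le/(_ _ e'0) := cB i.
  by apply: filterS => y; rewrite distrC.
move=> /nbhs_ballP [r /= r0 Hr].
near=> h.
pose g t := f (x + tau t *: h) - tau t *: L h.
pose dg t := dtau t *: \sum_i h 0 i *: (B i (x + tau t *: h) - B i x).
have g0 : g 0 = f x by rewrite /g tau0 !scale0r addr0 subr0.
have g1 : g 1 = f (h + x) - L h by rewrite /g tau1 !scale1r [h + x]addrC.
rewrite addrAC -g1 -g0.
apply: (@mean_value_le _ _ g dg) => //; rewrite ?ler01 ?lexx //.
- by rewrite mulr_ge0 // ltW.
- move=> t t01.
  have D1 : is_derive t 1 (fun t => f (x + tau t *: h))
      (dtau t *: \sum_i h 0 i *: B i (x + tau t *: h)).
    by move: t t01; near: h.
  have D2 : is_derive t 1 (fun t => tau t *: L h) (dtau t *: L h).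
    have [dt Et] := is_derive_tau t.
    have dft : differentiable (tau : R^o -> R^o) t by exact/derivable1_diffP.
    have dfs : differentiable (fun t : R^o => tau t *: L h) t.
      exact: differentiableZl.
    apply: DeriveDef; first exact/derivable1_diffP.
    by rewrite deriveE // diffZl // -deriveE // Et.
  have [d E] := is_deriveB D1 D2.
  apply: DeriveDef; first exact: d.
  apply: (etrans E); rewrite /dg /= -scalerBr; congr (_ *: _).
  by rewrite /l -sumrB; apply: eq_bigr => i _; rewrite scalerBr.
- move=> t t01; rewrite /dg normrZ.
  rewrite (le_trans (ler_wpM2r _ (dtau_le2 t))) //.
  rewrite (le_trans (ler_wpM2l _ (ler_norm_sum _ _ _))) //.
  rewrite (@le_trans _ _ (2 * \sum_(i < m) `|h| * e')) //.
    rewrite ler_wpM2l // ler_sum // => i _; rewrite normrZ ler_pM ?le_mxnorm //.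
    apply: Hr; rewrite -ball_normE /= opprD addrA subrr sub0r normrN normrZ.
    rewrite (le_lt_trans (ler_wpM2r _ (tau_le1 t))) // mul1r.
    by near: h; exact: (@nbhs0_lt R 'rV[R]_m r r0).
  rewrite sumr_const card_ord -mulr_natl /e'.
  rewrite [leLHS](_ : _ = (e * `|h|) * (m%:R / m.+1%:R)); last first.
    by field; rewrite nat1r pnatr_eq0.
  rewrite ler_piMr //; first by rewrite mulr_ge0 // ltW.
  by rewrite ler_pdivrMr ?ltr0n // mul1r ler_nat.
Unshelve. all: by end_near. Qed.

End MeanValue.

(** * Regularity of solutions of linear total differential equations *)

Section LinearTotalDifferential.
Context {R : realType} {m a b : nat}.
Implicit Types (f : 'rV[R]_m -> 'M[R]_(a, b)) (x h : 'rV[R]_m).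

(** Gronwall in its simplest form: along a short curve, the maximum [N] of
   [|f|] satisfies [N <= |f x| + N / 2]. *)
Lemma continuous_along f x (df : 'rV[R]_m -> R -> 'M[R]_(a, b)) (K : R) :
  0 <= K ->
  (\forall h \near (0 : 'rV[R]_m), forall t : R, 0 <= t <= 1 ->
    is_derive t 1 (fun t => f (x + tau t *: h)) (df h t) /\
    `|df h t| <= K * `|h| * `|f (x + tau t *: h)|) ->
  {for x, continuous f}.
Proof.
move=> K0 H.
(* [K + 1] in the place of [K], which may be 0. *)
have K1 : 0 < K + 1 by rewrite ltr_wpDl.
have key : \forall h \near (0 : 'rV[R]_m), `|f (x + h) - f x| <= K * `|h| * (2 * `|f x|).
  near=> h.
  have Kh : K * `|h| <= 2^-1.
    rewrite (@le_trans _ _ ((K + 1) * `|h|)) ?ler_wpM2r ?lerDl //.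
    rewrite mulrC -ler_pdivlMr //.
    by near: h; apply: (@nbhs0_le R 'rV[R]_m); rewrite divr_gt0 ?invr_gt0.
  have Hh : forall t : R, 0 <= t <= 1 ->
    is_derive t 1 (fun t => f (x + tau t *: h)) (df h t) /\
    `|df h t| <= K * `|h| * `|f (x + tau t *: h)| by near: h.
  pose g (t : R) := f (x + tau t *: h).
  have dg (t : R) : 0 <= t <= 1 -> is_derive t 1 g (df h t) by move=> /Hh [].
  have cg : {within `[0, 1], continuous (fun t : R => `|g t|)}.
    apply/continuous_in_subspaceT => t /[1!inE] /= /itvP t01.
    apply: (@continuous_comp _ _ _ g (fun y => `|y|)).
      apply/differentiable_continuous/derivable1_diffP.
      by have [] := dg t _; rewrite ?t01.
    exact: norm_continuous.
  have [c /itvP c01 cmax] := EVT_max ler01 cg.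
  have g0 : g 0 = f x by rewrite /g tau0 scale0r addr0.
  have g1 : g 1 = f (x + h) by rewrite /g tau1 scale1r.
  have bnd s : 0 <= s <= 1 -> `|g s - g 0| <= K * `|h| * `|g c|.
    apply: (@mean_value_le _ _ _ g (df h)) => //.
      by rewrite !mulr_ge0.
    move=> t t01; have [_ b1] := Hh t t01; apply: le_trans b1 _.
    by rewrite ler_wpM2l ?mulr_ge0 // cmax // in_itv.
  have gc : `|g c| <= 2 * `|f x|.
    have h1 : `|g c| <= `|f x| + `|g c - g 0|.
      by rewrite -g0 -{1}(subrK (g 0) (g c)) addrC ler_normD.
    have h2 : `|g c - g 0| <= K * `|h| * `|g c| by apply: bnd; rewrite !c01.
    have h3 : K * `|h| * `|g c| <= 2^-1 * `|g c| by rewrite ler_wpM2r.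
    lra.
  rewrite -g1 -g0; apply: le_trans (bnd 1 _) _; first by rewrite ler01 lexx.
  by rewrite g0 ler_wpM2l // mulr_ge0.
apply/(@cvgrPdist_le _ _ _ (nbhs x) _ f (f x)) => e e0.
pose C := K * (2 * `|f x|); have C0 : 0 <= C by rewrite !mulr_ge0.
have C1 : 0 < C + 1 by rewrite ltr_wpDl.
have : \forall h \near (0 : 'rV[R]_m), `|f x - f (h + x)| <= e.
  near=> h.
  rewrite distrC [h + x]addrC; have kh : `|f (x + h) - f x| <= K * `|h| * (2 * `|f x|) by near: h.
  apply: (le_trans kh); rewrite mulrAC -/C.
  rewrite (@le_trans _ _ ((C + 1) * `|h|)) ?ler_wpM2r // ?lerDl //.
  rewrite mulrC -ler_pdivlMr //.
  by near: h; apply: (@nbhs0_le R 'rV[R]_m); rewrite divr_gt0.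
move=> H0; apply/(@nbhs0P _ 'rV[R]_m (fun y => `|f x - f y| <= e) x).
by apply: filterS H0 => h; rewrite [h + x]addrC.
Unshelve. all: by end_near. Qed.

(** The solution is continuous by the Gronwall estimate, hence differentiable;
   each of its derivatives is then a combination of products of the solution
   and the coefficients, so it has the same order of smoothness, and induction
   applies. *)
Lemma smooth_on_along (U : set 'rV[R]_m) f
    (Om : 'I_m -> 'rV[R]_m -> 'M[R]_b) :
  open U -> (forall i, smooth_on U (Om i)) ->
  (forall x h, (forall s : R, `|s| <= 1 -> U (x + s *: h)) ->
    forall t : R, is_derive t 1 (fun t => f (x + tau t *: h))
     (dtau t *: \sum_i h 0 i *: (f (x + tau t *: h) *m Om i (x + tau t *: h)))) ->
  smooth_on U f.
Proof.
move=> oU sOm Hf.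
have near_ball x (P : 'rV[R]_m -> Prop) : (\forall y \near x, P y) ->
    \forall h \near (0 : 'rV[R]_m), forall s : R, `|s| <= 1 -> P (x + s *: h).
  move=> /nbhs_ballP [r /= r0 Hr]; near=> h => s s1; apply: Hr.
  rewrite -ball_normE /= opprD addrA subrr sub0r normrN normrZ.
  rewrite (le_lt_trans (ler_wpM2r _ s1)) // mul1r.
  by near: h; exact: (@nbhs0_lt R 'rV[R]_m r r0).
have nU x : U x -> \forall y \near x, U y by move=> Ux; apply: (open_nearP oU Ux).
have cf x : U x -> {for x, continuous f}.
  move=> Ux; pose N i := `|Om i x| + 1.
  pose K := \sum_i 2 * b%:R * N i.
  have N0 i : 0 <= N i by rewrite addr_ge0.
  apply: (@continuous_along f x _ K).
    by apply: sumr_ge0 => i _; rewrite !mulr_ge0.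
  have nOm : \forall y \near x, forall i, `|Om i y| <= N i.
    apply: (@filter_forall _ _ (fun i y => `|Om i y| <= N i) (nbhs x)) => i.
    have /cvgrPdist_le/(_ _ (@ltr01 R)) := smooth_on_cont (sOm i) Ux.
    apply: filterS => y h1.
    rewrite -[Om i y](subKr (Om i x)) (le_trans (ler_normB _ _)) // lerD2l //.
  near=> h => t t01.
  have hU : forall s : R, `|s| <= 1 -> U (x + s *: h) by near: h; exact: near_ball (nU _ Ux).
  have hO : forall s : R, `|s| <= 1 -> forall i, `|Om i (x + s *: h)| <= N i.
    by near: h; exact: near_ball nOm.
  split; first exact: Hf.
  set y := x + _; rewrite normrZ (le_trans (ler_wpM2r _ (dtau_le2 t))) //.
  rewrite (le_trans (ler_wpM2l _ (ler_norm_sum _ _ _))) // /K !mulr_suml mulr_sumr.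
  apply: ler_sum => i _.
  rewrite -!mulrA ler_wpM2l // normrZ.
  rewrite (le_trans (ler_pM _ _ (le_mxnorm h 0 i) (mxnorm_mul _ _))) //.
  rewrite [leLHS](_ : _ = b%:R * (`|Om i y| * (`|h| * `|f y|))); last by ring.
  by rewrite ler_wpM2l // ler_wpM2r ?mulr_ge0 // hO // tau_le1.
have df x : U x -> differentiable f x /\
    forall h, 'd f x h = \sum_i h 0 i *: (f x *m Om i x).
  move=> Ux; apply: (@differentiable_along _ _ _ _ f (fun i y => f y *m Om i y)).
    move=> i; have := @Ck_on_mulmx _ _ _ _ _ U 0 f (Om i) oU cf (sOm i 0%N).
    by apply.
  near=> h => t t01; apply: Hf.
  by near: h; exact: near_ball (nU _ Ux).
elim=> [|k IH]; first by move=> x Ux; exact: cf.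
split=> [x Ux|v]; first by have [] := df x Ux.
pose g y := \sum_i v 0 i *: (f y *m Om i y).
apply: (@Ck_on_eq _ _ _ _ _ g) => // [x Ux|].
  by have [d E] := df x Ux; rewrite deriveE // E.
apply: Ck_on_sum => // i _; apply: Ck_onZ => //; first exact: Ck_on_cst.
by apply: Ck_on_mulmx => //; exact: sOm.
Unshelve. all: by end_near. Qed.

End LinearTotalDifferential.

(** * Charts and transition matrices *)

(** The transition matrices are sealed: comparing two of them must not unfold
   the derivatives that they are made of. *)
HB.lock Definition jac (R : realType) (m : nat) (M : manifold R m)
  (c d : chart M) (p : M) : 'M[R]_m := transition_jac c d p.

Section Charts.
Context {R : realType} {m : nat} {M : manifold R m}.
Local Notation vec := 'rV[R]_m.
Implicit Types (c d e : chart M) (p q : M) (x y v : vec) (O : set M) (W : normedModType R).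

Lemma chart_imageP c x : chart_image c x -> dom c (param c x) /\ coord c (param c x) = x.
Proof. by move=> [p dp <-]; rewrite coordK. Qed.

Definition dom_image c O : set vec := coord c @` (dom c `&` O).

Lemma dom_imageE c O : dom_image c O = chart_image c `&` param c @^-1` O.
Proof.
apply/seteqP; split=> x.
  by move=> [p [dp Op] <-]; split; [exists p|rewrite /= coordK].
by move=> [[p dp <-]] /=; rewrite coordK // => Op; exists p.
Qed.

Lemma dom_imageP c O x :
  dom_image c O x -> [/\ dom c (param c x), O (param c x) & coord c (param c x) = x].
Proof. by move=> [p [dp Op] <-]; rewrite coordK. Qed.

Lemma dom_image_coord c O p : dom c p -> O p -> dom_image c O (coord c p).
Proof. by move=> dp Op; exists p. Qed.

Lemma open_dom_image c O : open O -> open (dom_image c O).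
Proof.
move=> oO; rewrite openE => x hx; have [dx Ox cx] := dom_imageP hx.
rewrite dom_imageE; apply: filterI.
  by apply: open_nbhs_nbhs; split; [exact: coord_open|exists (param c x)].
have cp : {for x, continuous (param c)}.
  by apply: param_continuous; exists (param c x).
by apply: cp; apply: open_nbhs_nbhs.
Qed.

Lemma dom_imageS c O B : O `<=` B -> dom_image c O `<=` dom_image c B.
Proof. by move=> sO x [p [dp Op] <-]; exists p => //; split=> //; exact: sO. Qed.

Lemma dom_imageT c : dom_image c setT = chart_image c.
Proof. by rewrite /dom_image setIT. Qed.

Lemma transition_differentiable c d p : dom c p -> dom d p ->
  differentiable (coord d \o param c) (coord c p).
Proof.
by move=> cp dp; apply: smooth_on_diff (transition_smooth c d) _; exists p.
Qed.

Lemma jacE c d p : transition_jac c d p = jac c d p.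
Proof. by rewrite jac.unlock. Qed.

Lemma mulmx_jac c d p v : dom c p -> dom d p ->
  v *m jac c d p = 'D_v (coord d \o param c) (coord c p).
Proof.
move=> cp dp; rewrite -jacE deriveEjacobian //; exact: transition_differentiable.
Qed.

Lemma jac_id c p : dom c p -> jac c c p = 1%:M.
Proof.
move=> cp; apply/row_matrixP => i; rewrite !rowE mulmx_jac // mulmx1.
rewrite (@near_eq_derive _ _ _ _ id) ?derive_id //.
apply: (@open_nearP _ _ (chart_image c)); first exact: coord_open.
  by exists p.
by move=> y /chart_imageP [].
Qed.

Lemma jac_comp c d e p : dom c p -> dom d p -> dom e p ->
  jac c d p *m jac d e p = jac c e p.
Proof.
move=> cp dp ep; apply/row_matrixP => i.
rewrite 2!rowE mulmxA.
rewrite [X in X *m _](mulmx_jac (delta_mx 0 i) cp dp).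
rewrite [LHS](mulmx_jac _ dp ep) [RHS](mulmx_jac _ cp ep).
have E : coord d p = (coord d \o param c) (coord c p) by rewrite /= coordK.
rewrite E -derive_comp; first last.
- by rewrite -E; exact: transition_differentiable.
- exact: transition_differentiable.
apply: near_eq_derive.
apply: (@open_nearP _ _ (dom_image c (dom d))).
- by apply: open_dom_image; exact: dom_open.
- exact: dom_image_coord.
by move=> y /dom_imageP [_ dy _] /=; rewrite coordK.
Qed.

Lemma jacK c d p : dom c p -> dom d p ->
  jac c d p *m jac d c p = 1%:M.
Proof. by move=> cp dp; rewrite jac_comp // jac_id. Qed.

Lemma jac_unit c d p : dom c p -> dom d p -> jac c d p \in unitmx.
Proof. by move=> cp dp; exact: (mulmx1_unit (jacK cp dp)).1. Qed.

(** * Smooth functions, frames and coframes on open sets *)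

Definition smoothM_on O (W : normedModType R) (f : M -> W) : Prop :=
  forall c, smooth_on (dom_image c O) (f \o param c).

(** [k] vector fields at once, as the rows of a matrix. *)
Definition frame_rep k c (X : M -> 'M[R]_(k, m)) x : 'M[R]_(k, m) :=
  X (param c x) *m jac (chart_at (param c x)) c (param c x).

Definition smoothT_on O k (X : M -> 'M[R]_(k, m)) : Prop :=
  forall c, smooth_on (dom_image c O) (frame_rep c X).

(** [k] one-forms at once, as the columns of a matrix. *)
Definition coframe_rep k c (W : M -> 'M[R]_(m, k)) x : 'M[R]_(m, k) :=
  jac c (chart_at (param c x)) (param c x) *m W (param c x).

Definition smoothC_on O k (W : M -> 'M[R]_(m, k)) : Prop :=
  forall c, smooth_on (dom_image c O) (coframe_rep c W).

Lemma smooth_fieldP (X : M -> vec) : smooth_field X <-> smoothT_on setT X.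
Proof.
have E c : field_rep c X = frame_rep c X.
  by apply/funext => x; rewrite /field_rep /frame_rep jacE.
by split=> h c; have := h c; rewrite dom_imageT E.
Qed.

Lemma smooth_funP (f : M -> R) :
  smooth_fun f <-> smoothM_on setT (f : M -> R^o).
Proof. by split=> h c; have := h c; rewrite dom_imageT. Qed.

Lemma smoothM_onS O B W (f : M -> W) : B `<=` O -> smoothM_on O f -> smoothM_on B f.
Proof. by move=> sO h c; apply: smooth_on_subset (h c); exact: dom_imageS. Qed.

Lemma smoothT_onS O B k (X : M -> 'M[R]_(k, m)) : B `<=` O -> smoothT_on O X -> smoothT_on B X.
Proof. by move=> sO h c; apply: smooth_on_subset (h c); exact: dom_imageS. Qed.

Lemma smooth_dom_image_near W c O (g : vec -> W) :
  (forall p, O p -> exists B h, [/\ open B, B p, smooth_on (dom_image c B) h &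
     forall x, dom_image c B x -> h x = g x]) ->
  smooth_on (dom_image c O) g.
Proof.
move=> H; apply: smooth_on_near => x [p [cp Op] <-].
have [B [h [oB Bp sh hg]]] := H p Op.
exists h, (dom_image c B); split=> //.
apply: open_nbhs_nbhs; split; first exact: open_dom_image.
exact: dom_image_coord.
Qed.

Lemma smoothM_on_near O W (f : M -> W) :
  (forall p, O p -> exists B g, [/\ open B, B p, smoothM_on B g &
     forall q, B q -> g q = f q]) ->
  smoothM_on O f.
Proof.
move=> H c; apply: smooth_dom_image_near => p /H [B [g [oO Bp sg gf]]].
exists B, (g \o param c); split=> // x /dom_imageP [_ Ox _].
exact: gf.
Qed.

Lemma smoothT_on_near O k (X : M -> 'M[R]_(k, m)) :
  (forall p, O p -> exists B Y, [/\ open B, B p, smoothT_on B Y &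
     forall q, B q -> Y q = X q]) ->
  smoothT_on O X.
Proof.
move=> H c; apply: smooth_dom_image_near => p /H [B [g [oO Bp sg gf]]].
exists B, (frame_rep c g); split=> // x /dom_imageP [_ Ox _].
by rewrite /frame_rep gf.
Qed.

Lemma chart_atK c p k (X : 'M[R]_(k, m)) : dom c p ->
  X *m jac (chart_at p) c p *m jac c (chart_at p) p = X.
Proof. by move=> cp; rewrite -mulmxA jacK ?mulmx1 //; exact: chart_atP. Qed.

Lemma frame_coframe_rep c k l (X : M -> 'M[R]_(k, m)) (W : M -> 'M[R]_(m, l)) x :
  dom c (param c x) ->
  frame_rep c X x *m coframe_rep c W x = X (param c x) *m W (param c x).
Proof.
by move=> cx; rewrite /frame_rep /coframe_rep mulmxA chart_atK.
Qed.

Lemma smooth_pairing O k l (X : M -> 'M[R]_(k, m)) (W : M -> 'M[R]_(m, l)) :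
  open O -> smoothT_on O X -> smoothC_on O W ->
  smoothM_on O (fun p => X p *m W p).
Proof.
move=> oO sX sW c; have oD := open_dom_image (c := c) oO.
apply: (smooth_on_eq oD _ (smooth_on_mulmx oD (sX c) (sW c))) => x.
by move=> /dom_imageP [cx _ _]; rewrite frame_coframe_rep.
Qed.

Lemma smoothT_mul O k l (A : M -> 'M[R]_(l, k)) (X : M -> 'M[R]_(k, m)) :
  open O -> smoothM_on O A -> smoothT_on O X -> smoothT_on O (fun p => A p *m X p).
Proof.
move=> oO sA sX c; have oD := open_dom_image (c := c) oO.
apply: (smooth_on_eq oD _ (smooth_on_mulmx oD (sA c) (sX c))) => x _.
by rewrite /frame_rep /= mulmxA.
Qed.

Lemma smoothM_cst O (W : normedModType R) (a : W) : smoothM_on O (fun=> a).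
Proof. by move=> c; exact: smooth_on_cst. Qed.

Lemma smoothM_onP O a b (A : M -> 'M[R]_(a, b)) : open O ->
  smoothM_on O A <-> forall i j, smoothM_on O (fun p => A p i j : R^o).
Proof.
move=> oO; have oD c := open_dom_image (c := c) oO.
split=> [h i j c|h c]; first exact: (smooth_on_mxP _ (oD c)).1 (h c) i j.
by apply/(smooth_on_mxP _ (oD c)) => i j; exact: h.
Qed.

Lemma coframe_rep_inv c (X : M -> 'M[R]_m) x : dom c (param c x) ->
  X (param c x) \in unitmx ->
  frame_rep c X x \in unitmx /\
  coframe_rep c (fun p => invmx (X p)) x = invmx (frame_rep c X x).
Proof.
move=> cx Xu; have cu := jac_unit (chart_atP (param c x)) cx.
have fu : frame_rep c X x \in unitmx by rewrite unitmx_mul Xu.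
split=> //; apply: (can_inj (mulKmx fu)).
by rewrite frame_coframe_rep // !mulmxV.
Qed.

Lemma smoothC_inv O (X : M -> 'M[R]_m) : open O ->
  (forall p, O p -> X p \in unitmx) ->
  smoothT_on O X -> smoothC_on O (fun p => invmx (X p)).
Proof.
move=> oO Xu sX c; have oD := open_dom_image (c := c) oO.
apply: (smooth_on_eq oD _ (smooth_on_invmx oD _ (sX c))) => x.
  by move=> /dom_imageP [cx /Xu ux _]; have [_ ->] := coframe_rep_inv cx ux.
by move=> /dom_imageP [cx /Xu ux _]; have [] := coframe_rep_inv cx ux.
Qed.

Lemma smoothT_inv O (W : M -> 'M[R]_m) : open O ->
  (forall p, O p -> W p \in unitmx) ->
  smoothC_on O W -> smoothT_on O (fun p => invmx (W p)).
Proof.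
move=> oO Wu sW c; have oD := open_dom_image (c := c) oO.
have key x : dom_image c O x -> coframe_rep c W x \in unitmx /\
    frame_rep c (fun p => invmx (W p)) x = invmx (coframe_rep c W x).
  move=> /dom_imageP [cx /Wu ux _].
  have cu : coframe_rep c W x \in unitmx.
    by rewrite unitmx_mul ux andbT; exact: jac_unit (chart_atP _).
  split=> //; apply: (can_inj (mulmxK cu)).
  by rewrite frame_coframe_rep // !mulVmx.
apply: (smooth_on_eq oD _ (smooth_on_invmx oD _ (sW c))) => x /key [] //.
Qed.

Lemma smoothT_endo O k (J : M -> 'M[R]_m) (X : M -> 'M[R]_(k, m)) : open O ->
  smooth_endo J -> smoothT_on O X -> smoothT_on O (fun p => X p *m J p).
Proof.
move=> oO sJ sX c; have oD := open_dom_image (c := c) oO.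
have sJO : smooth_on (dom_image c O) (endo_rep c J).
  by apply: smooth_on_subset (sJ c); rewrite -dom_imageT; exact: dom_imageS.
apply: (smooth_on_eq oD _ (smooth_on_mulmx oD (sX c) sJO)) => x.
move=> /dom_imageP [cx _ _]; rewrite /frame_rep /endo_rep 2!jacE.
by rewrite !mulmxA (chart_atK (X (param c x)) cx).
Qed.

Lemma smoothT_rowP O k (X : M -> 'M[R]_(k, m)) : open O ->
  smoothT_on O X <-> forall i, smoothT_on O (fun p => row i (X p)).
Proof.
move=> oO; have oD c := open_dom_image (c := c) oO.
split=> [h i c|h c]; apply/(smooth_on_mxP _ (oD c)).
  move=> a j; have := (smooth_on_mxP _ (oD c)).1 (h c) i j.
  apply: (smooth_on_eq (oD c)) => x _.
  by rewrite /frame_rep -row_mul [RHS]mxE.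
move=> i j; have := (smooth_on_mxP _ (oD c)).1 (h i c) 0 j.
apply: (smooth_on_eq (oD c)) => x _.
by rewrite /frame_rep -row_mul [LHS]mxE.
Qed.

Lemma smoothC_colP O k (W : M -> 'M[R]_(m, k)) : open O ->
  smoothC_on O W <-> forall i, smoothC_on O (fun p => col i (W p)).
Proof.
move=> oO; have oD c := open_dom_image (c := c) oO.
split=> [h i c|h c]; apply/(smooth_on_mxP _ (oD c)).
  move=> j a; have := (smooth_on_mxP _ (oD c)).1 (h c) j i.
  apply: (smooth_on_eq (oD c)) => x _.
  by rewrite /coframe_rep colE mulmxA -colE [RHS]mxE.
move=> j i; have := (smooth_on_mxP _ (oD c)).1 (h i c) j 0.
apply: (smooth_on_eq (oD c)) => x _.
by rewrite /coframe_rep colE mulmxA -colE [LHS]mxE.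
Qed.

(** In the other charts the function is composed with a smooth transition map. *)
Lemma smoothM_on_chart O c a b (A : M -> 'M[R]_(a, b)) : open O -> O `<=` dom c ->
  smooth_on (dom_image c O) (A \o param c) -> smoothM_on O A.
Proof.
move=> oO Oc sA d; have oD e := open_dom_image (c := e) oO.
have sT : smooth_on (dom_image d O) (coord c \o param d).
  by apply: smooth_on_subset (transition_smooth d c); exact: dom_imageS.
have := @smooth_on_comp_rV_mx _ _ _ _ _ (dom_image d O) (dom_image c O)
   (A \o param c) (coord c \o param d) (oD d) (oD c) _ sA sT.
move=> H; apply: (smooth_on_eq (oD d)) (H _).
  by move=> x /dom_imageP [_ /Oc cx _] /=; rewrite coordK.
by move=> x /dom_imageP [_ Ox _]; apply: dom_image_coord => //; exact: Oc.
Qed.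

Lemma smoothM_on_chart_fun O c (f : M -> R^o) : open O -> O `<=` dom c ->
  smooth_on (dom_image c O) (f \o param c) -> smoothM_on O f.
Proof.
move=> oO Oc sf.
have s1 : smoothM_on O (fun p => (f p)%:M : 'M[R]_1).
  apply: (smoothM_on_chart oO Oc); apply/smooth_on_mxP => [|i j].
    exact: open_dom_image.
  apply: (smooth_on_eq (open_dom_image (c := c) oO) _ sf) => x _ /=.
  by rewrite !ord1 mxE mulr1n.
have := (smoothM_onP _ oO).1 s1 0 0.
move=> h c'; apply: (smooth_on_eq (open_dom_image (c := c') oO) _ (h c')) => x _ /=.
by rewrite mxE mulr1n.
Qed.

End Charts.

(** * Derivatives along tangent vectors *)

Section TangentDerivatives.
Context {R : realType} {m : nat} {M : manifold R m}.
Local Notation vec := 'rV[R]_m.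
Implicit Types (c d e : chart M) (p q : M) (x y v : vec) (O : set M) (W : normedModType R).

Definition dmat W (A : M -> W) p v : W :=
  'D_v (A \o param (chart_at p)) (coord (chart_at p) p).

Lemma dmat_dirder (f : M -> R) p v : dirder f p v = dmat (f : M -> R^o) p v.
Proof. by []. Qed.

Lemma smoothM_diff W O (A : M -> W) c p : smoothM_on O A -> O p -> dom c p ->
  differentiable (A \o param c) (coord c p).
Proof. by move=> sA Op cp; apply: smooth_on_diff (sA c) _; exact: dom_image_coord. Qed.

Lemma dmat_chart W O (A : M -> W) c p v : smoothM_on O A -> O p -> dom c p ->
  'D_(v *m jac (chart_at p) c p) (A \o param c) (coord c p) = dmat A p v.
Proof.
move=> sA Op cp; have p0 := chart_atP p.
rewrite /dmat (mulmx_jac _ p0 cp).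
have E : coord c p = (coord c \o param (chart_at p)) (coord (chart_at p) p).
  by rewrite /= coordK.
rewrite E -derive_comp.
- apply: near_eq_derive.
  apply: (@open_nearP _ _ (dom_image (chart_at p) (dom c))).
  + by apply: open_dom_image; exact: dom_open.
  + exact: dom_image_coord.
  + by move=> y /dom_imageP [_ dy _] /=; rewrite coordK.
- exact: transition_differentiable.
- by rewrite -E; exact: smoothM_diff sA _ _.
Qed.

Lemma dmat_linear W O (A : M -> W) p k u v : smoothM_on O A -> O p ->
  dmat A p (k *: u + v) = k *: dmat A p u + dmat A p v.
Proof.
move=> sA Op; have dA := smoothM_diff sA Op (chart_atP p).
by rewrite /dmat 3!(deriveE _ dA) linearP.
Qed.

Lemma dmat_cst W (a : W) p v : dmat (fun=> a) p v = 0.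
Proof. exact: derive_cst. Qed.

Lemma dmat_mul O a b k (A : M -> 'M[R]_(a, b)) (B : M -> 'M[R]_(b, k)) p v :
  smoothM_on O A -> smoothM_on O B -> O p ->
  dmat (fun q => A q *m B q) p v = dmat A p v *m B p + A p *m dmat B p v.
Proof.
move=> sA sB Op; have p0 := chart_atP p.
have dA := smoothM_diff sA Op p0; have dB := smoothM_diff sB Op p0.
have [_ E] := derive_mulmx (diff_derivable dA) (diff_derivable dB) (v := v).
by rewrite /dmat E /= coordK.
Qed.

Lemma smoothM_dmat O a b (A : M -> 'M[R]_(a, b)) (X : M -> vec) : open O ->
  smoothM_on O A -> smoothT_on O X -> smoothM_on O (fun p => dmat A p (X p)).
Proof.
move=> oO sA sX c; have oD := open_dom_image (c := c) oO.
have H : smooth_on (dom_image c O)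
   (fun x => \sum_i frame_rep c X x 0 i *: 'D_(delta_mx 0 i) (A \o param c) x).
  apply: smooth_on_sum => // i _; apply: smooth_onZ => //.
    exact: (smooth_on_mxP _ oD).1 (sX c) 0 i.
  exact: smooth_on_D.
apply: (smooth_on_eq oD _ H) => x /dom_imageP [cx Ox E] /=.
rewrite -(dmat_chart (X (param c x)) sA Ox cx) -/(frame_rep c X x).
rewrite {2}(row_sum_delta (frame_rep c X x)) E derive_span //.
by have := smoothM_diff sA Ox cx; rewrite E.
Qed.

Lemma open_curve_preimage (sigma : R -> M) O : continuous sigma -> open O ->
  open (sigma @^-1` O : set R^o).
Proof. by move=> cs oO; move/continuousP: cs; exact. Qed.

Lemma curve_coord_diff (sigma : R -> M) c t : smooth_curve sigma ->
  dom c (sigma t) -> differentiable (coord c \o sigma : R^o -> vec) t.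
Proof. by move=> [_ ss] ct; exact: smooth_on_diff (ss c) ct. Qed.

Lemma is_derive_curve W O (A : M -> W) (sigma : R -> M) (t : R) : open O ->
  smooth_curve sigma -> smoothM_on O A -> O (sigma t) ->
  is_derive (t : R^o) (1 : R^o) (A \o sigma) (dmat A (sigma t) (velocity sigma t)).
Proof.
move=> oO ss sA Ot; set c := chart_at (sigma t).
have ct : dom c (sigma t) by exact: chart_atP.
have dA := smoothM_diff sA Ot ct.
have ds := curve_coord_diff ss ct.
have E : \forall s \near (t : R^o), ((A \o param c) \o (coord c \o sigma)) s = (A \o sigma) s.
  apply: (@open_nearP _ _ (sigma @^-1` dom c)).
  - by apply: open_curve_preimage; [exact: ss.1|exact: dom_open].
  - exact: ct.
  - by move=> s cs /=; rewrite coordK.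
have dAs : differentiable ((A \o param c) \o (coord c \o sigma) : R^o -> W) t.
  exact: (@differentiable_comp _ _ _ _ (coord c \o sigma : R^o -> vec)).
apply: near_eq_is_derive E _; apply: DeriveDef; first exact: diff_derivable.
have E1 : velocity sigma t = 'D_1 (coord c \o sigma : R^o -> vec) t.
  by rewrite /velocity derive1E.
rewrite /dmat E1.
exact: (@derive_comp R R^o vec W (A \o param c) (coord c \o sigma) t 1 ds dA).
Qed.

Lemma velocity_chart (sigma : R -> M) c (t : R) : smooth_curve sigma ->
  dom c (sigma t) ->
  velocity sigma t *m jac (chart_at (sigma t)) c (sigma t) =
  derive1 (coord c \o sigma) t.
Proof.
move=> ss ct; have p0 := chart_atP (sigma t).
rewrite (mulmx_jac _ p0 ct) /velocity 2!derive1E.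
have ds := curve_coord_diff ss p0; have dT := transition_differentiable p0 ct.
have <- := @derive_comp R R^o vec vec (coord c \o param (chart_at (sigma t)))
   (coord (chart_at (sigma t)) \o sigma) t 1 ds dT.
apply: near_eq_derive; apply: (@open_nearP _ _ (sigma @^-1` dom (chart_at (sigma t)))).
- by apply: open_curve_preimage; [exact: ss.1|exact: dom_open].
- exact: p0.
- by move=> s cs /=; rewrite coordK.
Qed.

(** These derivatives depend on the chart [chart_at p]; only combinations of them,
   such as the bracket and the exterior derivative, are intrinsic. *)
Definition tder k (X : M -> 'M[R]_(k, m)) p v : 'M[R]_(k, m) :=
  'D_v (frame_rep (chart_at p) X) (coord (chart_at p) p).
Definition cder k (W : M -> 'M[R]_(m, k)) p v : 'M[R]_(m, k) :=
  'D_v (coframe_rep (chart_at p) W) (coord (chart_at p) p).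

Lemma frame_rep_at k (X : M -> 'M[R]_(k, m)) p :
  frame_rep (chart_at p) X (coord (chart_at p) p) = X p.
Proof.
by rewrite /frame_rep coordK ?jac_id ?mulmx1 //; exact: chart_atP.
Qed.

Lemma coframe_rep_at k (X : M -> 'M[R]_(m, k)) p :
  coframe_rep (chart_at p) X (coord (chart_at p) p) = X p.
Proof.
by rewrite /coframe_rep coordK ?jac_id ?mul1mx //; exact: chart_atP.
Qed.

Lemma smoothT_diff O k (X : M -> 'M[R]_(k, m)) p : smoothT_on O X -> O p ->
  differentiable (frame_rep (chart_at p) X) (coord (chart_at p) p).
Proof.
move=> sX Op; apply: smooth_on_diff (sX _) _.
by apply: dom_image_coord => //; exact: chart_atP.
Qed.

Lemma smoothC_diff O k (X : M -> 'M[R]_(m, k)) p : smoothC_on O X -> O p ->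
  differentiable (coframe_rep (chart_at p) X) (coord (chart_at p) p).
Proof.
move=> sX Op; apply: smooth_on_diff (sX _) _.
by apply: dom_image_coord => //; exact: chart_atP.
Qed.

(** The pairing of fields with forms can be computed in the chart at [p], since the
   transition matrices of both cancel. *)
Lemma dmat_pairing O k l (X : M -> 'M[R]_(k, m)) (W : M -> 'M[R]_(m, l)) p v :
  open O -> smoothT_on O X -> smoothC_on O W -> O p ->
  dmat (fun q => X q *m W q) p v = tder X p v *m W p + X p *m cder W p v.
Proof.
move=> oO sX sW Op; have p0 := chart_atP p.
have dX := smoothT_diff sX Op; have dW := smoothC_diff sW Op.
have [_] := derive_mulmx (diff_derivable dX) (diff_derivable dW) (v := v).
rewrite frame_rep_at coframe_rep_at => <-.
apply: near_eq_derive; apply: (@open_nearP _ _ (dom_image (chart_at p) O)).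
- exact: open_dom_image.
- exact: dom_image_coord.
- by move=> x /dom_imageP [cx _ _] /=; rewrite frame_coframe_rep.
Qed.

Lemma field_repE c (X : M -> vec) : field_rep c X = frame_rep c X.
Proof. by apply/funext => x; rewrite /field_rep /frame_rep jacE. Qed.

Lemma bracketE (X Y : M -> vec) p : bracket X Y p = tder Y p (X p) - tder X p (Y p).
Proof. by rewrite /bracket !field_repE. Qed.

Lemma bracketC (X Y : M -> vec) p : bracket X Y p = - bracket Y X p.
Proof. by rewrite !bracketE opprB. Qed.

Lemma bracket_self (X : M -> vec) p : bracket X X p = 0.
Proof. by rewrite bracketE subrr. Qed.

Lemma tderN O k (X : M -> 'M[R]_(k, m)) p v : smoothT_on O X -> O p ->
  tder (fun q => - X q) p v = - tder X p v.
Proof.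
move=> sX Op; have dX := smoothT_diff sX Op.
have E : frame_rep (chart_at p) (fun q => - X q) = - frame_rep (chart_at p) X.
  by apply/funext => x; rewrite /frame_rep mulNmx.
by rewrite /tder E deriveN //; exact: diff_derivable.
Qed.

Lemma tderNr O k (X : M -> 'M[R]_(k, m)) p v : smoothT_on O X -> O p ->
  tder X p (- v) = - tder X p v.
Proof.
move=> sX Op; have dX := smoothT_diff sX Op.
by rewrite /tder 2!(deriveE _ dX) linearN.
Qed.

Lemma bracketNr (X Y : M -> vec) p : smooth_field X -> smooth_field Y ->
  bracket X (fun q => - Y q) p = - bracket X Y p.
Proof.
move=> /smooth_fieldP sX /smooth_fieldP sY.
by rewrite !bracketE (tderN _ sY) // (tderNr _ sX) // opprB opprK addrC.
Qed.

Lemma bracketNl (X Y : M -> vec) p : smooth_field X -> smooth_field Y ->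
  bracket (fun q => - X q) Y p = - bracket X Y p.
Proof. by move=> sX sY; rewrite bracketC bracketNr // [in RHS]bracketC. Qed.

End TangentDerivatives.

(** * Bump functions *)

Section BumpFunctions.
Context {R : realType} {m : nat} {M : manifold R m}.
Local Notation vec := 'rV[R]_m.
Implicit Types (c : chart M) (p q : M) (x y v : vec) (O : set M).

Lemma ball_dom_image c O p : open O -> O p -> dom c p ->
  exists2 r : R, 0 < r & forall x, `|x - coord c p| < r -> dom_image c O x.
Proof.
move=> oO Op cp; have oD := open_dom_image (c := c) oO.
have : nbhs (coord c p) (dom_image c O).
  by apply: open_nbhs_nbhs; split=> //; exact: dom_image_coord.
move=> /nbhs_ballP [r /= r0 h]; exists r => // x xr.
by apply: h; rewrite -ball_normE /= distrC.
Qed.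

Lemma compact_param c (B : set vec) : compact B -> B `<=` chart_image c ->
  compact (param c @` B).
Proof.
move=> cB sB; apply: continuous_compact => //.
apply/continuous_in_subspaceT => x /[1!inE] Bx.
by apply: param_continuous; exact: sB.
Qed.

(** The product over the coordinates of [flat 0 (s ^ 2 - (x_i - x0_i) ^ 2)] is
   supported in a box. The image of the box in the manifold is compact, hence
   closed, as the manifold is separated; so the extension by 0 is smooth. *)
Lemma bump_function p O : open O -> O p ->
  exists rho : M -> R^o, exists K : set M,
    [/\ smoothM_on setT rho, rho p != 0, closed K, K `<=` O &
        forall q, ~ K q -> rho q = 0].
Proof.
move=> oO Op; set c := chart_at p; have cp : dom c p := chart_atP p.
have [r r0 Hr] := ball_dom_image oO Op cp.
set x0 := coord c p in Hr; pose s := r / 2; have s0 : 0 < s by rewrite divr_gt0.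
pose B := [set x : vec | forall i, `[x0 0 i - s, x0 0 i + s]%classic (x 0 i)].
have BO x : B x -> dom_image c O x.
  move=> Bx; apply: Hr; apply: (@le_lt_trans _ _ s); last first.
    by rewrite /s ltr_pdivrMr // ltr_pMr // ltr1n.
  apply/mxnorm_leP; first exact: ltW.
  move=> i j; rewrite ord1 !mxE; have := Bx j; rewrite /= in_itv /= => /andP[b1 b2].
  rewrite ler_norml; apply/andP; split; lra.
pose phi (x : vec) : R^o := \prod_(i < m) flat 0 (s ^+ 2 - (x 0 i - x0 0 i) ^+ 2).
have phiB x : phi x != 0 -> B x.
  move=> /prodf_neq0 h i; have := h i isT; have [le0|gt0 _] := leP (s ^+ 2 - (x 0 i - x0 0 i) ^+ 2) 0.
    by rewrite (flat0_eq0 le0) eqxx.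
  rewrite /= in_itv /=.
  have : `|x 0 i - x0 0 i| < s.
    by rewrite -ltr_sqr ?nnegrE ?(ltW s0) // real_normK ?num_real // -subr_gt0.
  by rewrite ltr_norml => /andP[b1 b2]; apply/andP; split; lra.
have phis : smooth_on setT phi.
  have oT : open [set: vec] by exact: openT.
  apply: smooth_on_prod => // i.
  apply: (@smooth_on_comp_R _ _ _ setT (flat 0) (fun x : vec => s ^+ 2 - (x 0 i - x0 0 i) ^+ 2 : R^o)) => //.
    exact: flat_smooth.
  apply: smooth_onD => //; first exact: smooth_on_cst.
  apply: smooth_onN => //.
  have s1 : smooth_on setT (fun x : vec => x 0 i - x0 0 i : R^o).
    apply: smooth_onD => //; first exact: smooth_on_coord.
    exact: smooth_on_cst.
  by have := smooth_onM oT s1 s1; apply: smooth_on_eq.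
pose K := param c @` B.
have Bi : B `<=` chart_image c.
  by move=> x Bx; have /dom_imageP [cx _ E] := BO _ Bx; exists (param c x).
have cK : closed K.
  apply: compact_closed; first exact: carrier_hausdorff.
  apply: compact_param => //.
  exact: (@rV_compact _ m (fun i => `[x0 0 i - s, x0 0 i + s]%classic) (fun i => @segment_compact R _ _)).
pose rho q : R^o := if `[< dom c q >] then phi (coord c q) else 0.
have rhoK q : ~ K q -> rho q = 0.
  move=> nK; rewrite /rho; case: asboolP => // cq.
  by apply/eqP; apply: contra_notT nK => /phiB Bq; exists (coord c q); rewrite ?coordK.
exists rho, K; split=> //.
- apply: smoothM_on_near => q _; have [cq|ncq] := pselect (dom c q).
    exists (dom c), rho; split=> //; first exact: dom_open.
    apply: (@smoothM_on_chart_fun _ _ _ _ c) => //; first exact: dom_open.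
    have : smooth_on (dom_image c (dom c)) phi by exact: smooth_on_subset phis.
    apply: smooth_on_eq; first by apply: open_dom_image; exact: dom_open.
    move=> x /dom_imageP [cx _ E]; by rewrite /= /rho asboolT // E.
  exists (~` K), (fun=> 0); split; first exact: closed_openC.
  + by move=> [x Bx E]; have /dom_imageP [cx _ _] := BO _ Bx; apply: ncq; rewrite -E.
  + exact: smoothM_cst.
  + by move=> q' /rhoK ->.
- rewrite /rho asboolT //; apply/prodf_neq0 => i _.
  by apply: flat0_gt0; rewrite subrr expr0n subr0 exprn_gt0.
- by move=> _ [x Bx <-]; have /dom_imageP [] := BO _ Bx.
Qed.

Lemma smoothM_funM O (f g : M -> R^o) : open O ->
  smoothM_on O f -> smoothM_on O g -> smoothM_on O (fun p => f p * g p : R^o).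
Proof. by move=> oO sf sg c; apply: smooth_onM (sf c) (sg c); exact: open_dom_image. Qed.

Lemma smoothT_scale O k (f : M -> R^o) (X : M -> 'M[R]_(k, m)) : open O ->
  smoothM_on O f -> smoothT_on O X -> smoothT_on O (fun p => f p *: X p).
Proof.
move=> oO sf sX c; have oD := open_dom_image (c := c) oO.
apply: (smooth_on_eq oD _ (smooth_onZ oD (sf c) (sX c))) => x _.
by rewrite /frame_rep /= scalemxAl.
Qed.

Lemma dmat_funM O (f g : M -> R^o) p v : smoothM_on O f -> smoothM_on O g -> O p ->
  dmat (fun q => f q * g q : R^o) p v = dmat f p v * g p + f p * dmat g p v :> R.
Proof.
move=> sf sg Op; have cp := chart_atP p.
have df := diff_derivable (v := v) (smoothM_diff sf Op cp).
have dg := diff_derivable (v := v) (smoothM_diff sg Op cp).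
apply: (etrans (deriveM df dg)).
by rewrite /GRing.scale /= coordK // addrC mulrC.
Qed.

(** On the complement of the closed support the product is 0. *)
Lemma smooth_bump_mul O (K : set M) (rho f : M -> R^o) : open O -> closed K -> K `<=` O ->
  smoothM_on setT rho -> (forall q, ~ K q -> rho q = 0) -> smoothM_on O f ->
  smoothM_on setT (fun q => rho q * f q : R^o).
Proof.
move=> oO cK KO srho rhoK sf; apply: smoothM_on_near => q _.
have [Oq|nOq] := pselect (O q).
  exists O, (fun q => rho q * f q : R^o); split=> //.
  by apply: smoothM_funM => //; exact: smoothM_onS srho.
exists (~` K), (fun=> 0); split; [exact: closed_openC|by move=> /KO|exact: smoothM_cst|].
by move=> q' /rhoK ->; rewrite mul0r.
Qed.

End BumpFunctions.

(** * Connections are local *)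

Section ConnectionLocality.
Context {R : realType} {m : nat} {M : manifold R m}.
Local Notation vec := 'rV[R]_m.
Context (nabla : M -> vec -> (M -> vec) -> vec) (nablaP : connection nabla).
Implicit Types (p q : M) (u v w : vec) (X Y : M -> vec) (O : set M).

Lemma smooth_field_eq X Y : X =1 Y -> smooth_field X -> smooth_field Y.
Proof. by move=> /funext ->. Qed.

Lemma smooth_field0 : smooth_field (M := M) (fun=> 0).
Proof.
apply/smooth_fieldP => c; rewrite (_ : frame_rep c _ = fun=> 0).
  exact: smooth_on_cst.
by apply/funext => x; rewrite /frame_rep mul0mx.
Qed.

Lemma smooth_fieldD X Y : smooth_field X -> smooth_field Y ->
  smooth_field (fun p => X p + Y p).
Proof.
move=> /smooth_fieldP sX /smooth_fieldP sY; apply/smooth_fieldP => c.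
have oD : open (dom_image c setT) by apply: open_dom_image; exact: openT.
apply: (smooth_on_eq oD _ (smooth_onD oD (sX c) (sY c))) => x _.
by rewrite /frame_rep mulmxDl.
Qed.

Lemma smooth_fieldZ (f : M -> R^o) X : smoothM_on setT f -> smooth_field X ->
  smooth_field (fun p => f p *: X p).
Proof.
move=> sf /smooth_fieldP sX; apply/smooth_fieldP.
by apply: smoothT_scale => //; exact: openT.
Qed.

Lemma smooth_field_sum I (s : seq I) (X : I -> M -> vec) :
  (forall i, smooth_field (X i)) -> smooth_field (fun p => \sum_(i <- s) X i p).
Proof.
move=> sX; elim: s => [|i s IH].
  by apply: smooth_field_eq smooth_field0 => p; rewrite big_nil.
by apply: smooth_field_eq (smooth_fieldD (sX i) IH) => p; rewrite big_cons.
Qed.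

Lemma nabla_linear p a u v X : smooth_field X ->
  nabla p (a *: u + v) X = a *: nabla p u X + nabla p v X.
Proof. by move=> sX; have [h _ _ _] := nablaP; exact: h. Qed.

Lemma nabla0v p X : smooth_field X -> nabla p 0 X = 0.
Proof.
move=> sX; have := nabla_linear p 1 0 0 sX; rewrite !scale1r addr0 => /eqP.
by rewrite -subr_eq0 opprD addrA subrr sub0r oppr_eq0 => /eqP.
Qed.

Lemma nablaZv p (a : R) u X : smooth_field X -> nabla p (a *: u) X = a *: nabla p u X.
Proof. by move=> sX; have := nabla_linear p a u 0 sX; rewrite (nabla0v p sX) !addr0. Qed.

Lemma nablaNv p u X : smooth_field X -> nabla p (- u) X = - nabla p u X.
Proof. by move=> sX; rewrite -scaleN1r nablaZv // scaleN1r. Qed.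

Lemma nabla_sumv p k (a : 'I_k -> R) (u : 'I_k -> vec) X : smooth_field X ->
  nabla p (\sum_i a i *: u i) X = \sum_i a i *: nabla p (u i) X.
Proof.
move=> sX; elim: (index_enum _) => [|i s IH]; last first.
  by rewrite !big_cons nabla_linear // IH.
by rewrite !big_nil; have := nablaZv p 0 0 sX; rewrite !scale0r.
Qed.

Lemma nablaD p v X Y : smooth_field X -> smooth_field Y ->
  nabla p v (fun q => X q + Y q) = nabla p v X + nabla p v Y.
Proof. by move=> sX sY; have [_ h _ _] := nablaP; exact: h. Qed.

Lemma nabla0 p v : nabla p v (fun=> 0) = 0.
Proof.
have := nablaD p v smooth_field0 smooth_field0.
rewrite (_ : (fun _ => 0 + 0) = (fun=> 0)); last by apply/funext => q; rewrite addr0.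
by move=> /eqP; rewrite -subr_eq0 opprD addrA subrr sub0r oppr_eq0 => /eqP.
Qed.

Lemma nabla_leibniz p v (f : M -> R^o) X : smoothM_on setT f -> smooth_field X ->
  nabla p v (fun q => f q *: X q) = dmat f p v *: X p + f p *: nabla p v X.
Proof.
move=> sf sX; have [_ _ h _] := nablaP; apply: h => //.
exact/smooth_funP.
Qed.

Lemma nabla_sum I (s : seq I) p v (X : I -> M -> vec) :
  (forall i, smooth_field (X i)) ->
  nabla p v (fun q => \sum_(i <- s) X i q) = \sum_(i <- s) nabla p v (X i).
Proof.
move=> sX; elim: s => [|i s IH].
  rewrite big_nil -[RHS](nabla0 p v); congr (nabla p v _).
  by apply/funext => q; rewrite big_nil.
rewrite big_cons -IH -nablaD //; last exact: smooth_field_sum.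
by congr (nabla p v _); apply/funext => q; rewrite big_cons.
Qed.

Lemma nabla_smooth X Y : smooth_field X -> smooth_field Y ->
  smooth_field (fun p => nabla p (X p) Y).
Proof. by move=> sX sY; have [_ _ _ h] := nablaP; exact: h. Qed.

Definition nablaF k (F : M -> 'M[R]_(k, m)) p v : 'M[R]_(k, m) :=
  \matrix_j nabla p v (fun q => row j (F q)).

(** The covariant derivative at [p] is determined by the components of the field
   in a frame near [p], even though the connection only applies to global
   fields: multiply everything by a bump function and cancel. *)
Lemma nabla_frame O k (F : M -> 'M[R]_(k, m)) (a : M -> 'rV[R]_k) Y p v :
  open O -> O p -> smoothT_on setT F -> smooth_field Y -> smoothM_on O a ->
  (forall q, O q -> Y q = a q *m F q) ->
  nabla p v Y = dmat a p v *m F p + a p *m nablaF F p v.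
Proof.
move=> oO Op sF sY sa YaF.
(* The functions [f j] are global, and [rho *: Y] is [\sum_j f j *: F_j] everywhere. *)
have [rho [K [srho rhop cK KO rhoK]]] := bump_function oO Op.
have sFj j : smooth_field (fun q => row j (F q)).
  by apply/smooth_fieldP; exact: (smoothT_rowP F openT).1 sF j.
pose f j : M -> R^o := fun q => rho q * a q 0 j.
have saj j : smoothM_on O (fun q => a q 0 j : R^o) by exact: (smoothM_onP a oO).1 sa 0 j.
have sf j : smoothM_on setT (f j) by exact: smooth_bump_mul oO cK KO srho rhoK (saj j).
have E : (fun q => rho q *: Y q) = (fun q => \sum_j f j q *: row j (F q)).
  apply/funext => q; have [Kq|nK] := pselect (K q); last first.
    by rewrite rhoK // scale0r big1 // => j _; rewrite /f rhoK // mul0r scale0r.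
  rewrite YaF; last exact: KO.
  rewrite mulmx_sum_row scaler_sumr; apply: eq_bigr => j _.
  by rewrite scalerA.
have := nabla_leibniz p v srho sY; rewrite E nabla_sum; last first.
  by move=> j; apply: smooth_fieldZ.
have daj j : dmat (fun q => a q 0 j : R^o) p v = dmat a p v 0 j.
  rewrite /dmat derive_mx ?mxE //; apply: diff_derivable.
  by apply: smoothM_diff sa Op _; exact: chart_atP.
have -> : \sum_j nabla p v (fun q => f j q *: row j (F q)) =
   dmat rho p v *: Y p + rho p *: (dmat a p v *m F p + a p *m nablaF F p v).
  rewrite YaF // (mulmx_sum_row (a p) (F p)) (mulmx_sum_row (dmat a p v)).
  rewrite (mulmx_sum_row (a p)) -big_split /= !scaler_sumr -big_split /=.
  apply: eq_bigr => j _; rewrite nabla_leibniz //.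
  have srhoO : smoothM_on O rho by exact: smoothM_onS srho.
  rewrite (dmat_funM v srhoO (saj j) Op) daj rowK scalerDl.
  by rewrite scalerDr !scalerA /f -addrA.
move=> /addrI /esym; exact: scalerI.
Qed.

(** * Covariant derivative along a curve, in a frame *)

(** In terms of the components [a] in a frame [F], the covariant derivative along a
   curve is [a' *m F + a *m nablaF F], whatever global fields are used to write
   the vector field along the curve. *)
Lemma cov_der_frame O (F : M -> 'M[R]_m) sigma V (t : R) w :
  open O -> O (sigma t) -> smoothT_on setT F ->
  (forall q, O q -> F q \in unitmx) ->
  smooth_curve sigma -> cov_der nabla sigma V t w ->
  is_derive (t : R^o) (1 : R^o) (fun s => V s *m invmx (F (sigma s)))
    ((w - V t *m invmx (F (sigma t)) *m nablaF F (sigma t) (velocity sigma t))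
      *m invmx (F (sigma t))).
Proof.
move=> oO Ot sF uF ss [N [g [X [sg sX EV ->]]]].
set p := sigma t; set u := velocity sigma t.
pose f k q := X k q *m invmx (F q).
have sFO : smoothT_on O F by exact: smoothT_onS sF.
have sf k : smoothM_on O (f k).
  apply: smooth_pairing => //; last exact: smoothC_inv.
  by apply: (smoothT_onS (O := setT)) => //; exact/smooth_fieldP.
have EX k q : O q -> X k q = f k q *m F q.
  by move=> Oq; rewrite /f mulmxKV // uF.
have dfk k : is_derive (t : R^o) (1 : R^o) (f k \o sigma) (dmat (f k) p u).
  exact: (is_derive_curve oO ss (sf k) Ot).
have dgk k : differentiable (g k : R^o -> R^o) t by exact: smooth_on_diff (sg k) _.
have dZ k : is_derive (t : R^o) (1 : R^o) (fun s => g k s *: (f k \o sigma) s)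
    (derive1 (g k) t *: f k p + g k t *: dmat (f k) p u).
  have dg1 : is_derive (t : R^o) (1 : R^o) (g k : R^o -> R^o) (derive1 (g k) t).
    by rewrite derive1E; apply: derivableP; exact: diff_derivable.
  exact: is_derive_scalemx dg1 (dfk k).
have dS := is_derive_sum dZ.
have En : \forall s \near (t : R^o), (\sum_k (fun s => g k s *: (f k \o sigma) s)) s
    = V s *m invmx (F (sigma s)).
  have nO : \forall s \near (t : R^o), O (sigma s).
    apply: (@open_nearP _ _ (sigma @^-1` O)) => //.
    by apply: open_curve_preimage => //; exact: ss.1.
  near=> s; have -> : V s = \sum_k g k s *: X k (sigma s) by near: s.
  rewrite fct_sumE mulmx_suml; apply: eq_bigr => k _.
  by rewrite -scalemxAl.
apply: (near_eq_is_derive En); apply: is_derive_eq dS _.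
have Vt := nbhs_singleton En; rewrite -Vt.
apply: (canRL (mulmxK (uF p Ot))).
rewrite fct_sumE !mulmx_suml -sumrB; apply: eq_bigr => k _ /=.
rewrite (nabla_frame u oO Ot sF (sX k) (sf k) (EX k)) EX //.
by rewrite -scalemxAl mulmxDl -!scalemxAl scalerDr addrA addrK.
Unshelve. all: by end_near. Qed.

End ConnectionLocality.

(** * Parallel transport *)

Section ParallelTransport.
Context {R : realType} {m : nat} {M : manifold R m}.
Local Notation vec := 'rV[R]_m.
Context (nabla : M -> vec -> (M -> vec) -> vec) (nablaP : connection nabla).
Implicit Types (p q : M) (u v w : vec) (X Y : M -> vec) (sigma : R -> M).

Definition affine (a b : R) (t : R) : R := a * t + b.

Lemma affine_smooth a b : smooth_on setT (affine a b : R^o -> R^o).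
Proof.
have sid : smooth_on setT (fun t : R^o => t).
  apply: (@smooth_on_linear _ _ _ _ (@idfun R^o)).
  by move=> x; exact: cvg_id.
apply: smooth_onD; [exact: openT| |exact: smooth_on_cst].
by apply: smooth_onM => //; [exact: openT|exact: smooth_on_cst].
Qed.

Lemma is_derive_affine (a b t : R) : is_derive (t : R^o) (1 : R^o) (affine a b : R^o -> R^o) a.
Proof.
have [d E] := is_deriveD (is_deriveZ a (@is_derive_id R R^o t 1)) (is_derive_cst (b : R^o) t (1 : R^o)).
apply: DeriveDef; first exact: d.
by apply: (etrans E); rewrite addr0 [_ *: _]mulr1.
Qed.

Lemma affine_diff a b t : differentiable (affine a b : R^o -> R^o) t.
Proof. by apply: smooth_on_diff (affine_smooth a b) _. Qed.

Lemma derive1_affine (W : normedModType R) (f : R -> W) a b t :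
  differentiable (f : R^o -> W) (affine a b t) ->
  derive1 (f \o affine a b) t = a *: derive1 f (affine a b t).
Proof.
move=> df; rewrite !derive1E.
have E := @derive_comp R R^o R^o W f (affine a b) t 1 (affine_diff a b t) df.
rewrite [LHS]E; have [_ ->] := is_derive_affine a b t.
rewrite -[X in 'D_X _ _](mulr1 a) 2!(deriveE _ df).
exact: (linearZZ ('d f (affine a b t)) a (1 : R^o)).
Qed.

Lemma smooth_curve_affine sigma a b : smooth_curve sigma -> smooth_curve (sigma \o affine a b).
Proof.
move=> [cs ss]; split.
  move=> t; apply: continuous_comp; last exact: cs.
  by apply: differentiable_continuous; exact: affine_diff.
move=> c; pose U : set R^o := sigma @^-1` dom c.
have oU : open U by apply: open_curve_preimage => //; exact: dom_open.
have oV : open (affine a b @^-1` U : set R^o).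
  apply: (open_comp _ oU) => t _.
  by apply: differentiable_continuous; exact: affine_diff.
apply/smooth_on_mxP => // i j.
apply: (@smooth_on_comp_R _ _ _ U (fun t => (coord c \o sigma) t i j) (affine a b)) => //.
  exact: (smooth_on_mxP _ oU).1 (ss c) i j.
exact: smooth_on_subset (affine_smooth a b).
Qed.

Lemma velocity_affine sigma a b t : smooth_curve sigma ->
  velocity (sigma \o affine a b) t = a *: velocity sigma (affine a b t).
Proof.
move=> ss; rewrite /velocity /=.
set c := chart_at _.
apply: (@derive1_affine _ (coord c \o sigma)).
by apply: curve_coord_diff => //; exact: chart_atP.
Qed.

Lemma cov_der_affine sigma V a b t w : smooth_curve sigma ->
  cov_der nabla sigma V (affine a b t) w ->
  cov_der nabla (sigma \o affine a b) (V \o affine a b) t (a *: w).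
Proof.
move=> ss [N [g [X [sg sX EV ->]]]].
exists N, (fun k => g k \o affine a b), X; split=> //.
- move=> k; apply: (@smooth_on_comp_R _ _ _ setT (g k) (affine a b)) => //.
  + exact: openT.
  + exact: affine_smooth.
- have ca : {for t, continuous (affine a b : R^o -> R^o)}.
    by apply: differentiable_continuous; exact: affine_diff.
  exact: (ca _ EV).
- rewrite scaler_sumr; apply: eq_bigr => k _.
  rewrite derive1_affine; last exact: smooth_on_diff (sg k) _.
  rewrite velocity_affine // nablaZv // scalerDr !scalerA /=.
  by rewrite [a * g k _]mulrC.
Qed.

Lemma cov_der_linear sigma V V' t w w' (a : R) :
  cov_der nabla sigma V t w -> cov_der nabla sigma V' t w' ->
  cov_der nabla sigma (fun s => a *: V s + V' s) t (a *: w + w').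
Proof.
move=> [N [g [X [sg sX EV ->]]]] [N' [g' [X' [sg' sX' EV' ->]]]].
pose h (i : 'I_(N + N')) : R -> R :=
  match fintype.split i with inl k => fun s => a * g k s | inr k => g' k end.
pose Y (i : 'I_(N + N')) : M -> vec :=
  match fintype.split i with inl k => X k | inr k => X' k end.
have hl k : h (lshift N' k) = fun s => a * g k s by rewrite /h (unsplitK (inl k)).
have hr k : h (rshift N k) = g' k by rewrite /h (unsplitK (inr k)).
have Yl k : Y (lshift N' k) = X k by rewrite /Y (unsplitK (inl k)).
have Yr k : Y (rshift N k) = X' k by rewrite /Y (unsplitK (inr k)).
exists (N + N')%N, h, Y; split.
- move=> i; rewrite /h; case: (fintype.split i) => k //.
  by apply: smooth_onM; [exact: openT|exact: smooth_on_cst|exact: sg].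
- by move=> i; rewrite /Y; case: (fintype.split i).
- near=> s; rewrite big_split_ord /=.
  have -> : V s = \sum_k g k s *: X k (sigma s) by near: s.
  have -> : V' s = \sum_k g' k s *: X' k (sigma s) by near: s.
  rewrite scaler_sumr; congr (_ + _); apply: eq_bigr => k _.
    by rewrite hl Yl scalerA.
  by rewrite hr Yr.
- rewrite big_split_ord /= scaler_sumr; congr (_ + _); apply: eq_bigr => k _.
    rewrite hl Yl scalerDr !scalerA; congr (_ *: _ + _).
    rewrite !derive1E.
    have dg : differentiable (g k : R^o -> R^o) t by exact: smooth_on_diff (sg k) _.
    exact: esym (@deriveZ R R^o R^o (g k) a t 1 (diff_derivable dg)).
  by rewrite hr Yr.
Unshelve. all: by end_near. Qed.

Lemma curve_transport_linear sigma u v u' v' (a : R) :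
  curve_transport nabla sigma u v -> curve_transport nabla sigma u' v' ->
  curve_transport nabla sigma (a *: u + u') (a *: v + v').
Proof.
move=> [V [V1 <- <-]] [V' [V1' <- <-]]; exists (fun s => a *: V s + V' s); split=> // t.
by have := cov_der_linear a (V1 t) (V1' t); rewrite scaler0 addr0.
Qed.

(** Allows one to run a curve backwards, and to stop it at any time. *)
Lemma curve_transport_affine sigma V a b : smooth_curve sigma ->
  (forall t, cov_der nabla sigma V t 0) ->
  curve_transport nabla (sigma \o affine a b) (V b) (V (a + b)).
Proof.
move=> ss HV; exists (V \o affine a b); split=> [t||].
- by rewrite -[X in cov_der _ _ _ _ X](scaler0 _ a); exact: cov_der_affine.
- by rewrite /= /affine mulr0 add0r.
- by rewrite /= /affine mulr1.
Qed.

Lemma curve_transport_rev sigma u v : smooth_curve sigma ->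
  curve_transport nabla sigma u v ->
  curve_transport nabla (sigma \o affine (-1) 1) v u.
Proof.
move=> ss [V [HV <- <-]].
by have := curve_transport_affine (-1) 1 ss HV; rewrite addNr.
Qed.

Lemma transport_linear s u v u' v' (a : R) :
  transport nabla s u v -> transport nabla s u' v' ->
  transport nabla s (a *: u + u') (a *: v + v').
Proof.
elim: s u u' => [|sigma s IH] u u' /=; first by move=> -> ->.
move=> [w h1 h2] [w' h1' h2']; exists (a *: w + w').
  exact: curve_transport_linear.
exact: IH.
Qed.

Lemma transport_cat s s' u v w :
  transport nabla s u v -> transport nabla s' v w -> transport nabla (s ++ s') u w.
Proof.
elim: s u => [|sigma s IH] u /=; first by move=> ->.
by move=> [x h1 h2] h3; exists x => //; exact: IH.
Qed.

Lemma transport_cat_inv s s' u w :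
  transport nabla (s ++ s') u w -> exists2 v, transport nabla s u v & transport nabla s' v w.
Proof.
elim: s u => [|sigma s IH] u /=; first by exists u.
by move=> [x h1 /IH [v h2 h3]]; exists v => //; exists x.
Qed.

Lemma path_cat s s' p q r : piecewise_path p s q -> piecewise_path q s' r ->
  piecewise_path p (s ++ s') r.
Proof.
elim: s p => [|sigma s IH] p /=; first by move=> ->.
by move=> [h1 h2 h3] h4; split=> //; exact: IH.
Qed.

Definition rev_path (s : seq (R -> M)) : seq (R -> M) :=
  rev [seq sigma \o affine (-1) 1 | sigma <- s].

Lemma rev_path_cons sigma s : rev_path (sigma :: s) = rev_path s ++ [:: sigma \o affine (-1) 1].
Proof. by rewrite /rev_path /= rev_cons cats1. Qed.

Lemma path_rev s p q : piecewise_path p s q -> piecewise_path q (rev_path s) p.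
Proof.
elim: s p => [|sigma s IH] p; first by move=> /= ->.
move=> [h1 h2 /IH h3]; rewrite rev_path_cons; apply: path_cat h3 _ => /=.
split; first exact: smooth_curve_affine.
  by rewrite /affine mulr0 add0r.
by rewrite /affine mulr1 addNr.
Qed.

Lemma transport_rev s p q u v : piecewise_path p s q ->
  transport nabla s u v -> transport nabla (rev_path s) v u.
Proof.
elim: s p u => [|sigma s IH] p u; first by move=> _ /= ->.
move=> [h1 h2 h3] [w h4 h5]; rewrite rev_path_cons.
apply: transport_cat (IH _ _ h3 h5) _; exists u => //.
exact: curve_transport_rev.
Qed.

Context (hol : trivial_holonomy nabla).

(** A path followed by its reverse is a loop, along which transport exists by
   hypothesis. *)
Lemma transport_ex s p q u : piecewise_path p s q -> exists w, transport nabla s u w.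
Proof.
move=> ps; have loop := path_cat ps (path_rev ps).
by have [w h _] := transport_cat_inv ((hol loop u u).2 erefl); exists w.
Qed.

Lemma transport_uniq s s' p q u w w' :
  piecewise_path p s q -> piecewise_path p s' q ->
  transport nabla s u w -> transport nabla s' u w' -> w = w'.
Proof.
move=> ps ps' h h'; have loop := path_cat (path_rev ps) ps'.
by apply: (hol loop w w').1; exact: transport_cat (transport_rev ps h) h'.
Qed.

Lemma transport_inj s p q u u' w : piecewise_path p s q ->
  transport nabla s u w -> transport nabla s u' w -> u = u'.
Proof.
move=> ps /(transport_rev ps) h /(transport_rev ps).
exact: transport_uniq (path_rev ps) (path_rev ps) h.
Qed.

(** The hypothesis on holonomy gives transport along the constant loop, and the
   transported vector is near time 0 a combination of values of global fields. *)
Lemma field_through p u : exists2 X, smooth_field X & X p = u.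
Proof.
have sc : smooth_curve (fun=> p : M).
  split; first by move=> t; exact: cvg_cst.
  by move=> c; exact: smooth_on_cst.
have loop : piecewise_path p [:: fun=> p] p by [].
have [w [V [HV <- _]] _] := (hol loop u u).2 erefl.
have [N [g [X [sg sX EV _]]]] := HV 0.
exists (fun q => \sum_k g k 0 *: X k q); last by rewrite (nbhs_singleton EV).
apply: smooth_field_sum => k; apply: smooth_fieldZ => //.
exact: smoothM_cst.
Qed.

End ParallelTransport.

(** * Short curves and path connectedness *)

Section PathConnectedness.
Context {R : realType} {m : nat} {M : manifold R m}.
Local Notation vec := 'rV[R]_m.
Implicit Types (c d : chart M) (p q : M) (x h : vec).

Definition chart_curve c x h (t : R) : M := param c (x + tau t *: h).

Lemma chart_curve_smooth c x h :
  (forall s : R, `|s| <= 1 -> chart_image c (x + s *: h)) ->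
  smooth_curve (chart_curve c x h).
Proof.
move=> H.
have Ht t : chart_image c (x + tau t *: h) by apply: H; exact: tau_le1.
have oT : open [set: R^o] by exact: openT.
have sg : smooth_on setT (fun t : R^o => x + tau t *: h).
  apply: smooth_onD => //; first exact: smooth_on_cst.
  by apply: smooth_onZ => //; [exact: smooth_tau|exact: smooth_on_cst].
have cs : continuous (chart_curve c x h).
  move=> t; apply: (@continuous_comp _ _ _ (fun t : R^o => x + tau t *: h) (param c)).
    by apply: smooth_on_cont sg _.
  exact: param_continuous (Ht t).
split=> // d.
have oU := open_curve_preimage cs (dom_open d).
have oD : open (dom_image c (dom d)) by apply: open_dom_image; exact: dom_open.
apply: (@smooth_on_comp_rV_mx _ _ _ _ _ _ (dom_image c (dom d)) (coord d \o param c)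
  (fun t : R^o => x + tau t *: h)) => //.
- by move=> t dt; rewrite dom_imageE; split.
- exact: transition_smooth.
- exact: smooth_on_subset sg.
Qed.

Lemma chart_curve0 c x h : chart_curve c x h 0 = param c x.
Proof. by rewrite /chart_curve tau0 scale0r addr0. Qed.

Lemma chart_curve1 c x h : chart_curve c x h 1 = param c (x + h).
Proof. by rewrite /chart_curve tau1 scale1r. Qed.

(** In a chart, inside a ball whose triple is contained in the image. *)
Lemma nbhs_joined p : exists2 B : set M, nbhs p B &
  forall a b, B a -> B b -> exists sigma, [/\ smooth_curve sigma, sigma 0 = a & sigma 1 = b].
Proof.
set c := chart_at p; have cp : dom c p := chart_atP p.
have [r r0 Hr] := ball_dom_image (@openT M) I cp.
pose B := dom c `&` [set q | `|coord c q - coord c p| < r / 3].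
have r3 : 0 < r / 3 by rewrite divr_gt0.
exists B.
  apply: filterI; first by apply: open_nbhs_nbhs; split=> //; exact: dom_open.
  have /cvgrPdist_lt/(_ _ r3) := @coord_continuous _ _ M c p cp.
  by apply: filterS => q; rewrite /= distrC.
move=> a b [ca ra] [cb rb]; rewrite /= in ra rb.
exists (chart_curve c (coord c a) (coord c b - coord c a)); split.
- apply: chart_curve_smooth => s s1; rewrite -dom_imageT; apply: Hr.
  rewrite addrAC (le_lt_trans (ler_normD _ _)) //.
  have h1 : `|s *: (coord c b - coord c a)| <= `|coord c b - coord c p| + `|coord c a - coord c p|.
    rewrite normrZ (le_trans (ler_wpM2r _ s1)) // mul1r.
    by rewrite -(subrKA (coord c p)) (le_trans (ler_normD _ _)) // [`|coord c p - _|]distrC.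
  apply: le_lt_trans (lerD (lexx _) h1) _; lra.
- by rewrite chart_curve0 coordK.
- by rewrite chart_curve1 addrC subrK coordK.
Qed.

(** The set of points that can be reached from [p] is open and closed. *)
Lemma path_exists p q : connected [set: M] -> exists s, piecewise_path p s q.
Proof.
move=> cM; pose B := [set q | exists s, piecewise_path p s q].
have step a b : (exists sigma, [/\ smooth_curve sigma, sigma 0 = a & sigma 1 = b]) ->
    B a -> B b.
  move=> [sigma [ss s0 s1]] [s ps]; exists (s ++ [:: sigma]).
  by apply: path_cat ps _.
have oB : open B.
  rewrite openE => a Ba; have [N nN HN] := nbhs_joined a.
  have Na := nbhs_singleton nN.
  apply: filterS nN => b Nb; apply: step Ba.
  exact: (HN a b Na Nb).
have cB : closed B.
  rewrite -openC openE => a nBa; have [N nN HN] := nbhs_joined a.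
  have Na := nbhs_singleton nN.
  apply: filterS nN => b Nb Bb; apply: nBa; apply: step Bb.
  exact: (HN b a Nb Na).
suff E : B = [set: M] by have : B q by rewrite E.
apply: cM; first by exists p, [::].
- by exists B => //; rewrite setTI.
- by exists B => //; rewrite setTI.
Qed.

(** The determinant of the components in a chart is continuous. *)
Lemma open_frame (F : M -> 'M[R]_m) : smoothT_on setT F ->
  open [set q | F q \in unitmx].
Proof.
move=> sF; rewrite openE => q /= Fq.
set c := chart_at q; have cq : dom c q := chart_atP q.
have oD : open (dom_image c setT) by apply: open_dom_image; exact: openT.
pose f x : R^o := \det (frame_rep c F x).
have sf : smooth_on (dom_image c setT) f by exact: smooth_on_det.
have cf : {for coord c q, continuous f}.
  by apply: smooth_on_cont sf _; exact: dom_image_coord.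
have f0 : f (coord c q) != 0.
  by rewrite /f frame_rep_at -unitfE -unitmxE.
have nf : \forall y \near coord c q, f y != 0 by exact: (cvgr_neq0 _ cf f0).
have nq : \forall q' \near q, f (coord c q') != 0.
  exact: (coord_continuous cq nf).
have nc : \forall q' \near q, dom c q'.
  by apply: open_nbhs_nbhs; split=> //; exact: dom_open.
near=> q' => /=.
have cq' : dom c q' by near: q'.
have : f (coord c q') != 0 by near: q'.
rewrite /f /frame_rep coordK // det_mulmx mulf_eq0 negb_or => /andP[h _].
by rewrite unitmxE unitfE.
Unshelve. all: by end_near. Qed.

End PathConnectedness.

(** * The parallel frame of a connection with trivial holonomy *)

Section ParallelFrame.
Context {R : realType} {m : nat} {M : manifold R m}.
Local Notation vec := 'rV[R]_m.
Context (nabla : M -> vec -> (M -> vec) -> vec) (nablaP : connection nabla).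
Context (hol : trivial_holonomy nabla) (cM : connected [set: M]) (p0 : M).
Implicit Types (p q : M) (u v w : vec) (sigma : R -> M).

Lemma par_ex u q : exists w, exists2 s, piecewise_path p0 s q & transport nabla s u w.
Proof.
have [s ps] := path_exists p0 q cM.
by have [w h] := transport_ex hol u ps; exists w, s.
Qed.

Definition par u q : vec := sval (cid (par_ex u q)).

Lemma parP s u q : piecewise_path p0 s q -> transport nabla s u (par u q).
Proof.
move=> ps; have [w hw] := transport_ex hol u ps.
rewrite /par; case: cid => w' /= [s' ps' hs'].
by rewrite -(transport_uniq nablaP hol ps ps' hw hs').
Qed.

Lemma par_eq s u q w : piecewise_path p0 s q -> transport nabla s u w -> par u q = w.
Proof.
by move=> ps h; have h' := parP u ps; exact: (transport_uniq nablaP hol ps ps h' h).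
Qed.

Lemma par_linear (a : R) u v q : par (a *: u + v) q = a *: par u q + par v q.
Proof.
have [s ps] := path_exists p0 q cM.
by apply: (par_eq ps); apply: transport_linear => //; exact: parP.
Qed.

Lemma par_inj u v q : par u q = par v q -> u = v.
Proof.
have [s ps] := path_exists p0 q cM => E.
have h := parP u ps; have h' := parP v ps; rewrite -E in h'.
exact: (transport_inj nablaP hol ps h h').
Qed.

(** At each time [a], the curve run up to time [a] is a path to [sigma a], so the
   solution of the equation of parallel transport that starts at [par u (sigma 0)]
   takes the value [par u (sigma a)]. *)
Lemma par_cov_der u sigma t : smooth_curve sigma ->
  cov_der nabla sigma (par u \o sigma) t 0.
Proof.
move=> ss; have [s ps] := path_exists p0 (sigma 0) cM.
have p1 : piecewise_path (sigma 0) [:: sigma] (sigma 1) by [].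
have [w [_ [V [HV V0 _]] _]] := transport_ex hol (par u (sigma 0)) p1.
suff -> : par u \o sigma = V by exact: HV.
apply/funext => a /=.
have pa : piecewise_path (sigma 0) [:: sigma \o affine a 0] (sigma a).
  split=> /=; first exact: smooth_curve_affine.
    by rewrite /affine mulr0 addr0.
  by rewrite /affine mulr1 addr0.
apply: (par_eq (path_cat ps pa)); apply: transport_cat (parP u ps) _.
have := curve_transport_affine nablaP a 0 ss HV; rewrite V0 addr0 => h.
by exists (V a).
Qed.

Definition par_frame q : 'M[R]_m := \matrix_i par (delta_mx 0 i) q.

Lemma par_frameE u q : par u q = u *m par_frame q.
Proof.
rewrite mulmx_sum_row {1}(row_sum_delta u).
elim: (index_enum _) => [|i s IH].
  by rewrite !big_nil; have := par_linear (-1) 0 0 q; rewrite scaler0 addr0 scaleN1r addNr.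
by rewrite !big_cons par_linear IH rowK.
Qed.

Lemma par_frame_unit q : par_frame q \in unitmx.
Proof.
rewrite -row_free_unit -kermx_eq0; apply/eqP/row_matrixP => i.
rewrite row0; apply: (@par_inj _ _ q).
by rewrite !par_frameE mul0mx -row_mul mulmx_ker row0.
Qed.

Lemma nablaF_linear k (F : M -> 'M[R]_(k, m)) p N (a : 'I_N -> R) (u : 'I_N -> vec) :
  smoothT_on setT F ->
  nablaF nabla F p (\sum_i a i *: u i) = \sum_i a i *: nablaF nabla F p (u i).
Proof.
move=> sF; apply/row_matrixP => j; rewrite rowK nabla_sumv //; last first.
  by apply/smooth_fieldP; exact: (smoothT_rowP F openT).1 sF j.
rewrite linear_sum; apply: eq_bigr => i _.
by rewrite linearZ /= rowK.
Qed.

(** In a local frame [F], the components [par_frame * F^-1] solve a linear total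
   differential equation, whose coefficients are smooth because the values of
   the connection on the fields of [F] are. *)
Lemma par_frame_smooth : smoothT_on setT par_frame.
Proof.
apply: smoothT_on_near => p _.
set c := chart_at p; have cp : dom c p := chart_atP p.
pose X (i : 'I_m) := sval (cid2 (field_through hol p (delta_mx 0 i))).
have sX i : smooth_field (X i) by rewrite /X; case: cid2.
have Xp i : X i p = delta_mx 0 i by rewrite /X; case: cid2.
pose F q : 'M[R]_m := \matrix_i X i q.
have sF : smoothT_on setT F.
  apply/(smoothT_rowP F openT) => i; apply/smooth_fieldP.
  by apply: smooth_field_eq (sX i) => q; rewrite rowK.
have sFi i : smooth_field (fun q => row i (F q)).
  by apply/smooth_fieldP; exact: (smoothT_rowP F openT).1 sF i.
pose O := dom c `&` [set q | F q \in unitmx].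
have oO : open O by apply: openI; [exact: dom_open|exact: open_frame].
have Op : O p.
  split=> //=; rewrite (_ : F p = 1%:M) ?unitmx1 //.
  by apply/row_matrixP => i; rewrite rowK Xp row1.
have uF q : O q -> F q \in unitmx by case.
have sFO : smoothT_on O F by exact: smoothT_onS sF.
have sFV : smoothC_on O (fun q => invmx (F q)) by exact: smoothC_inv.
pose W (l : 'I_m) q := nablaF nabla F q (row l (F q)) *m invmx (F q).
have sW l : smoothM_on O (W l).
  apply: smooth_pairing => //; apply: (smoothT_onS (O := setT)) => //.
  apply/(smoothT_rowP _ openT) => j; apply/smooth_fieldP.
  have := nabla_smooth nablaP (sFi l) (sFi j).
  by apply: smooth_field_eq => q; rewrite [RHS]rowK.
pose A q := par_frame q *m invmx (F q).
have sA : smoothM_on O A; last first.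
  exists O, (fun q => A q *m F q); split=> //; first exact: smoothT_mul.
  by move=> q Oq; rewrite /A mulmxKV // uF.
apply: (smoothM_on_chart (c := c)) => //; first by move=> q' [].
have oD : open (dom_image c O) by exact: open_dom_image.
pose G x := coframe_rep c (fun q => invmx (F q)) x.
pose Om (i : 'I_m) x := - \sum_l G x i l *: W l (param c x).
apply: (@smooth_on_along _ _ _ _ _ _ Om) => //.
  move=> i; apply/smooth_on_mxP => // j k.
  apply: (@smooth_on_eq _ _ _ _ (fun x => - (\sum_l G x i l *: W l (param c x)) j k : R^o)) => //.
    by move=> x _; rewrite /Om !mxE.
  apply: smooth_onN => //.
  apply: (smooth_on_mxP _ oD).1 => //; apply: smooth_on_sum => // l _.
  apply: smooth_onZ => //; last exact: sW.
  exact: (smooth_on_mxP _ oD).1 (sFV c) i l.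
move=> x h Hx t; pose sigma := chart_curve c x h.
have ss : smooth_curve sigma.
  apply: chart_curve_smooth => s s1; rewrite -dom_imageT.
  by apply: dom_imageS (Hx s s1).
have Dt : dom_image c O (x + tau t *: h) by apply: Hx; exact: tau_le1.
have [ct Ot xt] := dom_imageP Dt.
set q := sigma t; rewrite -/(sigma t) in ct Ot; rewrite -/q in ct Ot.
set v := velocity sigma t.
set xt' := x + tau t *: h in Dt xt *.
have vh : v *m jac (chart_at q) c q = dtau t *: h.
  rewrite (velocity_chart ss ct) (_ : coord c \o sigma = fun s => x + tau s *: h); last first.
    apply/funext => s; have Ds : dom_image c O (x + tau s *: h) by apply: Hx; exact: tau_le1.
    by have [] := dom_imageP Ds.
  have d1 := is_derive_scalemx (is_derive_tau t) (is_derive_cst h (t : R^o) (1 : R^o)).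
  have [_ E] := is_deriveD (is_derive_cst x (t : R^o) (1 : R^o)) d1.
  by rewrite derive1E; apply: (etrans E); rewrite scaler0 addr0 add0r.
have vE : v = \sum_l (dtau t * \sum_i h 0 i * G xt' i l) *: row l (F q).
  have -> : v = (dtau t *: (h *m G xt')) *m F q.
    rewrite -scalemxAl -mulmxA /G /coframe_rep -/(sigma t) -/q mulmxKV ?uF //.
    by rewrite scalemxAl -vh chart_atK.
  rewrite mulmx_sum_row; apply: eq_bigr => l _.
  by rewrite mxE [X in _ * X]mxE.
have aE : nablaF nabla F q v *m invmx (F q) = - dtau t *: \sum_i h 0 i *: Om i xt'.
  rewrite vE nablaF_linear // mulmx_suml.
  rewrite scaleNr -scalerN -sumrN scaler_sumr.
  under [RHS]eq_bigr => i _.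
    rewrite -scalerN /Om opprK scaler_sumr scaler_sumr.
    under eq_bigr => l _ do rewrite !scalerA.
    over.
  rewrite exchange_big; apply: eq_bigr => l _ /=.
  rewrite -scalemxAl -/(W l q) mulr_sumr scaler_suml; apply: eq_bigr => i _.
  by rewrite mulrA.
have Aq : A q = (A \o param c) xt' by [].
have dE i : is_derive (t : R^o) (1 : R^o) (fun s => row i ((A \o param c) (x + tau s *: h)))
   (row i (dtau t *: \sum_j h 0 j *: ((A \o param c) xt' *m Om j xt'))).
  have := cov_der_frame nablaP oO Ot sF uF ss (par_cov_der (delta_mx 0 i) t ss).
  rewrite -/q -/v /= -{1}(rowK (fun i => par (delta_mx 0 i) q)) -/(par_frame q).
  rewrite -row_mul -/(A q) sub0r mulNmx -mulmxA aE.
  rewrite -row_mul -linearN /=.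
  have -> : - (A q *m (- dtau t *: \sum_j h 0 j *: Om j xt')) =
      dtau t *: \sum_j h 0 j *: ((A \o param c) xt' *m Om j xt').
    rewrite scaleNr mulmxN opprK -scalemxAr mulmx_sumr; congr (_ *: _).
    by apply: eq_bigr => j _; rewrite -scalemxAr.
  congr (is_derive _ _ _ _); apply/funext => s.
  by rewrite /= /A row_mul rowK.
exact: is_derive_rows dE.
Qed.

(** The components of [par_frame] in the frame [par_frame] itself are constant. *)
Lemma nablaF_par_curve sigma t : smooth_curve sigma ->
  nablaF nabla par_frame (sigma t) (velocity sigma t) = 0.
Proof.
move=> ss; set v := velocity sigma t; set q := sigma t.
apply/row_matrixP => i; rewrite row0.
have := cov_der_frame nablaP openT (I : setT (sigma t)) par_frame_smooth
   (fun q _ => par_frame_unit q) ss (par_cov_der (delta_mx 0 i) t ss).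
have -> : (fun s => (par (delta_mx 0 i) \o sigma) s *m invmx (par_frame (sigma s))) =
    (fun=> delta_mx 0 i).
  by apply/funext => s; rewrite /= par_frameE mulmxK // par_frame_unit.
move=> [_]; rewrite derive_cst /= par_frameE mulmxK ?par_frame_unit // sub0r -rowE -/q -/v.
move=> /esym /(congr1 (fun A => A *m par_frame q)).
by rewrite mulmxKV ?par_frame_unit // mul0mx => /eqP; rewrite oppr_eq0 => /eqP.
Qed.

(** The vector [v] is, up to a factor, the velocity of a curve that stays in a
   chart. *)
Lemma nablaF_par q v : nablaF nabla par_frame q v = 0.
Proof.
set c := chart_at q; have cq : dom c q := chart_atP q.
have [r r0 Hr] := ball_dom_image openT (I : setT q) cq.
(* Small enough for the curve to stay in the ball; [+ 1] covers [v = 0]. *)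
pose e := r / (`|v| + 1); have v1 : 0 < `|v| + 1 by rewrite ltr_wpDl.
have e0 : 0 < e by rewrite divr_gt0.
pose sigma := chart_curve c (coord c q) (e *: v).
have H (s : R) : `|s| <= 1 -> chart_image c (coord c q + s *: (e *: v)).
  move=> s1; rewrite -dom_imageT; apply: Hr.
  rewrite addrAC subrr add0r 2!normrZ (le_lt_trans (ler_wpM2r _ s1)) //.
  rewrite mul1r gtr0_norm // /e mulrAC ltr_pdivrMr // ltr_pM2l // ltrDl //.
have ss : smooth_curve sigma by exact: chart_curve_smooth.
have s0 : sigma 0 = q by rewrite /sigma chart_curve0 coordK.
have E : velocity sigma 0 = (2 * e) *: v.
  have ct : dom c (sigma 0) by rewrite s0.
  have := velocity_chart ss ct; rewrite s0 jac_id // mulmx1 => ->.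
  rewrite (_ : coord c \o sigma = fun s => coord c q + tau s *: (e *: v)); last first.
    by apply/funext => s; have [] := chart_imageP (H _ (tau_le1 s)).
  have d1 := is_derive_scalemx (is_derive_tau (0 : R)) (is_derive_cst (e *: v) (0 : R^o) (1 : R^o)).
  have [_ E] := is_deriveD (is_derive_cst (coord c q) (0 : R^o) (1 : R^o)) d1.
  by rewrite derive1E; apply: (etrans E); rewrite scaler0 addr0 add0r dtau0 scalerA.
have := nablaF_par_curve 0 ss; rewrite s0 E => H0.
have e20 : 2 * e != 0 by rewrite mulf_neq0 // ?gt_eqF.
have := nablaF_linear q (fun _ : 'I_1 => 2 * e) (fun _ => v) par_frame_smooth.
by rewrite !big_ord1 H0 => /esym /eqP; rewrite scaler_eq0 (negbTE e20) => /eqP.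
Qed.

Definition par_field u q : vec := u *m par_frame q.

Lemma par_field_smooth u : smooth_field (par_field u).
Proof.
apply/smooth_fieldP; apply: smoothT_mul par_frame_smooth; first exact: openT.
exact: smoothM_cst.
Qed.

Lemma nabla_par_field q v u : nabla q v (par_field u) = 0.
Proof.
have sc : smoothM_on setT (fun _ : M => u) by exact: smoothM_cst.
have := nabla_frame nablaP v openT (I : setT q) par_frame_smooth (par_field_smooth u) sc (fun _ _ => erefl).
by rewrite dmat_cst mul0mx add0r nablaF_par mulmx0.
Qed.

Lemma bracket_par_field u v q :
  bracket (par_field u) (par_field v) q = - torsion nabla (par_field u) (par_field v) q.
Proof. by rewrite /torsion !nabla_par_field subrr sub0r opprK. Qed.

Context (J : M -> 'M[R]_m) (nablaJ : forall p v X, smooth_field X ->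
    nabla p v (endo_app J X) - nabla p v X *m J p = 0) (sJ : smooth_endo J).

Lemma cov_der_endo sigma V t w : cov_der nabla sigma V t w ->
  cov_der nabla sigma (fun s => V s *m J (sigma s)) t (w *m J (sigma t)).
Proof.
move=> [N [g [X [sg sX EV ->]]]]; exists N, g, (fun k => endo_app J (X k)); split=> //.
- move=> k; apply/smooth_fieldP; apply: smoothT_endo => //; first exact: openT.
  exact/smooth_fieldP.
- apply: filterS EV => s ->; rewrite mulmx_suml; apply: eq_bigr => k _.
  by rewrite -scalemxAl.
- rewrite mulmx_suml; apply: eq_bigr => k _; rewrite mulmxDl -!scalemxAl.
  by congr (_ + _ *: _); apply/esym/eqP; rewrite -subr_eq0 nablaJ.
Qed.

Lemma transport_endo s p q u w : piecewise_path p s q -> transport nabla s u w ->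
  transport nabla s (u *m J p) (w *m J q).
Proof.
elim: s p u => [|sigma s IH] p u /=; first by move=> -> ->.
move=> [ss <- ps] [x [V [HV <- <-]] h].
exists (V 1 *m J (sigma 1)); last exact: IH.
exists (fun s => V s *m J (sigma s)); split=> // t.
by have := cov_der_endo (HV t); rewrite mul0mx.
Qed.

(** As [J] is parallel, it commutes with transport. *)
Lemma par_field_endo u : endo_app J (par_field u) = par_field (u *m J p0).
Proof.
apply/funext => q; rewrite /endo_app /par_field -!par_frameE.
have [s ps] := path_exists p0 q cM.
apply/esym; apply: (par_eq ps); exact: (transport_endo ps (parP u ps)).
Qed.

End ParallelFrame.

(** * Exterior derivatives of real one-forms *)

Section ExteriorDerivative.
Context {R : realType} {m : nat} {M : manifold R m}.
Local Notation vec := 'rV[R]_m.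
Implicit Types (p q : M) (u v w : vec) (X Y : M -> vec).

Definition rext (a : M -> 'cV[R]_m) p : 'M[R]_m :=
  \matrix_(i, j) (cder a p (delta_mx 0 i) j 0 - cder a p (delta_mx 0 j) i 0).

Lemma rext_tr (a : M -> 'cV[R]_m) p : (rext a p)^T = - rext a p.
Proof. by apply/matrixP => i j; rewrite !mxE opprB. Qed.

Lemma cder_sum k (W : M -> 'M[R]_(m, k)) p u : smoothC_on setT W ->
  cder W p u = \sum_i u 0 i *: cder W p (delta_mx 0 i).
Proof.
move=> sW; have dW := smoothC_diff sW (I : setT p).
by rewrite /cder {1}(row_sum_delta u) derive_span.
Qed.

Lemma rextE (a : M -> 'cV[R]_m) p u v : smoothC_on setT a ->
  u *m rext a p *m v^T = v *m cder a p u - u *m cder a p v.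
Proof.
move=> sa; apply/matrixP => i j; rewrite !ord1 {i j}.
rewrite (cder_sum p u sa) (cder_sum p v sa) !mulmx_sumr.
rewrite !mxE !summxE.
under eq_bigr => i _ do rewrite !mxE mulr_suml.
under eq_bigr => i _ do under eq_bigr => j _ do rewrite !mxE mulrBr mulrBl.
under eq_bigr => i _ do rewrite sumrB.
rewrite sumrB; congr (_ - _).
  rewrite exchange_big; apply: eq_bigr => i _ /=.
  rewrite -scalemxAr !mxE mulr_sumr; apply: eq_bigr => j _.
  by ring.
apply: eq_bigr => i _.
by rewrite -scalemxAr !mxE mulr_sumr; apply: eq_bigr => j _; ring.
Qed.

(** The formula for the exterior derivative of one-forms: the derivatives of the
   components of the fields cancel against those in the bracket. *)
Lemma dmat_pairing_bracket k (W : M -> 'M[R]_(m, k)) X Y p :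
  smoothC_on setT W -> smooth_field X -> smooth_field Y ->
  Y p *m cder W p (X p) - X p *m cder W p (Y p) =
  dmat (fun q => Y q *m W q) p (X p) - dmat (fun q => X q *m W q) p (Y p)
  - bracket X Y p *m W p.
Proof.
move=> sW /smooth_fieldP sX /smooth_fieldP sY.
rewrite (dmat_pairing (X p) openT sY sW) // (dmat_pairing (Y p) openT sX sW) //.
rewrite bracketE mulmxBl.
apply/eqP; rewrite eq_sym subr_eq opprD addrACA.
by rewrite [X in _ == X]addrC.
Qed.

End ExteriorDerivative.

(** * The flat connection defined by a coframe *)

Section FlatConnection.
Context {R : realType} {m : nat} {M : manifold R m}.
Local Notation vec := 'rV[R]_m.
Implicit Types (p q : M) (u v w : vec) (X Y : M -> vec) (sigma : R -> M).
Context (P : M -> 'M[R]_m) (sP : smoothC_on setT P) (uP : forall p, P p \in unitmx).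

Definition flat_nabla p v X : vec :=
  dmat (fun q => X q *m P q) p v *m invmx (P p).

Lemma smooth_components X : smooth_field X -> smoothM_on setT (fun q => X q *m P q).
Proof. by move=> /smooth_fieldP sX; apply: smooth_pairing => //; exact: openT. Qed.

Lemma flat_nablaE p v X : flat_nabla p v X *m P p = dmat (fun q => X q *m P q) p v.
Proof. by rewrite /flat_nabla mulmxKV. Qed.

Lemma dmat_is_derive (W : normedModType R) (A : M -> W) p v : smoothM_on setT A ->
  is_derive (coord (chart_at p) p) v (A \o param (chart_at p)) (dmat A p v).
Proof.
move=> sA; apply: derivableP; apply: diff_derivable.
exact: smoothM_diff sA _ (chart_atP p).
Qed.

Lemma flat_connection : connection flat_nabla.
Proof.
split.
- move=> p X sX k u v.
  by rewrite /flat_nabla (dmat_linear _ _ _ (smooth_components sX)) // mulmxDl scalemxAl.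
- move=> p v X Y sX sY; rewrite /flat_nabla -mulmxDl; congr (_ *m _).
  have [_ E] := is_deriveD (dmat_is_derive p v (smooth_components sX))
             (dmat_is_derive p v (smooth_components sY)).
  apply: etrans E; rewrite /dmat; set A := (X in 'D_v X _); set B := (X in _ = 'D_v X _).
  suff -> : A = B by [].
  by apply/funext => x; rewrite /A /B /= mulmxDl.
- move=> p v f X /smooth_funP sf sX.
  have [_ E] := is_derive_scalemx (dmat_is_derive p v sf) (dmat_is_derive p v (smooth_components sX)).
  rewrite /flat_nabla.
  have -> : dmat (fun q => f q *: X q *m P q) p v =
     dmat (f : M -> R^o) p v *: (X p *m P p) + f p *: dmat (fun q => X q *m P q) p v.
    have cp := chart_atP p.
    have -> : X p *m P p = ((fun q => X q *m P q) \o param (chart_at p)) (coord (chart_at p) p).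
      by rewrite /= coordK.
    have -> : f p = ((f : M -> R^o) \o param (chart_at p)) (coord (chart_at p) p).
      by rewrite /= coordK.
    apply: etrans E; rewrite /dmat; set A := (X in 'D_v X _); set B := (X in _ = 'D_v X _).
    suff -> : A = B by [].
    by apply/funext => x; rewrite /A /B /= scalemxAl.
  by rewrite mulmxDl -!scalemxAl mulmxK // dmat_dirder.
- move=> X Y sX sY; apply/smooth_fieldP.
  apply: smoothT_mul; [exact: openT| |].
    apply: smoothM_dmat; [exact: openT|exact: smooth_components|exact/smooth_fieldP].
  by apply: smoothT_inv => //; exact: openT.
Qed.

(** Multiplied by the coframe, the equation of parallel transport says that the
   components of the transported vector have derivative 0. *)
Lemma flat_transport sigma u v : smooth_curve sigma ->
  curve_transport flat_nabla sigma u v <->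
  u *m P (sigma 0) = v *m P (sigma 1).
Proof.
move=> ss; split.
  move=> [V [HV <- <-]].
  have key (t : R) : is_derive (t : R^o) (1 : R^o) (fun s => V s *m P (sigma s)) 0.
    have [N [g [X [sg sX EV H0]]]] := HV t.
    have dX k := is_derive_curve openT ss (smooth_components (sX k)) (I : setT (sigma t)).
    have dg k : is_derive (t : R^o) (1 : R^o) (g k : R^o -> R^o) (derive1 (g k) t).
      rewrite derive1E; apply: derivableP; apply: diff_derivable.
      exact: smooth_on_diff (sg k) _.
    have dS := is_derive_sum (fun k => is_derive_scalemx (dg k) (dX k)).
    apply: (near_eq_is_derive _ (is_derive_eq dS _)).
      apply: filterS EV => s ->; rewrite fct_sumE mulmx_suml.
      by apply: eq_bigr => k _; rewrite /= scalemxAl.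
    have := congr1 (fun A => A *m P (sigma t)) H0; rewrite mul0mx => H1.
    apply: etrans (esym H1); rewrite mulmx_suml; apply: eq_bigr => k _.
    by rewrite mulmxDl -!scalemxAl flat_nablaE.
  have h := @mean_value_le R 1 m (fun s => V s *m P (sigma s)) (fun=> 0) 0 (lexx 0)
     (fun t _ => key t) (fun t _ => _) 1.
  apply/esym/eqP; rewrite -subr_eq0 -normr_le0; apply: h; first by rewrite normr0.
  by rewrite ler01 lexx.
move=> E; pose b := u *m P (sigma 0).
exists (fun t => b *m invmx (P (sigma t))); split.
- move=> t; exists 1%N, (fun _ _ => 1), (fun _ q => b *m invmx (P q)).
  have sE : smooth_field (fun q => b *m invmx (P q)).
    apply/smooth_fieldP; apply: smoothT_mul; [exact: openT|exact: smoothM_cst|].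
    by apply: smoothT_inv => //; exact: openT.
  split=> //.
  + by move=> _; exact: smooth_on_cst.
  + by near=> s; rewrite big_ord1 scale1r.
  + rewrite big_ord1 derive1_cst scale0r add0r scale1r /flat_nabla.
    have -> : (fun q => b *m invmx (P q) *m P q) = fun=> b.
      by apply/funext => q; rewrite mulmxKV.
    by rewrite dmat_cst mul0mx.
- by rewrite /b mulmxK.
- by rewrite /b E mulmxK.
Unshelve. all: by end_near. Qed.

Lemma flat_holonomy : trivial_holonomy flat_nabla.
Proof.
have key s p q u v : piecewise_path p s q ->
    (transport flat_nabla s u v <-> u *m P p = v *m P q).
  elim: s p u => [|sigma s IH] p u /=.
    move=> ->; split=> [-> //|E].
    exact: (can_inj (mulmxK (uP q))).
  move=> [ss <- ps]; split.
    by move=> [w /(flat_transport _ _ ss) -> /(IH _ _ ps)].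
  move=> E; exists (u *m P (sigma 0) *m invmx (P (sigma 1))).
    by apply/(flat_transport _ _ ss); rewrite mulmxKV.
  by apply/(IH _ _ ps); rewrite mulmxKV.
move=> p s ps u v; rewrite (key _ _ _ _ _ ps); split=> [|-> //].
exact: (can_inj (mulmxK (uP p))).
Qed.

Context (J : M -> 'M[R]_m) (sJ : smooth_endo J) (J0 : 'M[R]_m)
  (JP : forall p, J p *m P p = P p *m J0).

Lemma flat_complex : complex_connection J flat_nabla.
Proof.
split; first exact: flat_connection.
move=> p v X sX; apply/eqP; rewrite subr_eq0; apply/eqP.
have E : (fun q => endo_app J X q *m P q) = fun q => (X q *m P q) *m J0.
  by apply/funext => q; rewrite /endo_app -mulmxA JP mulmxA.
rewrite /flat_nabla E (dmat_mul (O := setT)) //; last first.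
- exact: smoothM_cst.
- exact: smooth_components.
rewrite dmat_cst mulmx0 addr0 -!mulmxA; congr (_ *m _).
apply: (canLR (mulmxK (uP p))); rewrite -mulmxA JP mulmxA mulVmx // mul1mx //.
Qed.

Lemma flat_torsion X Y p : smooth_field X -> smooth_field Y ->
  torsion flat_nabla X Y p *m P p = Y p *m cder P p (X p) - X p *m cder P p (Y p).
Proof.
move=> sX sY; rewrite dmat_pairing_bracket // /torsion !mulmxBl.
by rewrite (flat_nablaE p (X p) Y) (flat_nablaE p (Y p) X).
Qed.

(** The components of the torsion in the coframe are the exterior derivatives of
   the coframe, by the formula for the exterior derivative. *)
Lemma flat_torsion11 :
  (forall k p, J p *m rext (fun q => col k (P q)) p *m (J p)^T =
     rext (fun q => col k (P q)) p) ->
  torsion11 J flat_nabla.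
Proof.
move=> H X Y sX sY p.
have sE Z : smooth_field Z -> smooth_field (endo_app J Z).
  move=> /smooth_fieldP sZ; apply/smooth_fieldP.
  by apply: smoothT_endo => //; exact: openT.
apply: (can_inj (mulmxK (uP p))).
apply: (etrans (flat_torsion p (sE _ sX) (sE _ sY))).
apply: (etrans _ (esym (flat_torsion p sX sY))).
have sPk k : smoothC_on setT (fun q => col k (P q)).
  exact: (smoothC_colP P openT).1 sP k.
have colE' k (v : vec) : col k (cder P p v) = cder (fun q => col k (P q)) p v.
  apply/matrixP => i j; rewrite mxE /cder.
  have dP := diff_derivable (v := v) (smoothC_diff sP (I : setT p)).
  have dPk := diff_derivable (v := v) (smoothC_diff (sPk k) (I : setT p)).
  rewrite (derive_mx dP) (derive_mx dPk) 2!mxE.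
  set A := (X in 'D_v X _); set B := (X in _ = 'D_v X _).
  suff -> : A = B by [].
  apply/funext => x; rewrite /A /B /coframe_rep colE mulmxA -colE.
  by rewrite [RHS]mxE.
apply/matrixP => i k; rewrite {i}ord1.
have mc (v : vec) (B : 'M[R]_m) : (v *m B) 0 k = (v *m col k B) 0 0.
  by rewrite colE mulmxA -colE [RHS]mxE.
have E (u v : vec) : (v *m cder P p u - u *m cder P p v) 0 k =
    (u *m rext (fun q => col k (P q)) p *m v^T) 0 0.
  rewrite (rextE p u v (sPk k)) -(colE' k u) -(colE' k v) [LHS]mxE [RHS]mxE.
  congr (_ + _); first exact: mc.
  by rewrite [LHS]mxE [RHS]mxE; congr (- _); exact: mc.
apply: (etrans (E _ _)); apply: (etrans _ (esym (E _ _))).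
rewrite -[in RHS](H k p) /endo_app trmx_mul.
by rewrite !mulmxA.
Qed.

End FlatConnection.

(** * Integrability *)

Section Integrability.
Context {R : realType} {m : nat} {M : manifold R m}.
Local Notation vec := 'rV[R]_m.
Context (J : M -> 'M[R]_m) (J_acs : almost_complex J).
Context (nabla : M -> vec -> (M -> vec) -> vec).
Implicit Types (p q : M) (X Y : M -> vec).

Lemma smooth_endo_app X : smooth_field X -> smooth_field (endo_app J X).
Proof.
move=> /smooth_fieldP sX; apply/smooth_fieldP.
by apply: smoothT_endo => //; [exact: openT|exact: J_acs.1].
Qed.

Lemma endo_appK X : endo_app J (endo_app J X) = fun q => - X q.
Proof.
by apply/funext => q; rewrite /endo_app -mulmxA J_acs.2 mulmxN mulmx1.
Qed.

Lemma torsion_endoN X Y p : connection nabla -> smooth_field X -> smooth_field Y ->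
  torsion nabla (fun q => - X q) Y p = - torsion nabla X Y p.
Proof.
move=> nablaP sX sY; rewrite /torsion bracketNl //.
have E : nabla p (Y p) (fun q => - X q) = - nabla p (Y p) X.
  have s1 : smoothM_on setT (fun _ : M => -1 : R^o) by exact: smoothM_cst.
  have := nabla_leibniz nablaP p (Y p) s1 sX.
  rewrite dmat_cst scale0r add0r scaleN1r => <-; congr (nabla p (Y p) _).
  by apply/funext => q; rewrite scaleN1r.
rewrite E nablaNv //.
by move: (nabla p (X p) Y) (nabla p (Y p) X) (bracket X Y p) => a b d; rewrite !opprD.
Qed.

(** For a complex connection, the Nijenhuis tensor is a combination of values
   of the torsion, in which the terms of a torsion of type (1,1) cancel. *)
Lemma torsion11_integrable :
  complex_connection J nabla -> torsion11 J nabla -> integrable_acs J.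
Proof.
move=> [nablaP nablaJ] T11 X Y sX sY p.
have sJX := smooth_endo_app sX; have sJY := smooth_endo_app sY.
have cJ v Z : smooth_field Z -> nabla p v (endo_app J Z) = nabla p v Z *m J p.
  by move=> sZ; apply/eqP; rewrite -subr_eq0 nablaJ.
have T1 := T11 _ _ sX sY p.
have T2 : torsion nabla (endo_app J X) Y p = - torsion nabla X (endo_app J Y) p.
  by have := T11 _ _ sJX sY p; rewrite endo_appK torsion_endoN //.
have B Z Z' : bracket Z Z' p = nabla p (Z p) Z' - nabla p (Z' p) Z - torsion nabla Z Z' p.
  by rewrite /torsion subKr.
have JJ (x : vec) : x *m J p *m J p = - x by rewrite -mulmxA J_acs.2 mulmxN mulmx1.
have e1 := B (endo_app J X) (endo_app J Y); rewrite T1 (cJ _ _ sY) (cJ _ _ sX) in e1.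
have e2 := B X (endo_app J Y); rewrite (cJ _ _ sY) in e2.
have e3 := B (endo_app J X) Y; rewrite T2 (cJ _ _ sX) in e3.
have e4 := B X Y.
have -> : nijenhuis J X Y p = bracket (endo_app J X) (endo_app J Y) p
  - bracket X (endo_app J Y) p *m J p - bracket (endo_app J X) Y p *m J p
  - bracket X Y p by [].
rewrite e1 e2 e3 e4.
move: (torsion nabla X Y p) (torsion nabla X (endo_app J Y) p) => t t'.
move: (nabla p (endo_app J X p) Y) (nabla p (endo_app J Y p) X)
  (nabla p (X p) Y) (nabla p (Y p) X) => a1 a2 a3 a4.
rewrite !mulmxBl !JJ !mulNmx.
move: (a1 *m J p) (a2 *m J p) (t' *m J p) => b1 b2 b3.
by apply/rowP => j; rewrite !mxE; ring.
Qed.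

End Integrability.

(** * Linear algebra of complex structures *)

Section LinearComplexStructure.
Context {R : realType}.

Lemma row_free_kerP (F : fieldType) a b (A : 'M[F]_(a, b)) :
  row_free A <-> forall z : 'rV_a, z *m A = 0 -> z = 0.
Proof.
split=> [fA z zA|h]; first by apply/eqP; rewrite -(mulmx_free_eq0 z fA) zA.
rewrite -kermx_eq0; apply/eqP/row_matrixP => i; rewrite row0; apply: h.
by rewrite -row_mul mulmx_ker row0.
Qed.

(** Induction on the number of vectors. Adding a vector [u] outside an invariant
   subspace [W] enlarges it by two dimensions: if [B *: u + B' *: (u *m J)] is in
   [W], so is its image under [J], hence [(B ^+ 2 + B' ^+ 2) *: u]. *)
Lemma adapted_basis n (J : 'M[R]_(n + n)) : J *m J = - 1%:M ->
  exists U : 'M[R]_(n, n + n), row_free (col_mx U (U *m J)).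
Proof.
move=> JJ.
suff H k : (k <= n)%N -> exists U : 'M[R]_(k, n + n), row_free (col_mx U (U *m J)).
  exact: H.
elim: k => [|k IH] kn.
  by exists 0; apply/row_free_kerP => z _; apply/rowP => -[].
have [U fU] := IH (ltnW kn); pose W := col_mx U (U *m J).
have WJ (z : 'rV[R]_(n + n)) : (z <= W)%MS -> (z *m J <= W)%MS.
  move=> zW; apply: (submx_trans (submxMr J zW)).
  rewrite /W mul_col_mx -mulmxA JJ mulmxN mulmx1 col_mx_sub.
  apply/andP; split.
    apply/submxP; exists (row_mx 0 1%:M).
    by rewrite mul_row_col mul0mx mul1mx add0r.
  apply/submxP; exists (row_mx (- 1%:M) 0).
  by rewrite mul_row_col mul0mx mulNmx mul1mx addr0.
have [i iW] : exists i, ~~ (row i (1%:M : 'M[R]_(n + n)) <= W)%MS.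
  apply/row_subPn; apply: contraL kn => /mxrankS; rewrite mxrank1 (eqP fU).
  by rewrite -leqNgt !addnn leq_double.
pose u := row i (1%:M : 'M[R]_(n + n)).
suff fr : row_free (col_mx (col_mx u U) (col_mx u U *m J)) by exists (col_mx u U).
apply/row_free_kerP => z.
pose z1 := lsubmx z; pose z2 := rsubmx z.
pose b := lsubmx z1; pose a := rsubmx z1; pose b' := lsubmx z2; pose a' := rsubmx z2.
have zE : z = row_mx (row_mx b a) (row_mx b' a') by rewrite !hsubmxK.
rewrite zE mul_row_col mul_col_mx !mul_row_col => E.
have bE (c : 'M[R]_1) (v : 'rV[R]_(n + n)) : c *m v = c 0 0 *: v.
  by rewrite {1}[c]mx11_scalar mul_scalar_mx.
rewrite !bE in E; set B := b 0 0 in E; set B' := b' 0 0 in E.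
have aW : ((a *m U + a' *m (U *m J))%R <= W)%MS.
  by apply/submxP; exists (row_mx a a'); rewrite mul_row_col.
have uW : ((B *: u + B' *: (u *m J))%R <= W)%MS.
  rewrite (_ : _ + _ = - (a *m U + a' *m (U *m J))) ?eqmx_opp //.
  by apply/eqP; rewrite -addr_eq0 addrACA E.
have uJW : ((B *: (u *m J) - B' *: u)%R <= W)%MS.
  have := WJ _ uW; rewrite mulmxDl -!scalemxAl -mulmxA JJ mulmxN mulmx1.
  by rewrite scalerN.
have : (((B ^+ 2 + B' ^+ 2) *: u)%R <= W)%MS.
  rewrite (_ : _ *: u = B *: (B *: u + B' *: (u *m J)) - B' *: (B *: (u *m J) - B' *: u)).
    by rewrite addmx_sub ?eqmx_opp ?scalemx_sub.
  move: (u *m J) => u'; move: u {bE aW uW uJW E iW} => u.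
  by apply/rowP => j; rewrite !mxE; ring.
have [B0|Bn0] := eqVneq (B ^+ 2 + B' ^+ 2) 0; last first.
  by rewrite (eqmx_scale _ Bn0) (negbTE iW).
have /andP[/eqP B1 /eqP B1'] : (B == 0) && (B' == 0).
  by move/eqP: B0; rewrite paddr_eq0 ?sqr_ge0 // !sqrf_eq0.
move: E; rewrite B1 B1' !scale0r !add0r => E _.
have : row_mx a a' = 0 by apply: (row_free_kerP _).1 fU _ _; rewrite mul_row_col.
rewrite -[0]row_mx0 => /eq_row_mx [-> ->].
have -> : b = 0 by apply/matrixP => x y; rewrite !ord1 [RHS]mxE; exact: B1.
have -> : b' = 0 by apply/matrixP => x y; rewrite !ord1 [RHS]mxE; exact: B1'.
by rewrite !row_mx0.
Qed.

Local Notation C := (complex R).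

(** Complex matrices are handled through their real and imaginary parts, as all
   derivatives are taken of real functions. *)
Definition mkC a b (A B : 'M[R]_(a, b)) : 'M[C]_(a, b) := map2_mx (@Complex R) A B.
Definition reM a b (Z : 'M[C]_(a, b)) : 'M[R]_(a, b) := map_mx (@complex.Re R) Z.
Definition imM a b (Z : 'M[C]_(a, b)) : 'M[R]_(a, b) := map_mx (@complex.Im R) Z.

Lemma reM_mkC a b (A B : 'M[R]_(a, b)) : reM (mkC A B) = A.
Proof. by apply/matrixP => i j; rewrite !mxE. Qed.

Lemma imM_mkC a b (A B : 'M[R]_(a, b)) : imM (mkC A B) = B.
Proof. by apply/matrixP => i j; rewrite !mxE. Qed.

Lemma mkC_reim a b (Z : 'M[C]_(a, b)) : mkC (reM Z) (imM Z) = Z.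
Proof. by apply/matrixP => i j; rewrite !mxE; case: (Z i j). Qed.

Lemma mkC_inj a b (A B A' B' : 'M[R]_(a, b)) : mkC A B = mkC A' B' -> A = A' /\ B = B'.
Proof.
move=> E; split; first by rewrite -(reM_mkC A B) E reM_mkC.
by rewrite -(imM_mkC A B) E imM_mkC.
Qed.

Lemma mkC00 a b : mkC 0 0 = 0 :> 'M[C]_(a, b).
Proof. by apply/matrixP => i j; rewrite !mxE. Qed.

Lemma mkCD a b (A B A' B' : 'M[R]_(a, b)) : mkC A B + mkC A' B' = mkC (A + A') (B + B').
Proof. by apply/matrixP => i j; rewrite !mxE. Qed.

Lemma mkCN a b (A B : 'M[R]_(a, b)) : - mkC A B = mkC (- A) (- B).
Proof. by apply/matrixP => i j; rewrite !mxE. Qed.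

Lemma mkC_tr a b (A B : 'M[R]_(a, b)) : (mkC A B)^T = mkC A^T B^T.
Proof. by apply/matrixP => i j; rewrite !mxE. Qed.

Lemma mkC_i a b (A B : 'M[R]_(a, b)) : ('i)%C *: mkC A B = mkC (- B) A.
Proof.
apply/matrixP => i j; rewrite !mxE; apply/eqP; rewrite eq_complex /=.
by rewrite !mul0r !mul1r sub0r add0r !eqxx.
Qed.

Lemma mkC_real a b (A : 'M[R]_(a, b)) : map_mx (real_complex R) A = mkC A 0.
Proof. by apply/matrixP => i j; rewrite !mxE. Qed.

Lemma sum_Complex I (s : seq I) (f g : I -> R) :
  \sum_(i <- s) Complex (f i) (g i) = Complex (\sum_(i <- s) f i) (\sum_(i <- s) g i) :> C.
Proof.
elim: s => [|i s IH]; first by rewrite !big_nil.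
by rewrite !big_cons IH.
Qed.

Lemma mkC_mul a b c (A B : 'M[R]_(a, b)) (A' B' : 'M[R]_(b, c)) :
  mkC A B *m mkC A' B' = mkC (A *m A' - B *m B') (A *m B' + B *m A').
Proof.
apply/matrixP => i j; rewrite !mxE -sumrB -big_split -sum_Complex.
by apply: eq_bigr => k _; rewrite !mxE.
Qed.

Lemma mkC_conj a (K A B : 'M[R]_a) :
  mkC K 0 *m mkC A B *m mkC K^T 0 = mkC (K *m A *m K^T) (K *m B *m K^T).
Proof. by rewrite !mkC_mul !mul0mx !mulmx0 !subr0 !addr0 add0r. Qed.

Lemma eq_cols a b (A B : 'M[R]_(a, b)) : (forall k, col k A = col k B) -> A = B.
Proof. by move=> h; apply/matrixP => i k; have /colP/(_ i) := h k; rewrite !mxE. Qed.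

(** A complex combination of the rows of [A - i A K] vanishes when its real part
   does, because the imaginary part is the image of the real part under [- K]. *)
Lemma mkC_free a b (A : 'M[R]_(a, b)) (K : 'M[R]_b) : K *m K = - 1%:M ->
  row_free (mkC A (- (A *m K))) = row_free (col_mx A (A *m K)).
Proof.
move=> KK.
have KA (x : 'rV[R]_a) : x *m (A *m K) *m K = - (x *m A).
  by rewrite -!mulmxA KK mulmxN mulmx1 mulmxN.
apply/idP/idP => /row_free_kerP h; apply/row_free_kerP => z.
  rewrite -[z]hsubmxK mul_row_col; set x := lsubmx z; set y := rsubmx z => E.
  have E' : x *m (A *m K) - y *m A = 0.
    have := congr1 (fun v => v *m K) E; rewrite mulmxDl mul0mx KA.
    by rewrite mulmxA.
  have := h (mkC x y); rewrite mkC_mul.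
  have -> : x *m A - y *m - (A *m K) = 0 by rewrite mulmxN opprK.
  have -> : x *m - (A *m K) + y *m A = 0.
    by apply/eqP; rewrite mulmxN -oppr_eq0 opprD opprK E'.
  rewrite mkC00 => /(_ erefl); rewrite -mkC00 => /mkC_inj [-> ->].
  by rewrite row_mx0.
rewrite -[z]mkC_reim mkC_mul -mkC00 => /mkC_inj [E _].
have := h (row_mx (reM z) (imM z)); rewrite mul_row_col.
rewrite mulmxN opprK in E; rewrite E -row_mx0 => /(_ erefl) /eq_row_mx [-> ->].
exact: mkC00.
Qed.

End LinearComplexStructure.

(** * Types of complex forms *)

Section FormTypes.
Context {R : realType} {m : nat} {M : manifold R m}.
Local Notation C := (complex R).
Local Notation vec := 'rV[R]_m.
Context (J : M -> 'M[R]_m) (JJ : forall p, J p *m J p = - 1%:M).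
Implicit Types (p q : M).

Lemma scale_iN_eq0 a b (Z : 'M[C]_(a, b)) : ('i)%C *: Z = - ('i)%C *: Z -> Z = 0.
Proof.
rewrite -[Z]mkC_reim scaleNr mkC_i mkCN => /mkC_inj [E1 E2].
have z (x : 'M[R]_(a, b)) : x = - x -> x = 0.
  move=> /matrixP E; apply/matrixP => i j; have := E i j; rewrite !mxE => h; lra.
have E1' : imM Z = - imM Z by rewrite -[LHS]opprK -E1.
by rewrite -mkC00 (z _ E2) (z _ E1').
Qed.

(** The vectors of type (0,1) are the [v + i J v] with [v] real. *)
Lemma Lambda10P p (a : 'cV[C]_m) :
  Lambda10 J p a <-> mkC (J p) 0 *m a = ('i)%C *: a.
Proof.
split=> [h|E z]; last first.
  rewrite /T01 mkC_real => hz; apply: scale_iN_eq0.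
  by rewrite scalemxAr -E mulmxA hz -scalemxAl.
rewrite -[a]mkC_reim; set A := reM a; set B := imM a.
have key (v : vec) : v *m (A - J p *m B) = 0 /\ v *m (B + J p *m A) = 0.
  have : mkC v (v *m J p) *m a = 0.
    apply: h; rewrite /T01 mkC_real mkC_mul scaleNr mkC_i mkCN !mulmx0.
    by rewrite subr0 add0r -mulmxA JJ mulmxN mulmx1 opprK.
  rewrite -[a]mkC_reim mkC_mul -mkC00 => /mkC_inj [E1 E2].
  by rewrite mulmxBr mulmxDr !mulmxA.
have z (x : 'cV[R]_m) : (forall v : vec, v *m x = 0) -> x = 0.
  by move=> hx; apply/row_matrixP => i; rewrite rowE hx row0.
have /eqP := z _ (fun v => (key v).1); rewrite subr_eq0 => /eqP EA.
have /eqP := z _ (fun v => (key v).2); rewrite addr_eq0 => /eqP EB.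
by rewrite mkC_mul mkC_i !mul0mx subr0 addr0 -EA EB opprK.
Qed.

(** The vectors of type (1,0) are the [v - i J v] with [v] real. *)
Lemma Lambda01P p (a : 'cV[C]_m) :
  Lambda01 J p a <-> mkC (J p) 0 *m a = - ('i)%C *: a.
Proof.
split=> [h|E z]; last first.
  rewrite /T10 mkC_real => hz; apply: scale_iN_eq0.
  by rewrite [RHS]scalemxAr -E mulmxA hz -scalemxAl.
rewrite -[a]mkC_reim; set A := reM a; set B := imM a.
have key (v : vec) : v *m (A + J p *m B) = 0 /\ v *m (B - J p *m A) = 0.
  have : mkC v (- (v *m J p)) *m a = 0.
    apply: h; rewrite /T10 mkC_real mkC_mul mkC_i !mulmx0.
    by rewrite subr0 add0r mulNmx -mulmxA JJ mulmxN mulmx1 !opprK.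
  rewrite -[a]mkC_reim mkC_mul -mkC00 => /mkC_inj [E1 E2].
  split; first by apply: etrans _ E1; rewrite mulmxDr mulmxA mulNmx opprK.
  by apply: etrans _ E2; rewrite mulmxBr mulmxA mulNmx.
have z (x : 'cV[R]_m) : (forall v : vec, v *m x = 0) -> x = 0.
  by move=> hx; apply/row_matrixP => i; rewrite rowE hx row0.
have /eqP := z _ (fun v => (key v).1); rewrite addr_eq0 => /eqP EA.
have /eqP := z _ (fun v => (key v).2); rewrite subr_eq0 => /eqP EB.
by rewrite mkC_mul scaleNr mkC_i mkCN !mul0mx subr0 addr0 opprK -EB EA opprK.
Qed.

Lemma Lambda11_invariant p (w : 'M[C]_m) :
  Lambda11 J p w -> mkC (J p) 0 *m w *m mkC (J p)^T 0 = w.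
Proof.
move=> [N [a [b [ha hb ->]]]]; rewrite mulmx_sumr mulmx_suml.
apply: eq_bigr => k _.
have /Lambda10P Ea := ha k; have /Lambda01P Eb := hb k.
have T : mkC (J p)^T 0 = (mkC (J p) 0)^T by rewrite mkC_tr trmx0.
rewrite T /wedge mulmxBr mulmxBl !mulmxA Ea Eb -!mulmxA -!trmx_mul Ea Eb.
rewrite !linearZ /= -!scalemxAl scalerN !scalerA.
have -> : ('i)%C * - ('i)%C = 1 :> C.
  by apply/eqP; rewrite eq_complex /=; apply/andP; split; apply/eqP; ring.
have -> : - ('i)%C * ('i)%C = 1 :> C.
  by apply/eqP; rewrite eq_complex /=; apply/andP; split; apply/eqP; ring.
by rewrite !scale1r.
Qed.

Lemma mulmx_sum_col a b c (A : 'M[C]_(a, b)) (B : 'M[C]_(c, b)) :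
  A *m B^T = \sum_k col k A *m (col k B)^T.
Proof.
apply/matrixP => i j; rewrite mxE summxE; apply: eq_bigr => k _.
by rewrite [RHS]mxE big_ord1 !mxE.
Qed.

(** The projections of covectors to the types are [(1 - iJ)/2] and [(1 + iJ)/2].
   Invariance under [J] kills the parts of [w] of type (2,0) and (0,2), as [J]
   acts on them by [-1]. *)
Lemma invariant_Lambda11 p (w : 'M[C]_m) :
  w^T = - w -> mkC (J p) 0 *m w *m mkC (J p)^T 0 = w -> Lambda11 J p w.
Proof.
move=> wT wJ; pose h : R := 2^-1.
pose Q := mkC h%:M (- (h *: J p)) : 'M[C]_m.
pose Q' := mkC h%:M (h *: J p) : 'M[C]_m.
have QQ : Q + Q' = 1%:M.
  rewrite mkCD addNr -raddfD /= /h.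
  have -> : 2^-1 + 2^-1 = 1 :> R by field.
  by apply/matrixP => i j; rewrite !mxE; case: eqVneq.
have hJ : h%:M *m J p = h *: J p by rewrite mul_scalar_mx.
have Jh : J p *m h%:M = h *: J p by rewrite mul_mx_scalar.
have hJJ : J p *m (h *: J p) = - h%:M by rewrite -scalemxAr JJ scalerN scalemx1.
have hJJ' : (h *: J p) *m J p = - h%:M by rewrite -scalemxAl JJ scalerN scalemx1.
have JQ : mkC (J p) 0 *m Q = ('i)%C *: Q.
  by rewrite mkC_mul mkC_i !mul0mx subr0 addr0 mulmxN hJJ !opprK Jh.
have JQ' : mkC (J p) 0 *m Q' = - ('i)%C *: Q'.
  by rewrite mkC_mul scaleNr mkC_i mkCN !mul0mx subr0 addr0 hJJ opprK Jh.
have QJ : Q *m mkC (J p) 0 = ('i)%C *: Q.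
  by rewrite mkC_mul mkC_i !mulmx0 subr0 add0r mulNmx hJJ' !opprK hJ.
have QJ' : Q' *m mkC (J p) 0 = - ('i)%C *: Q'.
  by rewrite mkC_mul scaleNr mkC_i mkCN !mulmx0 subr0 add0r hJJ' opprK hJ.
have T : mkC (J p)^T 0 = (mkC (J p) 0)^T by rewrite mkC_tr trmx0.
have ii : ('i)%C * ('i)%C = -1 :> C.
  by apply/eqP; rewrite eq_complex /=; apply/andP; split; apply/eqP; ring.
have z (x : 'M[C]_m) : x = - x -> x = 0.
  move=> E; apply: scale_iN_eq0; by rewrite {1}E scalerN scaleNr.
have z1 : Q *m w *m Q^T = 0.
  apply: z; rewrite -{1}wJ T !mulmxA QJ -!mulmxA -trmx_mul QJ linearZ /=.
  by rewrite -!scalemxAr -!scalemxAl -?scalemxAr scalerA ii scaleN1r !mulmxA.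
have z2 : Q' *m w *m Q'^T = 0.
  apply: z; rewrite -{1}wJ T !mulmxA QJ' -!mulmxA -trmx_mul QJ' linearZ /=.
  by rewrite -!scalemxAr -!scalemxAl -?scalemxAr scalerA mulrNN ii scaleN1r !mulmxA.
exists m, (fun k => col k (Q *m w)), (fun k => col k Q'); split.
- by move=> k; apply/Lambda10P; rewrite colE !mulmxA JQ -!scalemxAl.
- by move=> k; apply/Lambda01P; rewrite colE !mulmxA JQ' -!scalemxAl.
have E : w = (Q + Q') *m w *m (Q + Q')^T by rewrite QQ mul1mx trmx1 mulmx1.
have H : w = Q *m w *m Q'^T + Q' *m w *m Q^T.
  by rewrite {1}E linearD /= mulmxDr !mulmxDl z1 z2 add0r addr0 addrC.
apply: (etrans H); rewrite /wedge sumrB -!mulmx_sum_col trmx_mul wT.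
by rewrite mulNmx mulmxN opprK mulmxA.
Qed.

Lemma mkC_antisymmetric (A B : 'M[R]_m) : A^T = - A -> B^T = - B -> (mkC A B)^T = - mkC A B.
Proof. by move=> EA EB; rewrite mkC_tr EA EB mkCN. Qed.

Lemma form_rep_mkC c (a b : M -> 'cV[R]_m) :
  form_rep c (fun p => mkC (a p) (b p)) =
  fun x => mkC (coframe_rep c a x) (coframe_rep c b x).
Proof.
apply/funext => x; rewrite /form_rep jacE mkC_real mkC_mul.
by rewrite !mul0mx subr0 addr0.
Qed.

Lemma smooth_formP (a b : M -> 'cV[R]_m) :
  smooth_form (fun p => mkC (a p) (b p)) <-> smoothC_on setT a /\ smoothC_on setT b.
Proof.
have Ea c : (fun x => map_mx (@complex.Re R) (form_rep c (fun p => mkC (a p) (b p)) x)) = coframe_rep c a.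
  by apply/funext => x; rewrite form_rep_mkC -/(reM _) reM_mkC.
have Eb c : (fun x => map_mx (@complex.Im R) (form_rep c (fun p => mkC (a p) (b p)) x)) = coframe_rep c b.
  by apply/funext => x; rewrite form_rep_mkC -/(imM _) imM_mkC.
split=> [h|[ha hb] c].
  by split=> c; have := h c; rewrite Ea Eb dom_imageT => -[].
by rewrite Ea Eb; split; rewrite -dom_imageT; [exact: ha|exact: hb].
Qed.

Lemma ext_derE (a b : M -> 'cV[R]_m) p : smoothC_on setT a -> smoothC_on setT b ->
  ext_der (fun p => mkC (a p) (b p)) p = mkC (rext a p) (rext b p).
Proof.
move=> sa sb.
have E (f : M -> 'cV[R]_m) i j : smoothC_on setT f ->
   'D_(delta_mx 0 i) (fun y => coframe_rep (chart_at p) f y j 0 : R^o) (coord (chart_at p) p)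
   = cder f p (delta_mx 0 i) j 0.
  move=> sf; have d := diff_derivable (v := delta_mx 0 i) (smoothC_diff sf (I : setT p)).
  by rewrite /cder (derive_mx d) mxE.
have cE i j : cpartial (fun y => form_rep (chart_at p) (fun p => mkC (a p) (b p)) y j 0) i (coord (chart_at p) p)
   = Complex (cder a p (delta_mx 0 i) j 0) (cder b p (delta_mx 0 i) j 0).
  rewrite /cpartial -(E a i j sa) -(E b i j sb).
  set A := (X in 'D__ X _); set B := (X in Complex _ ('D__ X _)).
  have -> : A = (fun y => coframe_rep (chart_at p) a y j 0 : R^o).
    by apply/funext => y; rewrite /A form_rep_mkC mxE.
  have -> : B = (fun y => coframe_rep (chart_at p) b y j 0 : R^o).
    by apply/funext => y; rewrite /B form_rep_mkC mxE.
  by [].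
apply/matrixP => i j; rewrite [LHS]mxE (cE i j) (cE j i) [RHS]mxE.
by rewrite [X in _ = Complex X _]mxE [X in _ = Complex _ X]mxE.
Qed.

End FormTypes.

(** * The four conditions *)

Section Conditions.
Context {R : realType} {n m : nat} {M : manifold R m} (J : M -> 'M[R]_m).
Local Notation C := (complex R).

(** The conditions are stated in dimension [m], so that [m] can be taken to be
   [n + n], over which matrices split into blocks. *)
Definition bracket_frame :=
  exists X : 'I_n -> M -> 'rV[R]_m,
    [/\ forall k, smooth_field (X k),
        forall p, row_free (col_mx (\matrix_k X k p)
                                   (\matrix_k endo_app J (X k) p))
      & forall (k l : 'I_n), (k < l)%N -> forall p,
          bracket (X k) (X l) p
            = bracket (endo_app J (X k)) (endo_app J (X l)) p /\
          bracket (endo_app J (X k)) (X l) p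
            = - bracket (X k) (endo_app J (X l)) p].

Definition commuting_frame :=
  exists Z : 'I_n -> M -> 'rV[C]_m,
    [/\ forall k, smooth_cfield (Z k),
        forall k p, T10 J p (Z k p),
        forall p, row_free (\matrix_k Z k p)
      & forall k l p, cbracket (Z k) (Z l) p = 0].

Definition coframe11 :=
  exists alpha : 'I_n -> M -> 'cV[C]_m,
    [/\ forall k, smooth_form (alpha k),
        forall k p, Lambda10 J p (alpha k p),
        forall p, row_free (\matrix_k (alpha k p)^T)
      & forall k p, Lambda11 J p (ext_der (alpha k) p)].

Definition flat_complex_connection :=
  exists nabla : M -> 'rV[R]_m -> (M -> 'rV[R]_m) -> 'rV[R]_m,
    [/\ complex_connection J nabla, trivial_holonomy nabla
      & torsion11 J nabla].

End Conditions.

(** * Commuting frames and dual coframes *)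

Section BracketToCommuting.
Context {R : realType} {n m : nat} {M : manifold R m}.
Context (J : M -> 'M[R]_m) (J_acs : almost_complex J).
Local Notation C := (complex R).

Lemma re_field_mkC (A B : M -> 'rV[R]_m) : re_field (fun p => mkC (A p) (B p)) = A.
Proof. by apply/funext => p; exact: reM_mkC. Qed.

Lemma im_field_mkC (A B : M -> 'rV[R]_m) : im_field (fun p => mkC (A p) (B p)) = B.
Proof. by apply/funext => p; exact: imM_mkC. Qed.

Lemma smooth_fieldN (X : M -> 'rV[R]_m) : smooth_field X -> smooth_field (fun p => - X p).
Proof.
move=> sX; have s1 : smoothM_on setT (fun _ : M => -1 : R^o) by exact: smoothM_cst.
by apply: smooth_field_eq (smooth_fieldZ s1 sX) => p; rewrite scaleN1r.
Qed.

Lemma cbracket_T10 (X Y : M -> 'rV[R]_m) p : smooth_field X -> smooth_field Y ->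
  cbracket (fun q => mkC (X q) (- endo_app J X q)) (fun q => mkC (Y q) (- endo_app J Y q)) p =
  mkC (bracket X Y p - bracket (endo_app J X) (endo_app J Y) p)
      (- (bracket X (endo_app J Y) p + bracket (endo_app J X) Y p)).
Proof.
move=> sX sY; have sJX := smooth_endo_app J_acs sX; have sJY := smooth_endo_app J_acs sY.
rewrite /cbracket !re_field_mkC !im_field_mkC.
rewrite (bracketNr _ sX sJY) (bracketNl _ sJX sY) (bracketNl _ sJX (smooth_fieldN sJY)).
by rewrite (bracketNr _ sJX sJY) opprK -opprD.
Qed.

Lemma matrix_endo_app (X : 'I_n -> M -> 'rV[R]_m) p :
  \matrix_k endo_app J (X k) p = (\matrix_k X k p) *m J p.
Proof. by apply/row_matrixP => k; rewrite rowK row_mul rowK. Qed.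

Lemma matrix_T10 (X : 'I_n -> M -> 'rV[R]_m) p :
  \matrix_k mkC (X k p) (- endo_app J (X k) p) =
  mkC (\matrix_k X k p) (- ((\matrix_k X k p) *m J p)).
Proof.
rewrite -matrix_endo_app; apply/row_matrixP => k; rewrite rowK.
by apply/rowP => j; rewrite !mxE.
Qed.

(** Antisymmetry reduces all pairs of indices to the pairs with [k < l]. In the
   application, [A], [B], [A'] and [B'] are the four brackets in the relations. *)
Lemma antisymmetric_relations (V : zmodType) (A B A' B' : 'I_n -> 'I_n -> V) :
  (forall k l, A k l = - A l k) -> (forall k l, B k l = - B l k) ->
  (forall k l, A' k l = - B' l k) -> (forall k, A k k = 0) -> (forall k, B k k = 0) ->
  (forall k l : 'I_n, (k < l)%N -> A k l = B k l /\ A' k l = - B' k l) ->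
  forall k l, A k l - B k l = 0 /\ - (B' k l + A' k l) = 0.
Proof.
move=> hA hB hA' A0 B0 H k l.
case: (ltngtP k l) => [kl|lk|/val_inj ->].
- by have [-> ->] := H _ _ kl; rewrite subrr addrN oppr0.
- have [h1 h2] := H _ _ lk; rewrite hA (hB k l) h1 subrr (hA' k l).
  by rewrite -[B' k l]opprK -(hA' l k) h2 -opprD addNr !oppr0.
- by rewrite A0 B0 subr0 hA' addrN oppr0.
Qed.

Lemma bracket_frame_commuting : bracket_frame (n := n) J -> commuting_frame (n := n) J.
Proof.
move=> [X [sX fX H]]; exists (fun k q => mkC (X k q) (- endo_app J (X k) q)); split.
- move=> k; rewrite /smooth_cfield re_field_mkC im_field_mkC; split=> //.
  by apply: smooth_fieldN; exact: smooth_endo_app.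
- move=> k p; rewrite /T10 mkC_real mkC_mul mkC_i !mulmx0 subr0 add0r opprK.
  by rewrite mulNmx /endo_app -mulmxA J_acs.2 mulmxN mulmx1 opprK.
- by move=> p; rewrite matrix_T10 (mkC_free _ (J_acs.2 p)) -matrix_endo_app; exact: fX.
- move=> k l p; rewrite cbracket_T10 // -mkC00.
  pose A k l := bracket (X k) (X l) p.
  pose B k l := bracket (endo_app J (X k)) (endo_app J (X l)) p.
  pose A' k l := bracket (endo_app J (X k)) (X l) p.
  pose B' k l := bracket (X k) (endo_app J (X l)) p.
  have [] := @antisymmetric_relations _ A B A' B' _ _ _ _ _ _ k l.
  + by move=> *; exact: bracketC.
  + by move=> *; exact: bracketC.
  + by move=> *; exact: bracketC.
  + by move=> *; exact: bracket_self.
  + by move=> *; exact: bracket_self.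
  + by move=> k' l' kl; exact: H.
  + by move=> E1 E2; exact: (f_equal2 (@mkC R 1 m) E1 E2).
Qed.

End BracketToCommuting.

Section CommutingToCoframe.
Context {R : realType} {n : nat} {M : manifold R (n + n)}.
Context (J : M -> 'M[R]_(n + n)) (J_acs : almost_complex J).
Local Notation C := (complex R).

(** The matrix of a complex structure in a basis [e_1, ..., e_n, J e_1, ..., J e_n]. *)
Definition std_complex : 'M[R]_(n + n) := block_mx 0 1%:M (- 1%:M) 0.

(** On pairs of vectors of the frame, which have constant components, the exterior
   derivative is minus the corresponding component of the bracket; the same
   holds for their images under [J]. *)
Lemma dual_coframe_invariant (F : M -> 'M[R]_(n + n)) (J0 : 'M[R]_(n + n)) c p :
  smoothT_on setT F -> (forall q, F q \in unitmx) ->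
  (forall q, F q *m J q = J0 *m F q) ->
  (forall i j, bracket (endo_app J (fun q => row i (F q))) (endo_app J (fun q => row j (F q))) p
     = bracket (fun q => row i (F q)) (fun q => row j (F q)) p) ->
  J p *m rext (fun q => col c (invmx (F q))) p *m (J p)^T = rext (fun q => col c (invmx (F q))) p.
Proof.
move=> sF uF FJ HB; set a := fun q => _.
have sP : smoothC_on setT (fun q => invmx (F q)) by apply: smoothC_inv => //; exact: openT.
have sa : smoothC_on setT a by exact: (smoothC_colP _ openT).1 sP c.
have sFi i : smooth_field (fun q => row i (F q)).
  by apply/smooth_fieldP; exact: (smoothT_rowP F openT).1 sF i.
have E (X Y : M -> 'rV[R]_(n + n)) (x y : 'M[R]_1) : smooth_field X -> smooth_field Y ->
    (forall q, X q *m a q = x) -> (forall q, Y q *m a q = y) ->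
    X p *m rext a p *m (Y p)^T = - (bracket X Y p *m a p).
  move=> sX sY Xa Ya; rewrite (rextE p (X p) (Y p) sa).
  rewrite (dmat_pairing_bracket p sa sX sY).
  have -> : (fun q => Y q *m a q) = fun=> y by apply/funext.
  have -> : (fun q => X q *m a q) = fun=> x by apply/funext.
  by rewrite !dmat_cst subrr sub0r.
have Fa i q : row i (F q) *m a q = row i (col c 1%:M).
  by rewrite /a colE mulmxA -row_mul mulmxV // colE row_mul.
have JFa i q : endo_app J (fun q => row i (F q)) q *m a q = row i (col c J0).
  rewrite /endo_app -row_mul FJ /a !colE -!row_mul; congr (row i _).
  by rewrite !mulmxA mulmxK.
pose w := rext a p.
have key : F p *m (J p *m w *m (J p)^T) *m (F p)^T = F p *m w *m (F p)^T.
  have ent (A : 'M[R]_(n + n)) i j : (F p *m A *m (F p)^T) i j =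
      (row i (F p) *m A *m (row j (F p))^T) 0 0.
    by rewrite -row_mul tr_row colE mulmxA -row_mul -colE [RHS]mxE [RHS]mxE.
  apply/matrixP => i j; rewrite !ent; congr (fun_of_matrix _ 0 0).
  rewrite (E _ _ _ _ (sFi i) (sFi j) (Fa i) (Fa j)) -HB.
  rewrite -(E _ _ _ _ (smooth_endo_app J_acs (sFi i)) (smooth_endo_app J_acs (sFi j)) (JFa i) (JFa j)).
  by rewrite /endo_app trmx_mul !mulmxA.
have uT : (F p)^T \in unitmx by rewrite unitmx_tr.
apply: (can_inj (mulKmx (uF p))); exact: (can_inj (mulmxK uT) key).
Qed.

End CommutingToCoframe.

(** * The cycle of implications *)

Section Cycle.
Context {R : realType} {n : nat} {M : manifold R (n + n)}.
Context (J : M -> 'M[R]_(n + n)) (J_acs : almost_complex J).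
Local Notation C := (complex R).

Lemma row_free_colN a b k (A : 'M[R]_(a, k)) (B : 'M[R]_(b, k)) :
  row_free (col_mx A (- B)) = row_free (col_mx A B).
Proof.
have H (B' : 'M[R]_(b, k)) : row_free (col_mx A B') -> row_free (col_mx A (- B')).
  move=> /row_free_kerP h; apply/row_free_kerP => z.
  rewrite -[z]hsubmxK mul_row_col mulmxN -mulNmx => E.
  have := h (row_mx (lsubmx z) (- rsubmx z)); rewrite mul_row_col E -row_mx0.
  move=> /(_ erefl) /eq_row_mx [-> /eqP]; rewrite oppr_eq0 => /eqP ->.
  by rewrite row_mx0.
by apply/idP/idP => /H; rewrite ?opprK.
Qed.

(** The rows [X_k] and [J X_k] form a real frame; the real and imaginary parts of
   the (1,0)-forms are the columns of its inverse. *)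
Lemma commuting_frame_coframe : commuting_frame (n := n) J -> coframe11 (n := n) J.
Proof.
move=> [Z [sZ TZ fZ HZ]].
pose X k := re_field (Z k).
have sX k : smooth_field (X k) by have [] := sZ k.
have imZ k p : imM (Z k p) = - endo_app J (X k) p.
  have := TZ k p; rewrite /T10 mkC_real -{1 2}[Z k p]mkC_reim mkC_mul mkC_i !mulmx0.
  by rewrite subr0 add0r => /mkC_inj [E _]; rewrite -[LHS]opprK -E.
have ZE k : Z k = fun q => mkC (X k q) (- endo_app J (X k) q).
  by apply/funext => q; rewrite -imZ mkC_reim.
have HB k l p : bracket (X k) (X l) p = bracket (endo_app J (X k)) (endo_app J (X l)) p /\
    bracket (X k) (endo_app J (X l)) p = - bracket (endo_app J (X k)) (X l) p.
  have := HZ k l p; rewrite (ZE k) (ZE l) (cbracket_T10 J_acs p (sX k) (sX l)) -mkC00.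
  move=> /mkC_inj [/subr0_eq E1 E2]; split; first exact: E1.
  by move/eqP: E2; rewrite oppr_eq0 addr_eq0 => /eqP E2; exact: E2.
pose A p := \matrix_k X k p.
have rA k p : row k (A p) = X k p by rewrite rowK.
pose F p := col_mx (A p) (A p *m J p).
have FJ p : F p *m J p = std_complex *m F p.
  rewrite /F /std_complex mul_col_mx mul_block_col !mul0mx add0r addr0 mul1mx mulNmx mul1mx.
  by rewrite -mulmxA J_acs.2 mulmxN mulmx1.
have ZA p : \matrix_k Z k p = mkC (A p) (- (A p *m J p)).
  rewrite -[RHS]/(mkC (\matrix_k X k p) (- ((\matrix_k X k p) *m J p))) -matrix_T10.
  by apply/row_matrixP => k; rewrite !rowK ZE.
have uF p : F p \in unitmx.
  by rewrite -row_free_unit /F -(mkC_free _ (J_acs.2 p)) -ZA; exact: fZ.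
have rFl k : (fun q => row (lshift n k) (F q)) = X k.
  by apply/funext => q; rewrite rowKu rA.
have rFr k : (fun q => row (rshift n k) (F q)) = endo_app J (X k).
  by apply/funext => q; rewrite rowKd row_mul rA.
have sF : smoothT_on setT F.
  apply/(smoothT_rowP F openT) => i; apply/smooth_fieldP.
  case: (split_ordP i) => k ->; first by rewrite rFl.
  by rewrite rFr; exact: smooth_endo_app.
have sJX k : smooth_field (endo_app J (X k)) by exact: smooth_endo_app.
have HF p i j : bracket (endo_app J (fun q => row i (F q))) (endo_app J (fun q => row j (F q))) p
     = bracket (fun q => row i (F q)) (fun q => row j (F q)) p.
  case: (split_ordP i) => k ->; case: (split_ordP j) => l ->; rewrite ?rFl ?rFr ?(endo_appK J_acs).
  - by have [-> _] := HB k l p.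
  - by rewrite (bracketNr _ (sJX k) (sX l)); have [_ ->] := HB k l p.
  - rewrite (bracketNl _ (sX k) (sJX l)); have [_ ->] := HB k l p; exact: opprK.
  - rewrite (bracketNl _ (sX k) (smooth_fieldN (sX l))) (bracketNr _ (sX k) (sX l)) opprK.
    by have [-> _] := HB k l p.
pose P q := invmx (F q).
have sP : smoothC_on setT P by apply: smoothC_inv => //; exact: openT.
have JP p : J p *m P p = P p *m std_complex.
  apply: (can_inj (mulKmx (uF p))).
  by rewrite !mulmxA mulmxV // mul1mx FJ /P mulmxK.
pose a c q := col c (P q).
have sa c : smoothC_on setT (a c) by exact: (smoothC_colP P openT).1 sP c.
have Ja p : J p *m lsubmx (P p) = - rsubmx (P p) /\ J p *m rsubmx (P p) = lsubmx (P p).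
  have := JP p; rewrite -[P p]hsubmxK mul_mx_row /std_complex mul_row_block.
  rewrite !mulmx0 add0r addr0 mulmxN !mulmx1 => /eq_row_mx [].
  by rewrite hsubmxK.
have al k p : a (lshift n k) p = col k (lsubmx (P p)).
  by apply/colP => i; rewrite !mxE.
have ar k p : a (rshift n k) p = col k (rsubmx (P p)).
  by apply/colP => i; rewrite !mxE.
pose alpha k p := mkC (a (lshift n k) p) (a (rshift n k) p).
exists alpha; split.
- by move=> k; apply/smooth_formP; split; exact: sa.
- move=> k p; apply/(Lambda10P J_acs.2); rewrite mkC_mul mkC_i !mul0mx subr0 addr0.
  have [E1 E2] := Ja p.
  by rewrite al ar !colE !mulmxA E1 E2 mulNmx.
- move=> p; have [E1 E2] := Ja p.
  have -> : \matrix_k (alpha k p)^T = mkC (lsubmx (P p))^T (- ((lsubmx (P p))^T *m (J p)^T)).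
    rewrite -trmx_mul E1 linearN opprK.
    by apply/row_matrixP => k; rewrite rowK; apply/rowP => j; rewrite !mxE.
  rewrite mkC_free; last by rewrite -trmx_mul J_acs.2 linearN /= trmx1.
  rewrite -trmx_mul E1 linearN row_free_colN -tr_row_mx hsubmxK row_free_unit unitmx_tr.
  by rewrite unitmx_inv.
- move=> k p; rewrite ext_derE //; apply: (invariant_Lambda11 J_acs.2).
    by apply: mkC_antisymmetric; exact: rext_tr.
  have inv c := dual_coframe_invariant J_acs c sF uF FJ (HF p).
  apply: (etrans (mkC_conj _ _ _)).
  exact: (f_equal2 (@mkC R _ _) (inv (lshift n k)) (inv (rshift n k))).
Qed.

(** The real coframe is the matrix with columns [Re alpha_k], then [Im alpha_k]; in
   it [J] is constant, because the forms are of type (1,0). *)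
Lemma coframe_flat_connection : coframe11 (n := n) J -> flat_complex_connection J.
Proof.
move=> [alpha [sal L10 fal L11]].
pose Am p : 'M[R]_(n + n, n) := \matrix_(i, k) reM (alpha k p) i 0.
pose Bm p : 'M[R]_(n + n, n) := \matrix_(i, k) imM (alpha k p) i 0.
have cA k p : col k (Am p) = reM (alpha k p) by apply/colP => i; rewrite !mxE.
have cB k p : col k (Bm p) = imM (alpha k p) by apply/colP => i; rewrite !mxE.
have alE k : alpha k = fun p => mkC (reM (alpha k p)) (imM (alpha k p)).
  by apply/funext => p; rewrite mkC_reim.
have sk k : smoothC_on setT (fun p => reM (alpha k p)) /\
    smoothC_on setT (fun p => imM (alpha k p)).
  by apply/smooth_formP; rewrite -alE.
have JAB p : J p *m Am p = - Bm p /\ J p *m Bm p = Am p.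
  have H k : J p *m col k (Am p) = - col k (Bm p) /\ J p *m col k (Bm p) = col k (Am p).
    have /(Lambda10P J_acs.2) := L10 k p; rewrite -[alpha k p]mkC_reim mkC_mul mkC_i !mul0mx.
    by rewrite subr0 addr0 -cA -cB => /mkC_inj.
  split; apply: eq_cols => k.
    by have [E _] := H k; rewrite linearN /= -E !colE mulmxA.
  by have [_ E] := H k; rewrite -E !colE mulmxA.
pose P p := row_mx (Am p) (Bm p).
have JP p : J p *m P p = P p *m std_complex.
  have [E1 E2] := JAB p.
  rewrite /P mul_mx_row E1 E2 /std_complex mul_row_block !mulmx0 add0r addr0.
  by rewrite mulmxN !mulmx1.
have cPl k : (fun p => col (lshift n k) (P p)) = fun p => reM (alpha k p).
  by apply/funext => p; rewrite colKl cA.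
have cPr k : (fun p => col (rshift n k) (P p)) = fun p => imM (alpha k p).
  by apply/funext => p; rewrite colKr cB.
have sP : smoothC_on setT P.
  apply/(smoothC_colP P openT) => i; case: (split_ordP i) => k ->.
    by rewrite cPl; have [] := sk k.
  by rewrite cPr; have [] := sk k.
have uP p : P p \in unitmx.
  have [E1 E2] := JAB p.
  have := fal p.
  have -> : \matrix_k (alpha k p)^T = mkC (Am p)^T (- ((Am p)^T *m (J p)^T)).
    rewrite -trmx_mul E1 linearN opprK.
    apply/row_matrixP => k; rewrite rowK; apply/rowP => j; rewrite !mxE.
    by case: (alpha k p j 0).
  rewrite mkC_free; last by rewrite -trmx_mul J_acs.2 linearN /= trmx1.
  by rewrite -trmx_mul E1 linearN row_free_colN -tr_row_mx row_free_unit unitmx_tr.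
exists (flat_nabla P); split.
- exact: (flat_complex sP uP JP).
- exact: (flat_holonomy sP uP).
- apply: (flat_torsion11 sP uP J_acs.1) => c p.
  have inv k :
      J p *m rext (fun q => reM (alpha k q)) p *m (J p)^T =
        rext (fun q => reM (alpha k q)) p /\
      J p *m rext (fun q => imM (alpha k q)) p *m (J p)^T =
        rext (fun q => imM (alpha k q)) p.
    have [s1 s2] := sk k.
    have E : ext_der (alpha k) p =
        mkC (rext (fun q => reM (alpha k q)) p) (rext (fun q => imM (alpha k q)) p).
      by rewrite -(ext_derE p s1 s2) -alE.
    have := Lambda11_invariant J_acs.2 (L11 k p); rewrite E.
    move: (rext _ p) (rext _ p) => w w' h.
    by apply: mkC_inj; rewrite -mkC_conj.
  case: (split_ordP c) => k ->; first by rewrite cPl; have [] := inv k.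
  by rewrite cPr; have [] := inv k.
Qed.

(** Parallel fields commute up to the torsion, and [J] preserves them. *)
Lemma flat_connection_bracket (M_connected : connected [set: M]) :
  flat_complex_connection J -> bracket_frame (n := n) J.
Proof.
move=> [nabla [[nablaP nablaJ] hol T11]].
(* Without a base point, the manifold is empty and all is vacuous. *)
have [[p0 _]|nM] := pselect (exists p : M, True); last first.
  exists (fun _ _ => 0); split=> [k|p|k l _ p].
  - exact: smooth_field0.
  - by case: nM; exists p.
  - by case: nM; exists p.
have [U fU] := adapted_basis (J_acs.2 p0).
pose E := par_field hol M_connected p0.
pose X k := E (row k U).
have JE u : endo_app J (E u) = E (u *m J p0).
  exact: (par_field_endo nablaP hol M_connected p0 nablaJ J_acs.1).
have sE u : smooth_field (E u) by exact: par_field_smooth.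
have br u v q : bracket (E u) (E v) q = - torsion nabla (E u) (E v) q.
  exact: bracket_par_field.
have brJ u v q : bracket (E (u *m J p0)) (E (v *m J p0)) q = bracket (E u) (E v) q.
  by rewrite !br -!JE (T11 _ _ (sE u) (sE v)).
exists X; split.
- by move=> k; exact: sE.
- move=> p; pose G := par_frame hol M_connected p0 p.
  have uG : G \in unitmx by exact: par_frame_unit.
  have -> : \matrix_k X k p = U *m G by apply/row_matrixP => k; rewrite rowK row_mul.
  have -> : \matrix_k endo_app J (X k) p = U *m J p0 *m G.
    by apply/row_matrixP => k; rewrite rowK JE !row_mul.
  by rewrite -mul_col_mx row_free_unit unitmx_mul uG andbT -row_free_unit.
- move=> k l _ p; rewrite !JE /X; split; first by rewrite brJ.
  rewrite -[in RHS](brJ (row k U)).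
  have -> : E (row l U *m J p0 *m J p0) = fun q => - E (row l U) q.
    by rewrite -!JE (endo_appK J_acs).
  by rewrite (bracketNr _ (sE _) (sE _)) opprK.
Qed.

End Cycle.

Lemma conditions_tfae (R : realType) (n m : nat) (M : manifold R m)
    (M_connected : connected [set: M])
    (J : M -> 'M[R]_m) (J_acs : almost_complex J) : m = (n + n)%N ->
  [<-> bracket_frame (n := n) J; commuting_frame (n := n) J;
       coframe11 (n := n) J; flat_complex_connection J].
Proof.
move=> e; move: M M_connected J J_acs; rewrite e => M cM J J_acs.
tfae.
- exact: bracket_frame_commuting.
- exact: commuting_frame_coframe.
- exact: coframe_flat_connection.
- exact: flat_connection_bracket.
Qed.

Theorem proposition3p8 (R : realType) (n : nat) (M : manifold R n.*2)
    (M_connected : connected [set: M])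
    (J : M -> 'M[R]_(n.*2)) (J_acs : almost_complex J) :
  let cond_i :=
    exists X : 'I_n -> M -> 'rV[R]_(n.*2),
      [/\ forall k, smooth_field (X k),
          forall p, row_free (col_mx (\matrix_k X k p)
                                     (\matrix_k endo_app J (X k) p))
        & forall (k l : 'I_n), (k < l)%N -> forall p,
            bracket (X k) (X l) p
              = bracket (endo_app J (X k)) (endo_app J (X l)) p /\
            bracket (endo_app J (X k)) (X l) p
              = - bracket (X k) (endo_app J (X l)) p] in
  let cond_ii :=
    exists Z : 'I_n -> M -> 'rV[complex R]_(n.*2),
      [/\ forall k, smooth_cfield (Z k),
          forall k p, T10 J p (Z k p),
          forall p, row_free (\matrix_k Z k p)
        & forall k l p, cbracket (Z k) (Z l) p = 0] in
  let cond_iii :=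
    exists alpha : 'I_n -> M -> 'cV[complex R]_(n.*2),
      [/\ forall k, smooth_form (alpha k),
          forall k p, Lambda10 J p (alpha k p),
          forall p, row_free (\matrix_k (alpha k p)^T)
        & forall k p, Lambda11 J p (ext_der (alpha k) p)] in
  let cond_iv :=
    exists nabla : M -> 'rV[R]_(n.*2) -> (M -> 'rV[R]_(n.*2)) -> 'rV[R]_(n.*2),
      [/\ complex_connection J nabla, trivial_holonomy nabla
        & torsion11 J nabla] in
  [<-> cond_i; cond_ii; cond_iii; cond_iv] /\
  ([\/ cond_i, cond_ii, cond_iii | cond_iv] -> integrable_acs J).
Proof.
move=> cond_i cond_ii cond_iii cond_iv.
have equiv : [<-> cond_i; cond_ii; cond_iii; cond_iv].
  exact: (conditions_tfae M_connected J_acs (esym (addnn n))).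
split=> // H.
have : cond_iv.
  case: H => h //.
  - by apply: (equiv 0 3)%N.1 h.
  - by apply: (equiv 1 3)%N.1 h.
  - by apply: (equiv 2 3)%N.1 h.
by move=> [nabla [cnabla _ T11]]; exact: torsion11_integrable cnabla T11.
Qed.
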